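(* Consider the inequality-constrained problem (no equality constraints) on $\mathcal M$, let $(x^*,y^* )$ be a KKT pair, and consider the sequences $\{(x_k,y_k)\}$, $\{\mu_k\}$ of the trust-region interior point algorithm described in the context. Suppose that: (A1) $(x^*,y^* )$ satisfies strict complementarity, LICQ and SOSC; (A2) there are constants $0<\underline\kappa_\bullet<1<\overline\kappa_\bullet$ ($\bullet\in\{L,c\}$) such that $\underline\kappa_\bullet\mu_k\le\varphi_\bullet(\mu_k)\le\overline\kappa_\bullet\mu_k$ for all $k\in\{0,1,2,\dots\}$; (A3) $\mu_k^2=o(\mu_{k+1})$; (A4) $\mu_{k+1}\le\mu_k$ for all sufficiently large $k$; (A5) the retraction $R$ is second order; (A6) for every $\theta\in\{f,g_1,\dots,g_m\}$ there is $L_\theta>0$ such that, for all $x\in\mathcal M$ sufficiently close to $x^*$ and all sufficiently small $\xi\in T_x\mathcal M$, $\|\mathrm{Hess}(\theta\circ R_x)(\xi)-\mathrm{Hess}(\theta\circ R_x)(0_x)\|_{\rm op}\le L_\theta\|\xi\|_x$; (A7) the inputs $(x_0,y_0)$ and $\mu_{-1}>0$ are sufficiently close to $(x^*,y^* )$ and sufficiently small, respectively, and satisfy $\|\mathrm{grad}_x\mathcal L(x_0,y_0)\|_{x_0}\le\varphi_L(\mu_{-1})$, $\|G(x_0)y_0-\mu_{-1}\mathbf 1\|\le\varphi_c(\mu_{-1})$, $g(x_0)>0$, $y_0>0$; (A8) $\mu_{k+1}=o(\mu_k)$; (A9) for every $\theta\in\{f,g_1,\dots,g_m\}$ there is $L'_\theta>0$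 such that, for all $x\in\mathcal M$ with $\mathrm{dist}(x,x^* )<\mathrm{inj}(x^* )$, $\|\mathrm{Hess}\,\theta(x)-P_{x\leftarrow x^*}\circ\mathrm{Hess}\,\theta(x^* )\circ P_{x^*\leftarrow x}\|_{\rm op}\le L'_\theta\,\mathrm{dist}(x,x^* )$. Then the sequence $\{(x_k,y_k)\}$ generated by the algorithm converges to $(x^*,y^* )$, and the convergence rate is superlinear. Moreover, $\{(x_k,y_k)\}$ converges near-quadratically if the barrier parameters are updated by $\mu_{k+1}\leftarrow c\,\mu_k^{1+r}$ with $0<c<1$, $0<r<1$ and $0<\mu_0\le1$; that is, for any given $r\in(0,1)$, the sequence generated with this update converges to $(x^*,y^* )$ with order at least $1+r$.
   Context: **Problem.** $\mathcal M$ is an $n$-dimensional connected complete Riemannian manifold with metric $\langle\cdot,\cdot\rangle_x$, norm $\|\cdot\|_x$, Riemannian distance $\mathrm{dist}$, injectivity radius $\mathrm{inj}(x)$; $f,g_i\ (i\in\mathcal I=\{1,\dots,m\}):\mathcal M\to\mathbb R$ are twice continuously differentiable. Minimize $f(x)$ subject to $g_i(x)\ge0$, $i\in\mathcal I$. $\mathcal L(x,y)=f(x)-y^\top g(x)$, $G(x)=\mathrm{diag}(g(x))$, $Y=\mathrm{diag}(y)$, $\mathbf 1$ all-ones vector, $\mathcal G_x[v]=\sum_iv_i\,\mathrm{grad}\,g_i(x)$, $\mathcal G_x^*[\xi]=(\langle\mathrm{grad}\,g_i(x),\xi\rangle_x)_{i}$. For $\mathrm{dist}(x,x^* )<\mathrm{inj}(x^*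 )$, $P_{x\leftarrow x^*}:T_{x^*}\mathcal M\to T_x\mathcal M$ is parallel transport along the unique minimizing geodesic and $P_{x^*\leftarrow x}$ its inverse. **KKT.** A KKT pair satisfies $\mathrm{grad}_x\mathcal L(x^*,y^* )=0$, $G(x^* )y^*=0$, $g(x^* )\ge0$, $y^*\ge0$. $\mathcal A(x^* )=\{i:g_i(x^* )=0\}$. Strict complementarity: for every $i$ exactly one of $y_i^*,g_i(x^* )$ is zero. LICQ: $\{\mathrm{grad}\,g_i(x^* )\}_{i\in\mathcal A(x^* )}$ is linearly independent. SOSC: $\langle\mathrm{Hess}_x\mathcal L(x^*,y^* )[\xi],\xi\rangle>0$ for all nonzero $\xi\in T_{x^*}\mathcal M$ with $\langle\mathrm{grad}\,g_i(x^* ),\xi\rangle=0$ for $i\in\mathcal A(x^* )$ with $y_i^*>0$ and $\ge0$ for $i\in\mathcal A(x^* )$ with $y_i^*=0$. **Retraction.** $R:T\mathcal M\to\mathcal M$ is smooth with $R_x(0_x)=x$, $\mathrm DR_x(0_x)=\mathrm{id}$; it is second order if each curve $t\mapsto R_x(t\xi)$ has zero acceleration at $t=0$. $\mathrm{Hess}(\theta\circ R_x)$ is the Hessian on the Euclidean space $T_x\mathcal M$. **Trust-region subproblem.** For $g(x)>0$: $H(x,y)=\mathrm{Hess}f(x)-\sum_iy_i\mathrm{Hess}g_i(x)+\mathcal G_xYG(x)^{-1}\mathcal G_x^*$ and $c_\mu(x)=\mathrm{grad}f(x)-\mu\,\mathcal G_x[G(x)^{-1}\mathbf 1]$. Subproblem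 $\mathrm{TRS}(x,y,\mu,\Delta)$: minimize $\tfrac12\langle H(x,y)[d],d\rangle_x+\langle c_\mu(x),d\rangle_x$ over $d\in T_x\mathcal M$, $\|d\|_x\le\Delta$. **Algorithm.** A forcing function is a continuous $\varphi:[0,\infty)\to[0,\infty)$ with $\varphi(\mu)=0$ iff $\mu=0$; $\varphi_L,\varphi_c,\varphi_s$ are given forcing functions. Parameters: $\Delta_{\max}>0$, $\Delta_0^{\rm init},\Delta_{\min}^{\rm init}\in(0,\Delta_{\max}]$. A point $(x,y)$ satisfies the stopping conditions with parameter $\mu$ if $\|\mathrm{grad}_x\mathcal L(x,y)\|_x\le\varphi_L(\mu)$, $\|G(x)y-\mu\mathbf 1\|\le\varphi_c(\mu)$, $g(x)>0$, $y>0$, and $\lambda_{\min}[H(x,y)]\ge-\varphi_s(\mu)$. Input: $(x_0,y_0)$ with $g(x_0)>0,y_0>0$, and $\mu_{-1}>0$. Outer iteration $k=0,1,\dots$: set $\mu_k>0$ so that $\lim_{k\to\infty}\mu_k=0$; obtain $(x_{k+1},y_{k+1})$ satisfying the stopping conditions with parameter $\mu_k$, and a radius $\Delta_k^{\rm final}>0$, from the inner iteration started at $(x_k,y_k)$ with $\mu_k$ and initial radius $\Delta_k^{\rm init}$; set $\Delta_{k+1}^{\rm init}=\max(\Delta_k^{\rm final},\Delta_{\min}^{\rm init})$. Inner iteration (barrier parameter $\mu$, starting point $(x^0,y^0)$, radius $\Delta^0$), $\ell=0,1,\dots$: compute a global minimizer $d_x$ of $\mathrm{TRS}(x^\ell,y^\ell,\mu,\Delta^\ell)$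 and $d_y=-y^\ell+\mu G(x^\ell)^{-1}\mathbf 1-Y^\ell G(x^\ell)^{-1}\mathcal G_{x^\ell}^*[d_x]$; if $(R_{x^\ell}(d_x),y^\ell+d_y)$ satisfies the stopping conditions with parameter $\mu$, return this point and final radius $\Delta^\ell$; otherwise update $(x^{\ell+1},y^{\ell+1})$ (with $g(x^{\ell+1})>0$, $y^{\ell+1}>0$) and $\Delta^{\ell+1}>0$ using $d_x,d_y$ by a trust-region rule (whose details play no role in this statement) and continue. **Notation.** $a=o(b)$ means $a/b\to0$. **Rates.** Let $(\mathcal O,\psi)$ be a chart of $\mathcal M$ with $x^*\in\mathcal O$ and $\hat w=(\psi(x),y)$ for $w=(x,y)$. $w_k\to w^*$ superlinearly if $\|\hat w_{k+1}-\hat w^*\|/\|\hat w_k-\hat w^*\|\to0$; with order at least $q>0$ if there are $C,K\ge0$ with $\|\hat w_{k+1}-\hat w^*\|\le C\|\hat w_k-\hat w^*\|^q$ for all $k\ge K$. *)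

(* Defs.v *)
From HB Require Import structures.
From mathcomp Require Import all_boot all_order all_algebra.
From mathcomp Require Import all_classical all_reals all_analysis.

Set Implicit Arguments.
Unset Strict Implicit.
Unset Printing Implicit Defensive.

Import Order.TTheory GRing.Theory Num.Theory.
Import numFieldNormedType.Exports.

Local Open Scope classical_set_scope.
Local Open Scope ring_scope.

(** * Differentiability classes between normed spaces *)

(* Used only for finite-dimensional V and open U, where continuity of all
   iterated directional derivatives is the usual notion of class C^k. *)
Fixpoint Ck_on (R : realType) (V W : normedModType R) (k : nat) (U : set V)
    (F : V -> W) : Prop :=
  (forall u, U u -> {for u, continuous F}) /\
  if k is k'.+1 then
    forall v : V, (forall u, U u -> derivable F u v) /\
                  Ck_on k' U (fun u => 'D_v F u)
  else True.

Definition smooth_on (R : realType) (V W : normedModType R) (U : set V)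
    (F : V -> W) : Prop := forall k : nat, Ck_on k U F.

(** * Smooth manifolds *)

(* [pt c] is the inverse of [coord c]; both are total functions, meaningful on
   [dom c] and on its image only. *)
Record chart (R : realType) (n : nat) (T : Type) := Chart {
  dom : set T;
  coord : T -> 'rV[R]_n;
  pt : 'rV[R]_n -> T }.

Section Charts.
Context (R : realType) (n : nat) (T : topologicalType).
Implicit Types c : chart R n T.

Definition codom c : set 'rV[R]_n := coord c @` dom c.

Definition is_chart c : Prop :=
  [/\ open (dom c),
      open (codom c),
      forall x, dom c x -> pt c (coord c x) = x,
      forall x, dom c x -> {for x, continuous (coord c)} &
      forall u, codom c u -> {for u, continuous (pt c)}].

Definition transition c c' : 'rV[R]_n -> 'rV[R]_n := coord c' \o pt c.

Definition compatible c c' : Prop :=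
  smooth_on (coord c @` (dom c `&` dom c')) (transition c c').

End Charts.

(* [chart_at] selects one chart around each point.  The tangent space at x is
   'rV[R]_n: a tangent vector is given by its coordinates in [chart_at x]. *)
Record smoothManifold (R : realType) (n : nat) := SmoothManifold {
  carrier :> topologicalType;
  atlas : set (chart R n carrier);
  chart_at : carrier -> chart R n carrier;
  manifold_hausdorff : hausdorff_space carrier;
  manifold_second_countable : @second_countable carrier;
  atlas_chart : forall c, atlas c -> is_chart c;
  atlas_compatible : forall c c', atlas c -> atlas c' -> compatible c c';
  chart_at_atlas : forall x, atlas (chart_at x);
  chart_at_dom : forall x, dom (chart_at x) x }.

Section Manifold.
Context (R : realType) (n : nat) (M : smoothManifold R n).
Implicit Types (c : chart R n M) (x : M).

(* The charts of the smooth structure (the maximal atlas). *)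
Definition smooth_chart c : Prop :=
  is_chart c /\
  forall c', atlas c' -> compatible c c' /\ compatible c' c.

Definition here x : 'rV[R]_n := coord (chart_at x) x.

(* Change of coordinates of tangent vectors: [to_chart c x v] are the
   coordinates in c of v : T_x M, and [from_chart c u v] is the tangent vector
   at [pt c u] whose coordinates in c are v. *)
Definition to_chart c x (v : 'rV[R]_n) : 'rV[R]_n :=
  'D_v (transition (chart_at x) c) (here x).

Definition from_chart c (u v : 'rV[R]_n) : 'rV[R]_n :=
  'D_v (transition c (chart_at (pt c u))) u.

(* Maps from an open subset U of a normed space to M; openness of all the
   preimages expresses continuity. *)
Definition Ck_map (V : normedModType R) (k : nat) (U : set V) (F : V -> M) :=
  forall c, atlas c ->
    open (U `&` F @^-1` dom c) /\
    Ck_on k (U `&` F @^-1` dom c) (coord c \o F).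

(* Maps from an open subset S of M to a normed space. *)
Definition Ck_fun (W : normedModType R) (k : nat) (S : set M) (h : M -> W) :=
  forall c, atlas c -> Ck_on k (coord c @` (dom c `&` S)) (h \o pt c).

Definition velocity (gam : R -> M) (t : R) : 'rV[R]_n :=
  derive1 (coord (chart_at (gam t)) \o gam) t.

(* E restricts to a diffeomorphism from the open set U onto an open set. *)
Definition diffeo_on (U : set 'rV[R]_n) (E : 'rV[R]_n -> M) : Prop :=
  [/\ forall k, Ck_map k U E, open (E @` U) &
      exists2 h : M -> 'rV[R]_n,
        forall v, U v -> h (E v) = v &
        forall k, Ck_fun k (E @` U) h].

End Manifold.

(** * Riemannian manifolds *)

Section Gram.
Context (R : realType) (n : nat) (M : smoothManifold R n).
Variable met : M -> 'M[R]_n.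

Definition met_inner (x : M) (u v : 'rV[R]_n) : R := (u *m met x *m v^T) 0 0.

(* Gram matrix of the coordinate frame of the chart c. *)
Definition met_gram (c : chart R n M) (u : 'rV[R]_n) : 'M[R]_n :=
  \matrix_(i, j) met_inner (pt c u) (from_chart c u (delta_mx 0 i))
                                    (from_chart c u (delta_mx 0 j)).

End Gram.

Record riemannianManifold (R : realType) (n : nat) := RiemannianManifold {
  smooth_manifold :> smoothManifold R n;
  metric : smooth_manifold -> 'M[R]_n;
  metric_sym : forall x, (metric x)^T = metric x;
  metric_pos : forall x v, v != 0 -> 0 < met_inner metric x v v;
  metric_smooth : forall c, atlas c -> smooth_on (codom c) (met_gram metric c) }.

Section Riemannian.
Context (R : realType) (n : nat) (M : riemannianManifold R n).
Implicit Types (c : chart R n M) (x y : M) (u v w xi : 'rV[R]_n) (t : R).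

Definition inner x v w : R := met_inner (@metric _ _ M) x v w.
Definition norm x v : R := Num.sqrt (inner x v v).
Definition gram c u : 'M[R]_n := met_gram (@metric _ _ M) c u.

Definition opnorm x (A : 'rV[R]_n -> 'rV[R]_n) : R :=
  sup [set norm x (A v) | v in [set v | norm x v <= 1]].

(** Levi-Civita connection *)

Definition dgram c u (i j l : 'I_n) : R :=
  'D_(delta_mx 0 i) (fun u' => gram c u' j l : R) u.

Definition christoffel c u (k i j : 'I_n) : R :=
  2^-1 * \sum_l invmx (gram c u) k l *
    (dgram c u i j l + dgram c u j i l - dgram c u l i j).

Definition christoffel_apply c u v w : 'rV[R]_n :=
  \row_k \sum_i \sum_j christoffel c u k i j * v 0 i * w 0 j.

(* Covariant derivative, in the chart c, of the vector field V along the curve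
   p, both given in coordinates. *)
Definition cov_along c (p V : R -> 'rV[R]_n) t : 'rV[R]_n :=
  derive1 V t + christoffel_apply c (p t) (derive1 p t) (V t).

Definition acceleration (gam : R -> M) t : 'rV[R]_n :=
  let c := chart_at (gam t) in
  let p := coord c \o gam in cov_along c p (derive1 p) t.

Definition geodesic (gam : R -> M) : Prop :=
  Ck_map 2 [set: R^o] gam /\ forall t, acceleration gam t = 0.

(* V t is a vector of T_(gam t) M, hence given in the chart [chart_at (gam t)];
   it is differentiated at t in the chart selected at gam t. *)
Definition parallel_field (gam : R -> M) (V : R -> 'rV[R]_n) : Prop :=
  forall t, let c := chart_at (gam t) in
    let Vc := fun s => to_chart c (gam s) (V s) in
    derivable (Vc : R^o -> _) t 1 /\ cov_along c (coord c \o gam) Vc t = 0.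

(* P : T_(gam 0) M -> T_(gam 1) M is the parallel transport along gam. *)
Definition parallel_transport (gam : R -> M) (P : 'rV[R]_n -> 'rV[R]_n) :=
  forall v, exists2 V, parallel_field gam V & V 0 = v /\ V 1 = P v.

(** Gradient and Hessian *)

Definition grad_in c (h : M -> R) u : 'rV[R]_n :=
  (\row_j 'D_(delta_mx 0 j) (h \o pt c : _ -> R) u) *m invmx (gram c u).

Definition grad (h : M -> R) x : 'rV[R]_n := grad_in (chart_at x) h (here x).

(* Hess h x [xi] is the covariant derivative of the field grad h along xi. *)
Definition Hess (h : M -> R) x xi : 'rV[R]_n :=
  let c := chart_at x in
  'D_xi (grad_in c h) (here x) +
  christoffel_apply c (here x) xi (grad h x).

(* Gradient and Hessian of a function on the Euclidean space (T_x M, inner x) *)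
Definition tgrad x (h : 'rV[R]_n -> R) v : 'rV[R]_n :=
  (\row_j 'D_(delta_mx 0 j) (h : _ -> R) v) *m invmx (metric x).

Definition tHess x (h : 'rV[R]_n -> R) v xi : 'rV[R]_n := 'D_xi (tgrad x h) v.

(** Distance, completeness, injectivity radius *)

Definition curve_length (gam : R -> M) : R :=
  \int[lebesgue_measure]_(t in `[0, 1]) norm (gam t) (velocity gam t).

(* Lengths of the piecewise C^1 curves from x to y: concatenations of C^1
   curves parametrized by [0, 1]. *)
Inductive path_length : M -> M -> R -> Prop :=
| PathC1 (gam : R -> M) : Ck_map 1 [set: R^o] gam ->
    path_length (gam 0) (gam 1) (curve_length gam)
| PathCat x y z l l' : path_length x y l -> path_length y z l' ->
    path_length x z (l + l').

Definition dist x y : R := inf [set l | path_length x y l].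

Definition complete_manifold : Prop :=
  forall z : nat -> M,
    (forall e, 0 < e -> exists N, forall i j, (N <= i)%N -> (N <= j)%N ->
       dist (z i) (z j) < e) ->
    exists l, dist (z k) l @[k --> \oo] --> (0 : R).

Definition is_exp x v y : Prop :=
  exists gam, [/\ geodesic gam, gam 0 = x, velocity gam 0 = v & gam 1 = y].

Definition inj_radius x : \bar R :=
  ereal_sup [set r%:E | r in [set r : R | 0 < r /\
    exists2 E : 'rV[R]_n -> M,
      forall v, norm x v < r -> is_exp x v (E v) &
      diffeo_on [set v | norm x v < r] E]].

Definition minimizing_geodesic x y (gam : R -> M) : Prop :=
  [/\ geodesic gam, gam 0 = x, gam 1 = y & curve_length gam = dist x y].

(** Retractions *)

(* Smoothness of Rt : TM -> M is expressed in the charts of TM induced by the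
   charts of M. *)
Definition retraction (Rt : M -> 'rV[R]_n -> M) : Prop :=
  [/\ forall c k, atlas c ->
        Ck_map k [set p : 'rV[R]_n * 'rV[R]_n | codom c p.1]
          (fun p => Rt (pt c p.1) (from_chart c p.1 p.2)),
      forall x, Rt x 0 = x &
      forall x xi, 'D_xi (coord (chart_at x) \o Rt x) 0 = xi].

Definition second_order (Rt : M -> 'rV[R]_n -> M) : Prop :=
  forall x xi, acceleration (fun t => Rt x (t *: xi)) 0 = 0.

End Riemannian.

(** * The optimization problem *)

Definition enorm (R : realType) (p : nat) (v : 'rV[R]_p) : R :=
  Num.sqrt (\sum_i v 0 i ^+ 2).

Section Problem.
Context (R : realType) (n m : nat) (M : riemannianManifold R n).
Variables (f : M -> R) (g : 'I_m -> M -> R).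
Implicit Types (x : M) (y v : 'rV[R]_m) (d xi : 'rV[R]_n) (mu Delta : R).

Definition lagrangian y x : R := f x - \sum_i y 0 i * g i x.

(* The residual G(x) y - mu 1. *)
Definition compl_res x y mu : 'rV[R]_m := \row_i (g i x * y 0 i - mu).

Definition calG x v : 'rV[R]_n := \sum_i v 0 i *: grad (g i) x.
Definition calG_adj x xi : 'rV[R]_m := \row_i inner x (grad (g i) x) xi.

Definition strictly_feasible x y : Prop :=
  (forall i, 0 < g i x) /\ (forall i, 0 < y 0 i).

Definition KKT x y : Prop :=
  [/\ grad (lagrangian y) x = 0, forall i, g i x * y 0 i = 0,
      forall i, 0 <= g i x & forall i, 0 <= y 0 i].

Definition strict_complementarity x y : Prop :=
  forall i, (y 0 i == 0) (+) (g i x == 0).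

Definition LICQ x : Prop :=
  free [seq grad (g i) x | i <- enum 'I_m & g i x == 0].

Definition SOSC x y : Prop :=
  forall xi, xi != 0 ->
    (forall i, g i x = 0 -> 0 < y 0 i -> inner x (grad (g i) x) xi = 0) ->
    (forall i, g i x = 0 -> y 0 i = 0 -> 0 <= inner x (grad (g i) x) xi) ->
    0 < inner x (Hess (lagrangian y) x xi) xi.

(** * The trust-region interior point method *)

Definition opH x y xi : 'rV[R]_n :=
  Hess f x xi - \sum_i y 0 i *: Hess (g i) x xi +
  calG x (\row_i (y 0 i / g i x * calG_adj x xi 0 i)).

Definition barrier_grad mu x : 'rV[R]_n :=
  grad f x - mu *: calG x (\row_i (g i x)^-1).

Definition TRS_obj x y mu d : R :=
  2^-1 * inner x (opH x y d) d + inner x (barrier_grad mu x) d.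

Definition TRS_sol x y mu Delta d : Prop :=
  norm x d <= Delta /\
  forall d', norm x d' <= Delta -> TRS_obj x y mu d <= TRS_obj x y mu d'.

Definition dual_step x y mu d : 'rV[R]_m :=
  \row_i (- y 0 i + mu / g i x - y 0 i / g i x * calG_adj x d 0 i).

Definition eigenvalue_min (A : 'rV[R]_n -> 'rV[R]_n) : R :=
  inf [set a : R | exists2 v, v != 0 & A v = a *: v].

Definition forcing (phi : R -> R) : Prop :=
  [/\ {within `[0, +oo[, continuous phi}, forall t, 0 <= t -> 0 <= phi t &
      forall t, 0 <= t -> (phi t = 0 <-> t = 0)].

Variables (Rt : M -> 'rV[R]_n -> M) (phiL phic phis : R -> R).

Definition approx_stationary mu x y : Prop :=
  [/\ norm x (grad (lagrangian y) x) <= phiL mu,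
      enorm (compl_res x y mu) <= phic mu & strictly_feasible x y].

Definition stopping mu x y : Prop :=
  approx_stationary mu x y /\ - phis mu <= eigenvalue_min (opH x y).

(* [inner_iter mu x y Delta x' y' Delta']: the inner iteration started at
   (x, y) with radius Delta can return (x', y') with final radius Delta'.
   The update after a rejected step is left nondeterministic, which covers
   every trust-region rule. *)
Inductive inner_iter mu : M -> 'rV[R]_m -> R -> M -> 'rV[R]_m -> R -> Prop :=
| InnerStop x y Delta d :
    TRS_sol x y mu Delta d ->
    stopping mu (Rt x d) (y + dual_step x y mu d) ->
    inner_iter mu x y Delta (Rt x d) (y + dual_step x y mu d) Delta
| InnerNext x y Delta d x1 y1 Delta1 x' y' Delta' :
    TRS_sol x y mu Delta d ->
    ~ stopping mu (Rt x d) (y + dual_step x y mu d) ->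
    strictly_feasible x1 y1 -> 0 < Delta1 ->
    inner_iter mu x1 y1 Delta1 x' y' Delta' ->
    inner_iter mu x y Delta x' y' Delta'.

(* The barrier parameters mu_(-1), mu_0, mu_1, ... are the values of nu at
   0, 1, 2, ...; so outer iteration k uses nu k.+1.  Asymptotic conditions on
   a parameter schedule do not constrain its first terms, so "mu_(-1) small"
   is meaningful for the runs along the tails of a fixed schedule mu, i.e. for
   nu = fun k => mu (K + k). *)
Definition outer_run (Delta0 Delta_min : R) (nu : nat -> R)
    (x : nat -> M) (y : nat -> 'rV[R]_m) : Prop :=
  strictly_feasible (x 0%N) (y 0%N) /\
  exists Dinit Dfinal : nat -> R,
    [/\ Dinit 0%N = Delta0,
        forall k, Dinit k.+1 = Num.max (Dfinal k) Delta_min,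
        forall k, 0 < Dfinal k &
        forall k, inner_iter (nu k.+1) (x k) (y k) (Dinit k)
                             (x k.+1) (y k.+1) (Dfinal k)].

End Problem.

(** * Assumptions and rates *)

(* Uniform Lipschitz-type bound at the origin for the pulled-back Hessians. *)
Definition pullback_Hess_lipschitz (R : realType) (n : nat)
    (M : riemannianManifold R n) (Rt : M -> 'rV[R]_n -> M) (xs : M)
    (h : M -> R) : Prop :=
  exists2 L : R, 0 < L &
  exists2 r : R, 0 < r &
  \forall x \near xs, forall xi, norm x xi < r ->
    opnorm x (fun v => tHess x (h \o Rt x) xi v - tHess x (h \o Rt x) 0 v)
      <= L * norm x xi.

(* P and Q are the transports from xs to x and back. *)
Definition Hess_lipschitz (R : realType) (n : nat)
    (M : riemannianManifold R n) (xs : M) (h : M -> R) : Prop :=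
  exists2 L : R, 0 < L &
  forall x : M, ((dist x xs)%:E < inj_radius xs)%E ->
  forall gam P Q, minimizing_geodesic xs x gam -> parallel_transport gam P ->
    cancel P Q -> cancel Q P ->
    opnorm x (fun v => Hess h x v - P (Hess h xs (Q v))) <= L * dist x xs.

Section Rates.
Context (R : realType) (n m : nat) (M : riemannianManifold R n).
Variables (psi : chart R n M) (xs : M) (ys : 'rV[R]_m).
Variables (x : nat -> M) (y : nat -> 'rV[R]_m).

Definition chart_err (k : nat) : R :=
  enorm (row_mx (coord psi (x k)) (y k) - row_mx (coord psi xs) ys).

(* chart_err k.+1 / chart_err k --> 0, without dividing: the ratio would be
   a junk value at an index where chart_err k = 0. *)
Definition superlinear : Prop :=
  forall e : R, 0 < e ->
    \forall k \near \oo, chart_err k.+1 <= e * chart_err k.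

Definition order_at_least (q : R) : Prop :=
  exists2 C : R, 0 <= C &
  \forall k \near \oo, chart_err k.+1 <= C * chart_err k `^ q.

End Rates.

(* Main.v *)
(* In a fixed chart at x*, a second-order retraction turns the Riemannian Hessian of
   h into the ordinary Hessian of the pullback v |-> h (R_x v) at 0, so (A6) gives
   gradients and values along the retraction a quadratic Taylor remainder, uniformly
   in x near x*. LICQ, SOSC and strict complementarity make the primal-dual Jacobian
   invertible and the barrier Hessian positive definite near the KKT pair w*. From a
   point meeting the stopping test for mu_(k-1), the linear system for barrier
   parameter mu_k has a solution of length O(mu_(k-1)), which lies inside the trust
   region because the initial radii are bounded below, and so is the unique
   minimizer: the first trial step is a Newton step. Its new residual is
   O(mu_(k-1)^2) = o(mu_k), so the stopping test accepts it and every outer iteration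
   ends after one inner step. The residual at mu = 0 is comparable both to the error
   |w - w*| and, by the stopping test, to mu, whence |w_k - w*| is comparable to
   mu_(k-1) and the rates of (mu_k) carry over. When there is no constraint mu plays
   no role and the iteration is plain Newton, which converges quadratically. *)

From HB Require Import structures.
From mathcomp Require Import all_boot all_order all_algebra.
From mathcomp Require Import all_classical all_reals all_analysis.
From mathcomp Require Import ring lra.
Require Import Defs.

Set Implicit Arguments.
Unset Strict Implicit.
Unset Printing Implicit Defensive.

Import Order.TTheory GRing.Theory Num.Theory.
Import numFieldNormedType.Exports.

Local Open Scope classical_set_scope.
Local Open Scope ring_scope.

(** * Calculus in finite dimension *)

(** The tangent space at [x] is read in [chart_at x], which may jump as [x] moves, so gradients and
    Hessians at neighbouring points cannot be compared entry by entry. The estimates are therefore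
    made in the one chart chosen at [xs]; the frame change [tanmx] may be discontinuous, but in the
    metric it is absorbed into the Gram matrix, which is continuous. Hessians are taken from
    pullbacks for the same reason: second derivatives on a tangent space change by a linear
    substitution, so no transformation law for Christoffel symbols is needed. The barrier Hessian
    has no limit at the KKT pair, because y_i / g_i blows up on active constraints; it is bounded
    below by a continuous matrix instead. Positivity of the trial point comes from its
    complementarity residual being below mu: every product g_i y_i is then positive, and strict
    complementarity already makes one factor positive. The bound of mu by the error uses one product
    g_i y_i >= mu / 2, hence the existence of a constraint; this is what separates the case m =
    0. *)

Section CkCalculus.
Context (R : realType).
Implicit Types V W : normedModType R.

Lemma derive_is V W (F : V -> W) u v D : is_derive u v F D -> 'D_v F u = D.
Proof. by case. Qed.

Lemma derivable_is V W (F : V -> W) u v D : is_derive u v F D -> derivable F u v.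
Proof. by case. Qed.

Lemma Ck_on_continuous V W k (U : set V) (F : V -> W) u :
  Ck_on k U F -> U u -> {for u, continuous F}.
Proof. by case: k => [|k] [+ _]; apply. Qed.

Lemma Ck_on_derivable V W k (U : set V) (F : V -> W) u v :
  Ck_on k.+1 U F -> U u -> derivable F u v.
Proof. by move=> [_ /(_ v)[+ _]]; apply. Qed.

Lemma Ck_on_derive V W k (U : set V) (F : V -> W) v :
  Ck_on k.+1 U F -> Ck_on k U (fun u => 'D_v F u).
Proof. by move=> [_ /(_ v)[]]. Qed.

Lemma Ck_on_pred V W k (U : set V) (F : V -> W) : Ck_on k.+1 U F -> Ck_on k U F.
Proof.
elim: k F => [|k IH] F [cF dF]; split => // v.
by have [dFv ?] := dF v; split => //; exact: IH.
Qed.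

Lemma Ck_on_subset V W k (U U' : set V) (F : V -> W) :
  U' `<=` U -> Ck_on k U F -> Ck_on k U' F.
Proof.
move=> sU; elim: k F => [|k IH] F [cF dF]; split; try by move=> u /sU /cF.
  by [].
by move=> v; have [dFv CF] := dF v; split; [move=> u /sU /dFv | exact: IH].
Qed.

(** Openness of [U] matters: a derivative at a point of [U] depends on the values nearby, where [F]
    and [G] must still agree. *)
Lemma Ck_on_eq V W k (U : set V) (F G : V -> W) :
  open U -> (forall u, U u -> F u = G u) -> Ck_on k U F -> Ck_on k U G.
Proof.
move=> oU; have nU u : U u -> nbhs u U by move=> Uu; exact: open_nbhs_nbhs.
elim: k F G => [|k IH] F G FG [cF dF].
  split => // u Uu; rewrite /prop_for /continuous_at -FG//.
  apply: cvg_trans (cF _ Uu); apply: near_eq_cvg.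
  by apply: filterS (nU _ Uu) => w Uw; rewrite FG.
have nFG u : U u -> {near u, F =1 G}.
  by move=> Uu; apply: filterS (nU _ Uu) => w Uw; rewrite FG.
split=> [u Uu|v].
  rewrite /prop_for /continuous_at -FG//.
  apply: cvg_trans (cF _ Uu); apply: near_eq_cvg.
  by apply: filterS (nU _ Uu) => w Uw; rewrite FG.
have [dFv CF] := dF v; split.
  by move=> u Uu; apply: near_eq_derivable (nFG _ Uu) _; exact: dFv.
by apply: IH CF => u Uu; apply: near_eq_derive; exact: nFG.
Qed.

Lemma continuous_mxP (T : topologicalType) p q (F : T -> 'M[R]_(p, q)) (t : T) :
  {for t, continuous F} <-> forall i j, {for t, continuous (fun s => F s i j)}.
Proof.
split=> [cF i j|cF].
  apply: (@continuous_comp _ _ _ F (fun M : 'M[R]_(p, q) => M i j)) => //.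
  exact: coord_continuous.
apply/cvgrPdist_le => /= e e0; near=> x.
rewrite /Num.Def.normr/= mx_normrE (bigmax_le _ (ltW e0))//= => i _.
rewrite !mxE; move: i; near: x; apply: filter_forall => /= i.
by have /cvgrPdist_le/(_ _ e0) := cF i.1 i.2.
Unshelve. all: by end_near. Qed.

Lemma derive_mxE V p q (F : V -> 'M[R]_(p, q)) u v i j :
  derivable F u v -> ('D_v F u) i j = 'D_v (fun w => F w i j) u.
Proof. by move=> dF; rewrite derive_mx// mxE. Qed.

Lemma Ck_on_coord V p q k (U : set V) (F : V -> 'M[R]_(p, q)) i j :
  open U -> Ck_on k U F -> Ck_on k U (fun u => F u i j).
Proof.
move=> oU; elim: k F => [|k IH] F [cF dF]; split.
- by move=> u /cF/continuous_mxP.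
- by [].
- by move=> u /cF/continuous_mxP.
move=> v; have [dFv CF] := dF v; split.
  by move=> u /dFv/derivable_mxP.
apply: (Ck_on_eq oU _ (IH _ CF)) => u Uu.
by rewrite derive_mxE//; exact: dFv.
Qed.

(** The difference quotient of the slice in direction [b] is literally that of [F] in direction
    [(0, b)], so the induction on [k] stays inside directional derivatives of [F]. *)
Lemma Ck_on_slice (V1 V2 W : normedModType R) k (U : set (V1 * V2))
    (F : V1 * V2 -> W) u :
  Ck_on k U F -> Ck_on k [set v | U (u, v)] (fun v => F (u, v)).
Proof.
have E (G : V1 * V2 -> W) b v : (fun h : R => h^-1 *:
    (((fun v => G (u, v)) \o shift v) (h *: b) - G (u, v))) =
    (fun h : R => h^-1 *: ((G \o shift (u, v)) (h *: ((0 : V1), b)) - G (u, v))).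
  apply/funext => h /=; congr (_ *: (G _ - _)).
  by rewrite /shift /= /GRing.add /= /add_pair /= scaler0 add0r.
have cp v : {for v, continuous (fun v : V2 => (u, v))}.
  by apply: cvg_pair => //=; exact: cvg_cst.
elim: k F => [|k IH] F [cF dF]; split => //.
- by move=> v Uv; apply: (continuous_comp (cp v)); exact: cF.
- by move=> v Uv; apply: (continuous_comp (cp v)); exact: cF.
move=> b; have [dFb CF] := dF (0, b); split.
  by move=> v Uv; rewrite /derivable E; exact: dFb.
have -> : (fun v => 'D_b (fun v0 => F (u, v0)) v) =
          (fun v => 'D_(0, b) F (u, v)).
  by apply/funext => v; rewrite /derive E.
exact: (IH (fun p => 'D_(0, b) F p)).
Qed.

Lemma is_derive_line V W (F : V -> W) u v (t : R) :
  derivable F (u + t *: v) v ->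
  is_derive t 1 (fun s : R => F (u + s *: v)) ('D_v F (u + t *: v)).
Proof.
move=> dF; have E : (fun h : R => h^-1 *:
   (((fun s : R => F (u + s *: v)) \o shift t) (h *: 1) - F (u + t *: v))) =
   (fun h : R => h^-1 *: ((F \o shift (u + t *: v)) (h *: v) - F (u + t *: v))).
  apply/funext => h /=; congr (_ *: (F _ - _)).
  by rewrite [h *: 1]mulr1 scalerDl addrCA.
by apply: DeriveDef; rewrite /derivable /derive E.
Qed.

Lemma MVT_line V (F : V -> R) u v :
  (forall t : R, 0 <= t <= 1 -> derivable F (u + t *: v) v) ->
  exists2 t : R, 0 <= t <= 1 & F (u + v) - F u = 'D_v F (u + t *: v).
Proof.
move=> dF.
have dG (t : R) : 0 <= t <= 1 ->
    is_derive t 1 (fun s : R => F (u + s *: v)) ('D_v F (u + t *: v)).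
  by move=> /dF; exact: is_derive_line.
have [] := @MVT_segment R (fun s => F (u + s *: v)) (fun t => 'D_v F (u + t *: v)) 0 1 ler01.
- by move=> t /[!in_itv]/= /andP[t0 t1]; apply: dG; rewrite !ltW.
- apply: derivable_within_continuous => t /[!in_itv]/= tI.
  exact: (derivable_is (dG _ tI)).
- move=> t /[!in_itv]/= tI; rewrite scale1r scale0r addr0 subr0 mulr1 => ->.
  by exists t.
Qed.

(** The inner map is only assumed derivable in the single direction [b]. Restricting it to the line
    through [v] gives a function of one real variable, where derivable and differentiable coincide
    and the usual chain rule applies. *)
Lemma derive_comp (V W' W : normedModType R) (r : V -> W') (h : W' -> W) v b :
  derivable r v b -> differentiable h (r v) ->
  is_derive v b (h \o r) ('D_('D_b r v) h (r v)).
Proof.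
move=> dr dh.
have dl : is_derive (0 : R) 1 (fun s : R => r (v + s *: b)) ('D_b r v).
  by have := @is_derive_line _ _ r v b 0; rewrite scale0r addr0; apply.
have {}dr : differentiable (fun s : R => r (v + s *: b)) 0.
  by apply/derivable1_diffP; exact: ex_derive.
have dhr : differentiable (h \o (fun s : R => r (v + s *: b))) 0.
  by apply: differentiable_comp => //; rewrite scale0r addr0.
have E : (fun h0 : R => h0^-1 *: (((h \o r) \o shift v) (h0 *: b) - (h \o r) v)) =
  (fun h0 : R => h0^-1 *:
    (((h \o (fun s : R => r (v + s *: b))) \o shift 0) (h0 *: 1) -
     (h \o (fun s : R => r (v + s *: b))) 0)).
  apply/funext => s /=; congr (_ *: (h (r _) - h (r _))).
    by rewrite addr0 [s *: 1]mulr1 addrC.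
  by rewrite scale0r addr0.
apply: DeriveDef.
  by rewrite /derivable E; apply/derivable1_diffP.
rewrite {1}/derive E -/(derive (h \o (fun s : R => r (v + s *: b))) 0 1).
rewrite deriveE// diff_comp//=; last by rewrite scale0r addr0.
have <- : 'd (fun s : R => r (v + s *: b)) 0 1 = 'D_b r v.
  by rewrite -deriveE//; exact: derive_is dl.
by rewrite scale0r addr0 deriveE.
Qed.

End CkCalculus.

Section Smooth.
Context (R : realType).
Implicit Types V W : normedModType R.

Lemma near_norm V (u : V) (P : V -> Prop) :
  (\forall w \near u, P w) -> exists2 r : R, 0 < r & forall w, `|w - u| < r -> P w.
Proof.
move=> /nbhs_normP[r /= r0 rP]; exists r => // w wu.
by apply: rP; rewrite /ball_/= distrC.
Qed.

Lemma norm_near V (u : V) (P : V -> Prop) (r : R) :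
  0 < r -> (forall w, `|w - u| < r -> P w) -> \forall w \near u, P w.
Proof.
move=> r0 rP; apply/nbhs_normP; exists r => // w.
by rewrite /ball_/= distrC => /rP.
Qed.

Lemma near_prod_norm V W (u : V) (v : W) (P : V * W -> Prop) :
  (\forall p \near (u, v), P p) -> exists2 r : R, 0 < r &
    forall u' v', `|u' - u| < r -> `|v' - v| < r -> P (u', v').
Proof.
move=> [[A B] /= [/near_norm[r1 r10 A1] /near_norm[r2 r20 B2]] AB].
exists (Num.min r1 r2); first by rewrite lt_min r10.
move=> u' v'; rewrite !lt_min => /andP[u1 _] /andP[_ v2].
by apply: AB; split; [exact: A1|exact: B2].
Qed.

Lemma normZ_le V (t : R) (v : V) : 0 <= t <= 1 -> `|t *: v| <= `|v|.
Proof. by move=> /andP[t0 t1]; rewrite normrZ ger0_norm// ler_piMl. Qed.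

Lemma norm_le_dist V (a b : V) (e : R) : `|a - b| <= e -> `|b| <= `|a| + e.
Proof.
move=> ab; rewrite -[b in leLHS](subKr a); apply: le_trans (ler_normB _ _) _.
by rewrite lerD2l.
Qed.

(** Homogeneity in the direction holds without Fréchet differentiability, again by restriction to a
    line; it is used to prove that differentiability. *)
Lemma is_derive_scale V W (F : V -> W) u v (a : R) :
  derivable F u v -> is_derive u (a *: v) F (a *: 'D_v F u).
Proof.
move=> dF.
have dl : is_derive (0 : R) 1 (fun s : R => F (u + s *: v)) ('D_v F u).
  by have := @is_derive_line _ _ _ F u v 0; rewrite scale0r addr0; apply.
have {}dr : differentiable (fun s : R => F (u + s *: v)) 0.
  by apply/derivable1_diffP; exact: ex_derive.
have E : (fun h : R => h^-1 *: ((F \o shift u) (h *: (a *: v)) - F u)) =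
  (fun h : R => h^-1 *: (((fun s : R => F (u + s *: v)) \o shift 0) (h *: a) -
     F (u + (0 : R) *: v))).
  apply/funext => h /=; congr (_ *: (F _ - F _)).
    by rewrite addr0 scalerA addrC.
  by rewrite scale0r addr0.
apply: DeriveDef; rewrite /derivable /derive E; first exact: diff_derivable.
rewrite -/(derive (fun s : R => F (u + s *: v)) 0 a) deriveE//.
rewrite -[in LHS](mulr1 a) linearZ /= -deriveE//.
by congr (_ *: _); exact: derive_is dl.
Qed.

Lemma is_derive_shiftr V W (F : V -> W) u c v :
  derivable F (u + c) v -> is_derive u v (fun x => F (x + c)) ('D_v F (u + c)).
Proof.
move=> dF; have E : (fun h : R => h^-1 *:
   (((fun x => F (x + c)) \o shift u) (h *: v) - F (u + c))) =
   (fun h : R => h^-1 *: ((F \o shift (u + c)) (h *: v) - F (u + c))).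
  by apply/funext => h /=; rewrite addrA.
by apply: DeriveDef; rewrite /derivable /derive E.
Qed.

Lemma mx_norm_le p q (M : 'M[R]_(p, q)) (e : R) :
  0 <= e -> (forall i j, `|M i j| <= e) -> `|M| <= e.
Proof.
move=> e0 Me; rewrite /Num.Def.normr/= mx_normrE (bigmax_le _ e0)//= => i _.
Qed.

Lemma mx_norm_ge p q (M : 'M[R]_(p, q)) i j : `|M i j| <= `|M|.
Proof.
rewrite [leRHS]/Num.Def.normr/= mx_normrE; exact: (le_bigmax _ _ (i, j)).
Qed.

(** The vertices of the path from 0 to [v] that switches on one coordinate at a time. *)
Definition row_trunc n k (v : 'rV[R]_n) : 'rV[R]_n :=
  \row_i (if (i < k)%N then v 0 i else 0).

(** [Ck_on] only speaks of directional derivatives, so Fréchet differentiability has to be derived.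
    The increment is telescoped along the coordinate path; on each edge the mean value theorem gives
    a partial derivative at a nearby point, close to its value at [u] by continuity. *)
Lemma C1_expansion n (U : set 'rV[R]_n) (F : 'rV[R]_n -> R) u :
  open U -> Ck_on 1 U F -> U u -> forall e : R, 0 < e ->
  \forall v \near (0 : 'rV[R]_n),
    `|F (u + v) - F u - \sum_j v 0 j * 'D_(delta_mx 0 j) F u| <= e * `|v|.
Proof.
move=> oU CF Uu e e0.
(* The path has [n] edges, each allowed an error [e' * |v|]; dividing by [n.+1] keeps the quotient
   meaningful for [n = 0]. *)
pose e' := e / (n.+1)%:R.
have e'0 : 0 < e' by rewrite divr_gt0.
have cD (j : 'I_n) : {for u, continuous (fun w => 'D_(delta_mx 0 j) F w)}.
  exact: (Ck_on_continuous (Ck_on_derive (delta_mx 0 j) CF)).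
have cD' : \forall w \near u, forall j : 'I_n,
    `|'D_(delta_mx 0 j) F w - 'D_(delta_mx 0 j) F u| <= e'.
  have FF := nbhs_filter u; apply: (@filter_forall _ _ (fun (j : 'I_n) w =>
    `|'D_(delta_mx 0 j) F w - 'D_(delta_mx 0 j) F u| <= e') _ FF) => j.
  by have /cvgrPdist_le/(_ _ e'0) := cD j; apply: filterS => w; rewrite distrC.
have [r r0 rP] := near_norm (filterI (open_nbhs_nbhs (conj oU Uu)) cD').
apply: (@norm_near _ _ _ r) => // v; rewrite subr0 => vr.
have tr k t : 0 <= t <= 1 -> forall i : 'I_n, (i : nat) = k ->
    `|u + row_trunc k v + t *: (v 0 i *: delta_mx 0 i) - u| < r.
  move=> /andP[t0 t1] i ik; apply: le_lt_trans vr.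
  rewrite addrAC (addrC u) addrK; apply: mx_norm_le => // a j.
  rewrite !mxE ord1 eqxx /=; have [->|ji] := eqVneq j i.
    rewrite ik ltnn mulr1 addrC addr0 normrM (ger0_norm t0).
    by apply: le_trans (mx_norm_ge v 0 i); rewrite ler_piMl.
  rewrite !mulr0 addr0; case: ifP => _; rewrite ?normr0//; exact: mx_norm_ge.
have step (i : 'I_n) : `|F (u + row_trunc i.+1 v) - F (u + row_trunc i v) -
     v 0 i * 'D_(delta_mx 0 i) F u| <= e' * `|v|.
  have E : row_trunc i.+1 v = row_trunc i v + v 0 i *: delta_mx 0 i.
    apply/rowP => j; rewrite !mxE eqxx /= ltnS leq_eqVlt.
    have [->|ji] := eqVneq j i; first by rewrite eqxx ltnn add0r mulr1.
    by rewrite (_ : (j == i :> nat) = false) ?mulr0 ?addr0//; apply/negbTE.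
  have [t tI] := @MVT_line _ _ F (u + row_trunc i v) (v 0 i *: delta_mx 0 i)
    (fun t tI => derivable_is (is_derive_scale (v 0 i)
      (Ck_on_derivable CF (proj1 (rP _ (tr _ _ tI i erefl)))))).
  rewrite E addrA => ->.
  rewrite (derive_is (is_derive_scale (v 0 i)
      (Ck_on_derivable CF (proj1 (rP _ (tr _ _ tI i erefl)))))).
  rewrite -mulrBr normrM mulrC ler_pM//; last exact: mx_norm_ge.
  exact: (proj2 (rP _ (tr _ _ tI i erefl))).
have -> : F (u + v) - F u - \sum_j v 0 j * 'D_(delta_mx 0 j) F u =
  \sum_(i < n) (F (u + row_trunc i.+1 v) - F (u + row_trunc i v) -
     v 0 i * 'D_(delta_mx 0 i) F u).
  rewrite sumrB; congr (_ - _).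
  rewrite -(big_mkord xpredT (fun i => F (u + row_trunc i.+1 v) - F (u + row_trunc i v))).
  rewrite telescope_sumr//.
  have -> : row_trunc n v = v by apply/rowP => j; rewrite mxE ltn_ord.
  have -> : row_trunc 0 v = 0 by apply/rowP => j; rewrite !mxE.
  by rewrite addr0.
apply: le_trans (ler_norm_sum _ _ _) _.
apply: le_trans (ler_sum _ (fun i _ => step i)) _.
rewrite sumr_const card_ord -mulr_natl mulrA ler_wpM2r//.
rewrite /e' mulrCA; apply: ler_piMr; first exact: ltW.
by rewrite ler_pdivrMr// mul1r ler_nat.
Qed.

Lemma cvg_sumr T (F : set_system T) (FF : Filter F) I (r : seq I) (P : pred I)
    (f : I -> T -> R) (l : I -> R) :
  (forall i, f i x @[x --> F] --> l i) ->
  \sum_(i <- r | P i) f i x @[x --> F] --> \sum_(i <- r | P i) l i.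
Proof. by move=> fl; apply: cvg_big => //; exact: add_continuous. Qed.

(** The candidate differential, declared as a linear map so that it can be handed to the
    characterization of differentiability. *)
Definition dot_row n (c v : 'rV[R]_n) : R := \sum_j v 0 j * c 0 j.

Lemma dot_row_is_linear n (c : 'rV[R]_n) : linear (dot_row c).
Proof.
move=> a v w; rewrite /dot_row scaler_sumr -big_split; apply: eq_bigr => j _ /=.
by rewrite !mxE mulrDl -mulrA.
Qed.

HB.instance Definition _ n (c : 'rV[R]_n) :=
  GRing.isLinear.Build R 'rV[R]_n R _ (dot_row c) (dot_row_is_linear c).

Lemma dot_row_continuous n (c : 'rV[R]_n) : continuous (dot_row c).
Proof.
move=> v; apply: (@cvg_sumr _ (nbhs v) (nbhs_filter v)) => j.
apply: (@continuousM R _ (fun v : 'rV[R]_n => v 0 j) (fun=> c 0 j)).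
  exact: coord_continuous.
exact: cst_continuous.
Qed.

Lemma differentiable_expansion V W (f : V -> W) (df : {linear V -> W}) x :
  continuous df ->
  (forall e : R, 0 < e ->
     \forall v \near (0 : V), `|f (x + v) - f x - df v| <= e * `|v|) ->
  differentiable f x.
Proof.
move=> cdf ef.
have E : f \o shift x = cst (f x) + df +o_ 0 id.
  apply/eqaddoP => e e0; apply: filterS (ef _ e0) => v.
  have E1 : (f \o +%R^~ x - (cst (f x) + df)) v = f (v + x) - (f x + df v) by [].
  by rewrite E1 opprD addrA addrC addrC (addrC v).
by apply/diff_locallyP; rewrite (diff_unique cdf E).
Qed.

Lemma C1_differentiable n (U : set 'rV[R]_n) (F : 'rV[R]_n -> R) u :
  open U -> Ck_on 1 U F -> U u -> differentiable F u.
Proof.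
move=> oU CF Uu; pose c := \row_j 'D_(delta_mx 0 j) F u.
apply: (@differentiable_expansion _ _ _ (dot_row c)).
  exact: dot_row_continuous.
move=> e e0; apply: filterS (C1_expansion oU CF Uu e0) => v.
have E : dot_row c v = \sum_j v 0 j * 'D_(delta_mx 0 j) F u.
  by apply: eq_bigr => j _; rewrite mxE.
by rewrite -E.
Qed.

Lemma derive_row_sum n W (F : 'rV[R]_n -> W) u v :
  differentiable F u -> 'D_v F u = \sum_j v 0 j *: 'D_(delta_mx 0 j) F u.
Proof.
move=> dF; rewrite deriveE// {1}(row_sum_delta v) linear_sum.
by apply: eq_bigr => j _; rewrite linearZ /= deriveE.
Qed.

Lemma Ck_derive_sum n k (U : set 'rV[R]_n) (F : 'rV[R]_n -> R) u v :
  open U -> Ck_on k.+1 U F -> U u ->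
  'D_v F u = \sum_j v 0 j * 'D_(delta_mx 0 j) F u.
Proof.
move=> oU CF Uu; apply: derive_row_sum; apply: (C1_differentiable oU _ Uu).
by elim: k CF => // k IH /Ck_on_pred.
Qed.

(** Two applications of the mean value theorem: along [v] to the increment of [F] by [w], then along
    [w] to the derivative of [F] in direction [v]. *)
Lemma second_difference V (F : V -> R) (U : set V) u v w :
  Ck_on 2 U F ->
  (forall s t : R, 0 <= s <= 1 -> 0 <= t <= 1 -> U (u + s *: v + t *: w)) ->
  exists s t : R, [/\ 0 <= s <= 1, 0 <= t <= 1 &
    F (u + v + w) - F (u + v) - (F (u + w) - F u) =
    'D_w (fun x => 'D_v F x) (u + s *: v + t *: w)].
Proof.
move=> CF sU; pose g x := F (x + w) - F x.
have I0 : 0 <= (0 : R) <= 1 by rewrite lexx ler01.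
have I1 : 0 <= (1 : R) <= 1 by rewrite lexx ler01.
have dg s : 0 <= s <= 1 ->
   is_derive (u + s *: v) v g ('D_v F (u + s *: v + w) - 'D_v F (u + s *: v)).
  move=> sI; have H1 : derivable F (u + s *: v + w) v.
    by apply: (Ck_on_derivable CF); have := sU _ _ sI I1; rewrite scale1r.
  have H2 : derivable F (u + s *: v) v.
    by apply: (Ck_on_derivable CF); have := sU _ _ sI I0; rewrite scale0r addr0.
  apply: is_deriveB; first exact: is_derive_shiftr.
  exact: derivableP.
have [s sI Es] := @MVT_line _ _ g u v (fun s sI => derivable_is (dg s sI)).
have CDF := Ck_on_derive v CF.
have [t tI Et] := @MVT_line _ _ (fun x => 'D_v F x) (u + s *: v) w
  (fun t tI => Ck_on_derivable CDF (sU _ _ sI tI)).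
exists s, t; split => //; rewrite -Et -(derive_is (dg s sI)) -Es.
by rewrite /g; ring.
Qed.

(** The second difference over a small parallelogram is symmetric in its two sides and equals
    [h ^ 2] times either mixed derivative at some point of the parallelogram. Both mixed derivatives
    thus share a value arbitrarily close to [u], and continuity concludes. *)
Lemma Schwarz_symmetry V (F : V -> R) (U : set V) u v w :
  open U -> Ck_on 2 U F -> U u ->
  'D_v (fun x => 'D_w F x) u = 'D_w (fun x => 'D_v F x) u.
Proof.
move=> oU CF Uu.
have c1 := Ck_on_continuous (Ck_on_derive v (Ck_on_derive w CF)) Uu.
have c2 := Ck_on_continuous (Ck_on_derive w (Ck_on_derive v CF)) Uu.
apply/eqP; rewrite -subr_eq0 -normr_le0; apply/ler_addgt0Pr => e e0; rewrite add0r.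
have e20 : 0 < e / 2 by rewrite divr_gt0.
move/cvgrPdist_le/(_ _ e20) : c1 => c1.
move/cvgrPdist_le/(_ _ e20) : c2 => c2.
have [r r0 rP] := near_norm (filterI (open_nbhs_nbhs (conj oU Uu)) (filterI c1 c2)).
(* This scale keeps the whole parallelogram within distance [r] of [u]; the added 1 covers
   [v = w = 0]. *)
pose h := r / (`|v| + `|w| + 1).
have N0 : 0 < `|v| + `|w| + 1 by rewrite ltr_wpDl// addr_ge0.
have h0 : 0 < h by rewrite divr_gt0.
have small (s t : R) : 0 <= s <= 1 -> 0 <= t <= 1 ->
    `|u + s *: (h *: v) + t *: (h *: w) - u| < r.
  move=> /andP[s0 s1] /andP[t0 t1].
  have -> : u + s *: (h *: v) + t *: (h *: w) - u = h *: (s *: v + t *: w).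
    by rewrite addrC !addrA addNr add0r scalerDr !scalerA ![h * _]mulrC.
  rewrite normrZ (gtr0_norm h0).
  have H : `|s *: v + t *: w| <= `|v| + `|w|.
    apply: le_trans (ler_normD _ _) _; rewrite !normrZ !ger0_norm//.
    by apply: lerD; rewrite ler_piMl.
  apply: le_lt_trans (ler_wpM2l (ltW h0) H) _.
  by rewrite /h mulrAC ltr_pdivrMr// ltr_pM2l// ltrDl.
have [s [t [sI tI E1]]] := @second_difference _ F U u (h *: v) (h *: w) CF
  (fun a b aI bI => proj1 (rP _ (small a b aI bI))).
have small' (a b : R) : 0 <= a <= 1 -> 0 <= b <= 1 ->
    `|u + a *: (h *: w) + b *: (h *: v) - u| < r.
  by move=> aI bI; rewrite (addrAC u); apply: small.
have [s' [t' [sI' tI' E2]]] := @second_difference _ F U u (h *: w) (h *: v) CF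
  (fun a b aI bI => proj1 (rP _ (small' a b aI bI))).
have DD a b x : U x -> 'D_(h *: a) (fun x => 'D_(h *: b) F x) x =
   h * (h * 'D_a (fun x => 'D_b F x) x).
  move=> Ux; have nU : nbhs x U by exact: open_nbhs_nbhs.
  rewrite (@near_eq_derive _ _ _ _ (fun y => h *: 'D_b F y)); last first.
    apply: filterS nU => y Uy.
    exact: (derive_is (is_derive_scale h (Ck_on_derivable CF Uy))).
  have dd : derivable (fun y => 'D_b F y) x a.
    exact: (Ck_on_derivable (Ck_on_derive b CF) Ux).
  rewrite (_ : (fun y => h *: 'D_b F y) = h \*: (fun y => 'D_b F y))//.
  have ddh : derivable (h \*: (fun y => 'D_b F y)) x a by exact: derivableZ.
  rewrite (derive_is (is_derive_scale h ddh)).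
  by rewrite deriveZ.
have [U1 [A1 B1]] := rP _ (small _ _ sI tI).
have [U2 [A2 B2]] := rP _ (small' _ _ sI' tI').
rewrite DD// in E1; rewrite DD// in E2.
have E : 'D_w (fun x => 'D_v F x) (u + s *: (h *: v) + t *: (h *: w)) =
         'D_v (fun x => 'D_w F x) (u + s' *: (h *: w) + t' *: (h *: v)).
  apply: (mulfI (lt0r_neq0 h0)); apply: (mulfI (lt0r_neq0 h0)).
  apply: etrans (esym E1) (etrans _ E2); rewrite (addrAC u (h *: w)).
  move: (F _) (F _) (F _) (F _) => x1 x2 x3 x4; ring.
rewrite -(subrKA ('D_v (fun x => 'D_w F x) (u + s' *: (h *: w) + t' *: (h *: v)))).
rewrite -{2}E (splitr e); apply: le_trans (ler_normD _ _) (lerD A2 _).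
rewrite distrC; exact: B1.
Qed.

End Smooth.

Section Chain.
Context (R : realType).
Implicit Types V W : normedModType R.

Definition dot n (a b : 'rV[R]_n) : R := (a *m b^T) 0 0.

(** This is the differential in coordinates (a covector), as opposed to the Riemannian gradient,
    which is [pgrad] multiplied by the inverse Gram matrix. *)
Definition pgrad n (h : 'rV[R]_n -> R) u : 'rV[R]_n :=
  \row_j 'D_(delta_mx 0 j) h u.

Definition phess n (h : 'rV[R]_n -> R) u : 'M[R]_n :=
  \matrix_(i, j) 'D_(delta_mx 0 i) (fun w => 'D_(delta_mx 0 j) h w) u.

Lemma dotE n (a b : 'rV[R]_n) : dot a b = \sum_j a 0 j * b 0 j.
Proof. by rewrite /dot mxE; apply: eq_bigr => j _; rewrite mxE. Qed.

Lemma dotC n (a b : 'rV[R]_n) : dot a b = dot b a.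
Proof. by rewrite !dotE; apply: eq_bigr => j _; rewrite mulrC. Qed.

Lemma dotDl n (a b c : 'rV[R]_n) : dot (a + b) c = dot a c + dot b c.
Proof. by rewrite /dot mulmxDl mxE. Qed.

Lemma dotDr n (a b c : 'rV[R]_n) : dot a (b + c) = dot a b + dot a c.
Proof. by rewrite dotC dotDl !(dotC a). Qed.

Lemma dotZl n k (a b : 'rV[R]_n) : dot (k *: a) b = k * dot a b.
Proof. by rewrite /dot -scalemxAl mxE. Qed.

Lemma dotZr n k (a b : 'rV[R]_n) : dot a (k *: b) = k * dot a b.
Proof. by rewrite dotC dotZl dotC. Qed.

Lemma dotNl n (a b : 'rV[R]_n) : dot (- a) b = - dot a b.
Proof. by rewrite -scaleN1r dotZl mulN1r. Qed.

Lemma dotBl n (a b c : 'rV[R]_n) : dot (a - b) c = dot a c - dot b c.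
Proof. by rewrite dotDl dotNl. Qed.

Lemma dotBr n (a b c : 'rV[R]_n) : dot a (b - c) = dot a b - dot a c.
Proof. by rewrite dotC dotBl !(dotC a). Qed.

Lemma dot_suml n I (r : seq I) (P : pred I) (F : I -> 'rV[R]_n) b :
  dot (\sum_(i <- r | P i) F i) b = \sum_(i <- r | P i) dot (F i) b.
Proof. by rewrite /dot mulmx_suml summxE. Qed.

Lemma dot_mulmxl n p (a : 'rV[R]_n) (A : 'M[R]_(n, p)) b :
  dot (a *m A) b = dot a (b *m A^T).
Proof. by rewrite /dot trmx_mul trmxK mulmxA. Qed.

Lemma dot_delta n (a : 'rV[R]_n) j : dot a (delta_mx 0 j) = a 0 j.
Proof.
rewrite dotE (bigD1 j)//= big1 ?addr0 => [|i ij]; rewrite mxE eqxx ?eqxx ?mulr1//.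
by rewrite (negbTE ij) mulr0.
Qed.

Lemma rV_dot_eq n (a b : 'rV[R]_n) : (forall c, dot a c = dot b c) -> a = b.
Proof. by move=> ab; apply/rowP => j; rewrite -!dot_delta ab. Qed.

Lemma continuous_mulmx (T : topologicalType) p q s (F : T -> 'M[R]_(p, q))
    (G : T -> 'M[R]_(q, s)) (t : T) :
  {for t, continuous F} -> {for t, continuous G} ->
  {for t, continuous (fun t => F t *m G t)}.
Proof.
move=> /continuous_mxP cF /continuous_mxP cG; apply/continuous_mxP => i j.
rewrite (_ : (fun s => _) = (fun s => \sum_k F s i k * G s k j)); last first.
  by apply/funext => x; rewrite mxE.
apply: (@cvg_sumr _ _ (nbhs t) (nbhs_filter t)) => k.
exact: (@continuousM R _ (fun s => F s i k) (fun s => G s k j)).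
Qed.

Lemma continuous_trmx (T : topologicalType) p q (F : T -> 'M[R]_(p, q)) (t : T) :
  {for t, continuous F} -> {for t, continuous (fun t => (F t)^T)}.
Proof.
move=> /continuous_mxP cF; apply/continuous_mxP => i j.
by rewrite (_ : (fun s => _) = (fun s => F s j i)) //; apply/funext => x; rewrite mxE.
Qed.

Lemma continuous_dot (T : topologicalType) n (F G : T -> 'rV[R]_n) (t : T) :
  {for t, continuous F} -> {for t, continuous G} ->
  {for t, continuous (fun t => dot (F t) (G t))}.
Proof.
move=> cF cG.
exact: (iffLR (continuous_mxP _ _) (continuous_mulmx cF (continuous_trmx cG))).
Qed.

Lemma derive_dot n k (U : set 'rV[R]_n) (h : 'rV[R]_n -> R) u v :
  open U -> Ck_on k.+1 U h -> U u -> 'D_v h u = dot v (pgrad h u).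
Proof.
move=> oU Ch Uu; rewrite (Ck_derive_sum v oU Ch Uu) dotE.
by apply: eq_bigr => j _; rewrite mxE.
Qed.

Lemma pgrad_continuous n k (U : set 'rV[R]_n) (h : 'rV[R]_n -> R) u :
  Ck_on k.+1 U h -> U u -> {for u, continuous (pgrad h)}.
Proof.
move=> Ch Uu; apply/continuous_mxP => i j.
rewrite (_ : (fun s => _) = (fun s => 'D_(delta_mx 0 j) h s)); last first.
  by apply/funext => x; rewrite mxE.
exact: (Ck_on_continuous (Ck_on_derive _ Ch)).
Qed.

Lemma phess_continuous n k (U : set 'rV[R]_n) (h : 'rV[R]_n -> R) u :
  Ck_on k.+2 U h -> U u -> {for u, continuous (phess h)}.
Proof.
move=> Ch Uu; apply/continuous_mxP => i j.
rewrite (_ : (fun s => _) = (fun s => 'D_(delta_mx 0 i)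
   (fun w => 'D_(delta_mx 0 j) h w) s)); last first.
  by apply/funext => x; rewrite mxE.
exact: (Ck_on_continuous (Ck_on_derive _ (Ck_on_derive _ Ch))).
Qed.

Lemma phess_sym n (U : set 'rV[R]_n) (h : 'rV[R]_n -> R) u :
  open U -> Ck_on 2 U h -> U u -> (phess h u)^T = phess h u.
Proof.
move=> oU Ch Uu; apply/matrixP => i j; rewrite !mxE.
exact: (Schwarz_symmetry _ _ oU Ch Uu).
Qed.

Lemma is_derive_mx V p q (F : V -> 'M[R]_(p, q)) u v (D : 'M[R]_(p, q)) :
  (forall i j, is_derive u v (fun w => F w i j) (D i j)) -> is_derive u v F D.
Proof.
move=> dF; have dF' : derivable F u v.
  by apply/derivable_mxP => i j; apply: ex_derive.
apply: DeriveDef => //; apply/matrixP => i j.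
by rewrite derive_mxE//; exact: (derive_is (dF i j)).
Qed.

Lemma is_derive_coord V p q (F : V -> 'M[R]_(p, q)) u v D i j :
  is_derive u v F D -> is_derive u v (fun w => F w i j) (D i j).
Proof.
move=> [dF <-]; rewrite derive_mxE//; apply: derivableP.
by move/derivable_mxP : dF.
Qed.

Lemma is_derive_pgrad n (U : set 'rV[R]_n) (h : 'rV[R]_n -> R) u v :
  open U -> Ck_on 2 U h -> U u -> is_derive u v (pgrad h) (v *m phess h u).
Proof.
move=> oU Ch Uu; apply: is_derive_mx => i j.
rewrite (_ : (fun s => _) = (fun s => 'D_(delta_mx 0 j) h s)); last first.
  by apply/funext => x; rewrite mxE.
rewrite !mxE ord1.
have C1 := Ck_on_derive (delta_mx 0 j) Ch.
have := Ck_derive_sum v oU C1 Uu.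
under [X in _ = X -> _]eq_bigr do
  rewrite -[X in _ * X](mxE matrix_key (fun i j => 'D_(delta_mx 0 i)
   (fun w => 'D_(delta_mx 0 j) h w) u)).
rewrite -/(phess h u) => <-.
by apply: derivableP; exact: (Ck_on_derivable C1).
Qed.

Lemma cvg_sum_derive V I (s : seq I) (F : I -> V -> R) (D : I -> R) u v :
  (forall i, is_derive u v (F i) (D i)) ->
  is_derive u v (fun w => \sum_(i <- s) F i w) (\sum_(i <- s) D i).
Proof.
move=> dF; elim: s => [|i s IH].
  rewrite big_nil (_ : (fun w => _) = cst 0); first exact: is_derive_cst.
  by apply/funext => w; rewrite big_nil.
rewrite big_cons (_ : (fun w => _) = F i + (fun w => \sum_(i <- s) F i w)).
  exact: is_deriveD.
by apply/funext => w; rewrite big_cons.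
Qed.

Lemma is_derive_mulmx V p q s (F : V -> 'M[R]_(p, q)) (G : V -> 'M[R]_(q, s))
    u v DF DG : is_derive u v F DF -> is_derive u v G DG ->
  is_derive u v (fun w => F w *m G w) (DF *m G u + F u *m DG).
Proof.
move=> dF dG; apply: is_derive_mx => i j.
rewrite (_ : (fun w => _) = (fun w => \sum_k F w i k * G w k j)); last first.
  by apply/funext => w; rewrite mxE.
rewrite !mxE -big_split /=; apply: cvg_sum_derive => k.
have dFk := is_derive_coord i k dF; have dGk := is_derive_coord k j dG.
apply: is_derive_eq (is_deriveM dFk dGk) _.
by rewrite addrC; congr (_ + _); rewrite /GRing.scale /= mulrC.
Qed.

Lemma is_derive_trmx V p q (F : V -> 'M[R]_(p, q)) u v DF :
  is_derive u v F DF -> is_derive u v (fun w => (F w)^T) DF^T.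
Proof.
move=> dF; apply: is_derive_mx => i j; rewrite mxE.
rewrite (_ : (fun w => _) = (fun w => F w j i)); first exact: is_derive_coord.
by apply/funext => w; rewrite mxE.
Qed.

Lemma is_derive_dot V n (F G : V -> 'rV[R]_n) u v DF DG :
  is_derive u v F DF -> is_derive u v G DG ->
  is_derive u v (fun w => dot (F w) (G w)) (dot DF (G u) + dot (F u) DG).
Proof.
move=> dF dG.
have := is_derive_coord 0 0 (is_derive_mulmx dF (is_derive_trmx dG)).
by rewrite mxE.
Qed.

Lemma is_derive_eq_near V W (F G : V -> W) (U : set V) u v D :
  open U -> U u -> (forall w, U w -> F w = G w) ->
  is_derive u v F D -> is_derive u v G D.
Proof.
move=> oU Uu FG; apply: near_eq_is_derive.
by apply: filterS (open_nbhs_nbhs (conj oU Uu)) => w /FG.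
Qed.

Lemma continuous_eq_near V (W : topologicalType) (F G : V -> W) (U : set V) u :
  open U -> U u -> (forall w, U w -> F w = G w) ->
  {for u, continuous F} -> {for u, continuous G}.
Proof.
move=> oU Uu FG cF; rewrite /prop_for /continuous_at -FG//.
apply: cvg_trans cF; apply: near_eq_cvg.
by apply: filterS (open_nbhs_nbhs (conj oU Uu)) => w Uw; rewrite FG.
Qed.

Section Composition.
Context (V : normedModType R) (n : nat) (U : set V) (Y : set 'rV[R]_n).
Context (r : V -> 'rV[R]_n) (h : 'rV[R]_n -> R).
Context (oU : open U) (oY : open Y) (rUY : forall v, U v -> Y (r v)).

Lemma is_derive_comp_dot k v b : Ck_on k.+1 Y h -> Ck_on 1 U r -> U v ->
  is_derive v b (h \o r) (dot ('D_b r v) (pgrad h (r v))).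
Proof.
move=> Ch Cr Uv; rewrite -(derive_dot _ oY Ch (rUY Uv)); apply: derive_comp.
  exact: (Ck_on_derivable Cr).
apply: (C1_differentiable oY _ (rUY Uv)).
by elim: k Ch => // k IH /Ck_on_pred.
Qed.

Lemma is_derive_pgrad_comp v a : Ck_on 2 Y h -> Ck_on 1 U r -> U v ->
  is_derive v a (pgrad h \o r) ('D_a r v *m phess h (r v)).
Proof.
move=> Ch Cr Uv; apply: is_derive_mx => i j; rewrite ord1.
have C1 := Ck_on_derive (delta_mx 0 j) Ch.
rewrite (_ : (fun s => _) = (fun s => 'D_(delta_mx 0 j) h s) \o r); last first.
  by apply/funext => x; rewrite /= mxE.
apply: is_derive_eq (derive_comp (Ck_on_derivable Cr Uv)
   (C1_differentiable oY C1 (rUY Uv))) _.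
by rewrite (Ck_derive_sum _ oY C1 (rUY Uv)) mxE; apply: eq_bigr => i' _; rewrite mxE.
Qed.

(** The second-order chain rule: the Hessian of [h] on the two first derivatives of [r], plus the
    differential of [h] on the second derivative of [r]. For a retraction this last term produces
    the Christoffel correction. *)
Lemma is_derive2_comp v a b : Ck_on 2 Y h -> Ck_on 2 U r -> U v ->
  is_derive v a (fun x => 'D_b (h \o r) x)
    (dot ('D_a r v *m phess h (r v)) ('D_b r v) +
     dot ('D_a (fun x => 'D_b r x) v) (pgrad h (r v))).
Proof.
move=> Ch Cr Uv.
have Cr1 := Ck_on_pred Cr.
have E w : U w -> dot ('D_b r w) ((pgrad h \o r) w) = 'D_b (h \o r) w.
  move=> Uw.
  by rewrite (derive_is (is_derive_comp_dot b Ch Cr1 Uw)).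
apply: (is_derive_eq_near oU Uv E).
rewrite addrC (dotC (_ *m _)); apply: is_derive_dot.
  apply: derivableP; exact: (Ck_on_derivable (Ck_on_derive b Cr)).
exact: is_derive_pgrad_comp.
Qed.

Lemma Ck_on2_comp : Ck_on 2 Y h -> Ck_on 2 U r -> Ck_on 2 U (h \o r).
Proof.
move=> Ch Cr; have Cr1 := Ck_on_pred Cr.
have cr v : U v -> {for v, continuous r} by exact: (Ck_on_continuous Cr).
split=> [v Uv|b].
  apply: continuous_comp; first exact: cr.
  exact: (Ck_on_continuous Ch (rUY Uv)).
have Db (v : V) : U v -> is_derive v b (h \o r) (dot ('D_b r v) (pgrad h (r v))).
  by move=> Uv; apply: (is_derive_comp_dot b Ch Cr1 Uv).
split=> [v Uv|]; first by have [] := Db v Uv.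
split=> [v Uv|a].
  have cD : {for v, continuous (fun v => dot ('D_b r v) (pgrad h (r v)))}.
    apply: continuous_dot; first exact: (Ck_on_continuous (Ck_on_derive b Cr)).
    apply: (continuous_comp (cr v Uv)); exact: (pgrad_continuous Ch (rUY Uv)).
  apply: (continuous_eq_near oU Uv _ cD) => w Uw.
  by rewrite (derive_is (Db w Uw)).
have Dab v : U v -> _ := fun Uv => is_derive2_comp a b Ch Cr Uv.
split=> [v Uv|]; first by have [] := Dab v Uv.
split=> // v Uv.
have cD : {for v, continuous (fun v => dot ('D_a r v *m phess h (r v)) ('D_b r v) +
     dot ('D_a (fun x => 'D_b r x) v) (pgrad h (r v)))}.
  apply: (@continuousD _ R^o V).
    apply: continuous_dot; last exact: (Ck_on_continuous (Ck_on_derive b Cr)).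
    apply: continuous_mulmx; first exact: (Ck_on_continuous (Ck_on_derive a Cr)).
    apply: (continuous_comp (cr v Uv)); exact: (phess_continuous Ch (rUY Uv)).
  apply: continuous_dot.
    exact: (Ck_on_continuous (Ck_on_derive a (Ck_on_derive b Cr))).
  apply: (continuous_comp (cr v Uv)); exact: (pgrad_continuous Ch (rUY Uv)).
apply: (continuous_eq_near oU Uv _ cD) => w Uw.
by rewrite (derive_is (Dab w Uw)).
Qed.

End Composition.
End Chain.

(** * Linear algebra *)

Section LinearAlgebra.
Context (R : realType).

Lemma mulmx_norm_le p q s (A : 'M[R]_(p, q)) (B : 'M[R]_(q, s)) :
  `|A *m B| <= q%:R * (`|A| * `|B|).
Proof.
apply: mx_norm_le; first by rewrite !mulr_ge0.
move=> i j; rewrite mxE; apply: le_trans (ler_norm_sum _ _ _) _.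
have H k : true -> `|A i k * B k j| <= `|A| * `|B|.
  by move=> _; rewrite normrM ler_pM// mx_norm_ge.
by apply: le_trans (ler_sum _ H) _; rewrite sumr_const card_ord mulr_natl.
Qed.

Lemma dot_norm_le n (a b : 'rV[R]_n) : `|dot a b| <= n%:R * (`|a| * `|b|).
Proof.
rewrite dotE; apply: le_trans (ler_norm_sum _ _ _) _.
have H k : true -> `|a 0 k * b 0 k| <= `|a| * `|b|.
  by move=> _; rewrite normrM ler_pM// mx_norm_ge.
by apply: le_trans (ler_sum _ H) _; rewrite sumr_const card_ord mulr_natl.
Qed.

Lemma inj_unitmx n (A : 'M[R]_n) :
  (forall v : 'rV[R]_n, v *m A = 0 -> v = 0) -> A \in unitmx.
Proof. by move=> /inj_row_free; rewrite row_free_unit. Qed.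

(** Quantitative stability of invertibility: one constant serves all nearby matrices, for an
    arbitrary filter, so that it applies to Jacobians, Gram matrices and difference quotients
    alike. *)
Lemma unitmx_near_bound T (F : set_system T) (FF : Filter F) n
    (J : T -> 'M[R]_n) (J0 : 'M[R]_n) :
  J0 \in unitmx -> J t @[t --> F] --> J0 ->
  exists2 C : R, 0 < C &
    \forall t \near F, forall v : 'rV[R]_n, `|v| <= C * `|v *m J t|.
Proof.
move=> uJ cJ; pose K := n%:R * `|invmx J0| + 1.
have K0 : 0 < K by rewrite ltr_wpDl// mulr_ge0.
have KJ (v : 'rV[R]_n) : `|v| <= K * `|v *m J0|.
  rewrite -{1}(mulmxK uJ v); apply: le_trans (mulmx_norm_le _ _) _.
  by rewrite mulrCA mulrC ler_wpM2r// /K lerDl.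
(* With this tolerance the perturbation of [J0] costs at most half of [|v|], which is absorbed on
   the left. *)
pose e := (K * n.+1%:R * 2)^-1.
have e0 : 0 < e by rewrite invr_gt0 !mulr_gt0.
exists (2 * K); first by rewrite mulr_gt0.
move/cvgrPdist_le/(_ _ e0) : cJ; apply: filterS => t Jt v.
have H1 : `|v *m J0| <= `|v *m J t| + n%:R * (`|v| * e).
  have -> : v *m J0 = v *m J t + v *m (J0 - J t) by rewrite -mulmxDr addrCA subrr addr0.
  apply: le_trans (ler_normD _ _) _; rewrite lerD2l.
  apply: le_trans (mulmx_norm_le _ _) _.
  by rewrite ler_wpM2l// ler_wpM2l.
have H2 : K * (n%:R * (`|v| * e)) <= `|v| / 2.
  have -> : K * (n%:R * (`|v| * e)) = (n%:R / n.+1%:R) * (`|v| / 2).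
    rewrite /e; field; rewrite (gt_eqF K0) /= ; by rewrite nat1r pnatr_eq0.
  rewrite -[leRHS]mul1r ler_wpM2r ?divr_ge0// ler_pdivrMr// mul1r ler_nat//.
have := KJ v; have := ler_wpM2l (ltW K0) H1; rewrite mulrDr.
move: (K * `|v *m J0|) (K * (n%:R * (`|v| * e))) H2 => x y.
rewrite -mulrA; move: (K * `|v *m J t|) => z; lra.
Qed.

Definition posdef n (G : 'M[R]_n) : Prop :=
  forall v : 'rV[R]_n, v != 0 -> 0 < dot (v *m G) v.

Lemma posdef_ge0 n (G : 'M[R]_n) v : posdef G -> 0 <= dot (v *m G) v.
Proof.
move=> pG; have [->|/pG/ltW//] := eqVneq v 0.
by rewrite mul0mx /dot mul0mx mxE.
Qed.

Lemma dot_symmx n (G : 'M[R]_n) v w : G^T = G -> dot (v *m G) w = dot (w *m G) v.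
Proof. by move=> sG; rewrite dot_mulmxl sG dotC. Qed.

Lemma posdef_unitmx n (G : 'M[R]_n) : posdef G -> G \in unitmx.
Proof.
move=> pG; apply: inj_unitmx => v vG; apply/eqP; apply: contraT => /pG.
by rewrite vG /dot mul0mx mxE ltxx.
Qed.

Lemma Cauchy_Schwarz n (G : 'M[R]_n) v w : G^T = G -> posdef G ->
  dot (v *m G) w ^+ 2 <= dot (v *m G) v * dot (w *m G) w.
Proof.
move=> sG pG; have [->|w0] := eqVneq w 0.
  by rewrite mul0mx /dot trmx0 mulmx0 mul0mx mxE expr0n mulr0.
have c0 := pG _ w0.
pose t := - dot (v *m G) w / dot (w *m G) w.
have := posdef_ge0 (v + t *: w) pG.
rewrite mulmxDl dotDl !dotDr -scalemxAl !dotZl !dotZr (dot_symmx w v sG).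
rewrite /t; move: (dot (v *m G) v) (dot (v *m G) w) (dot (w *m G) w) c0 => a b c c0 H.
have : 0 <= (a + - b / c * b + (- b / c * b + - b / c * (- b / c * c))) * c.
  by rewrite mulr_ge0// ltW.
have -> : (a + - b / c * b + (- b / c * b + - b / c * (- b / c * c))) * c =
   a * c - b ^+ 2 by field; rewrite gt_eqF.
by rewrite subr_ge0.
Qed.

(** No compactness is required: Cauchy-Schwarz against the basis vectors bounds [|v *m G| ^+ 2] by
    the trace [T] times the quadratic form, and invertibility of [G] bounds [|v|] by [|v *m G|]. *)
Lemma posdef_coercive n (G : 'M[R]_n) : G^T = G -> posdef G ->
  exists2 c : R, 0 < c & forall v : 'rV[R]_n, c * `|v| ^+ 2 <= dot (v *m G) v.
Proof.
move=> sG pG; have uG := posdef_unitmx pG.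
have [C C0 CP] : exists2 C : R, 0 < C & forall v : 'rV[R]_n, `|v| <= C * `|v *m G|.
  have [C C0 H] := @unitmx_near_bound R (nbhs (0 : R)) (nbhs_filter _) n (fun=> G) G uG
    (cvg_cst _).
  by exists C => // v; have := nbhs_singleton H; apply.
pose T := \sum_j dot (delta_mx 0 j *m G) (delta_mx 0 j).
have Tj j : dot (delta_mx 0 j *m G) (delta_mx 0 j) <= T.
  by rewrite /T (bigD1 j)//= lerDl sumr_ge0// => i _; apply: posdef_ge0.
have T0 : 0 <= T by apply: sumr_ge0 => i _; apply: posdef_ge0.
have H v : `|v *m G| ^+ 2 <= T * dot (v *m G) v.
  have qv := posdef_ge0 v pG.
  rewrite -[leRHS]sqr_sqrtr ?mulr_ge0// ler_sqr ?nnegrE ?sqrtr_ge0//.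
  apply: mx_norm_le; first exact: sqrtr_ge0.
  move=> i j; rewrite ord1 -sqrtr_sqr ler_sqrt ?mulr_ge0//.
  rewrite -dot_delta; apply: le_trans (Cauchy_Schwarz _ _ sG pG) _.
  by rewrite mulrC ler_wpM2r.
exists (C ^+ 2 * T + 1)^-1; first by rewrite invr_gt0 ltr_wpDl// mulr_ge0// sqr_ge0.
move=> v; rewrite ler_pdivrMl; last by rewrite ltr_wpDl// mulr_ge0// sqr_ge0.
have qv := posdef_ge0 v pG.
have : `|v| ^+ 2 <= (C * `|v *m G|) ^+ 2.
  by rewrite ler_sqr ?nnegrE ?mulr_ge0// ?ltW.
rewrite exprMn; have := ler_wpM2l (sqr_ge0 C) (H v).
move: (dot (v *m G) v) qv => q q0; rewrite mulrDl mul1r mulrA; lra.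
Qed.

Lemma posdef_near T (F : set_system T) (FF : Filter F) n
    (G : T -> 'M[R]_n) (G0 : 'M[R]_n) :
  G0^T = G0 -> posdef G0 -> G t @[t --> F] --> G0 ->
  exists2 c : R, 0 < c &
    \forall t \near F, forall v : 'rV[R]_n, c * `|v| ^+ 2 <= dot (v *m G t) v.
Proof.
move=> sG pG cG; have [c c0 cP] := posdef_coercive sG pG.
pose e := c / 2 / (n.+1%:R * n.+1%:R).
have N0 : (0 : R) < n.+1%:R by [].
have e0 : 0 < e by rewrite !divr_gt0// mulr_gt0.
exists (c / 2); first by rewrite divr_gt0.
move/cvgrPdist_le/(_ _ e0) : cG; apply: filterS => t Gt v.
have := cP v; have -> : dot (v *m G0) v = dot (v *m G t) v + dot (v *m (G0 - G t)) v.
  by rewrite mulmxBr dotBl addrC subrK.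
have : `|dot (v *m (G0 - G t)) v| <= c / 2 * `|v| ^+ 2.
  have nn : n%:R <= n.+1%:R :> R by rewrite ler_nat.
  apply: le_trans (dot_norm_le _ _) _.
  apply: (@le_trans _ _ (n.+1%:R * ((n.+1%:R * (`|v| * e)) * `|v|))).
    apply: ler_pM => //; apply: ler_wpM2r => //.
    apply: le_trans (mulmx_norm_le _ _) _; apply: ler_pM => //.
    exact: ler_wpM2l.
  rewrite /e le_eqVlt; apply/orP; left; apply/eqP; field.
  by rewrite nat1r pnatr_eq0.
move=> /(le_trans (ler_norm _)); lra.
Qed.

Lemma sphere_compact n : compact [set v : 'rV[R]_n | `|v| = 1].
Proof.
apply: bounded_closed_compact.
  by exists 1; split => // M M1 v /= ->; exact: ltW.
rewrite (_ : mkset _ = Num.norm @^-1` [set 1]) //.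
apply: closed_comp; first by move=> v _; exact: norm_continuous.
exact: closed_eq.
Qed.

(** Positivity on the common kernel of the [p i] becomes positivity everywhere after a large enough
    penalty. Each unit vector has a neighbourhood and a threshold for [rho] that work together;
    compactness of the sphere makes the threshold uniform, and homogeneity extends the result to all
    vectors. *)
Lemma Finsler n m (A : pred 'I_m) (B : 'M[R]_n) (p : 'I_m -> 'rV[R]_n) :
  (forall v, v != 0 -> (forall i, A i -> dot v (p i) = 0) -> 0 < dot (v *m B) v) ->
  exists2 rho : R, 0 < rho &
    forall v, v != 0 -> 0 < dot (v *m B) v + rho * \sum_(i | A i) dot v (p i) ^+ 2.
Proof.
move=> posB; pose q (v : 'rV[R]_n) := dot (v *m B) v.
pose s (v : 'rV[R]_n) := \sum_(i | A i) dot v (p i) ^+ 2.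
have s0 v : 0 <= s v by apply: sumr_ge0 => i _; exact: sqr_ge0.
have cq : continuous q.
  move=> v; have H := @continuous_dot R _ n (fun v : 'rV[R]_n => v *m B) id v.
  apply: H; last exact: cvg_id.
  apply: (@continuous_mulmx R _ _ _ _ id (fun=> B) v); first exact: cvg_id.
  exact: cst_continuous.
have cs : continuous s.
  move=> v; apply: (@cvg_sumr _ _ (nbhs v) (nbhs_filter v)) => i.
  have cd : {for v, continuous (fun v => dot v (p i))}.
    apply: (@continuous_dot R _ n id (fun=> p i) v); first exact: cvg_id.
    exact: cst_continuous.
  exact: (@continuousM R _ (fun v => dot v (p i)) (fun v => dot v (p i))).
have nc := iffLR (compact_near_coveringP _) (@sphere_compact n).
have : \forall rho \near +oo, [set v : 'rV[R]_n | `|v| = 1] `<=`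
    (fun v => 0 < q v + rho * s v).
  apply: nc => v v1; have v0 : v != 0.
    by apply/eqP => v0; move: v1 => /= /eqP; rewrite v0 normr0 eq_sym oner_eq0.
  have [sv|sv] := eqVneq (s v) 0.
    have qv : 0 < q v.
      apply: posB => // i Ai; apply/eqP; rewrite -sqrf_eq0; apply/eqP.
      have /eqP : s v = 0 := sv.
      rewrite psumr_eq0 => [/allP/(_ i)|j _]; last exact: sqr_ge0.
      by rewrite mem_index_enum Ai => /(_ isT)/eqP.
    near=> v' rho; rewrite /=.
    have : 0 < q v' by near: v'; apply: (cvgr_gt (q v)) => //; exact: cq.
    have r0 : 0 <= rho by near: rho; apply: nbhs_pinfty_ge; exact: num_real.
    by move=> q0; rewrite ltr_wpDr// mulr_ge0.
  have sv0 : 0 < s v by rewrite lt0r sv s0.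
  near=> v' rho; rewrite /=.
  have h1 : s v / 2 < s v'.
    near: v'; apply: (cvgr_gt (s v)); first exact: cs.
    by rewrite ltr_pdivrMr// ltr_pMr// ltr1n.
  have h2 : q v - 1 < q v'.
    by near: v'; apply: (cvgr_gt (q v)); [exact: cq | rewrite ltrBlDr ltrDl].
  have r0 : 0 <= rho by near: rho; apply: nbhs_pinfty_ge; exact: num_real.
  (* Near [v] one has [s > s v / 2] and [q > q v - 1], so this size of [rho] makes the penalty
     outweigh the form. *)
  have h3 : 2 * (`|q v| + 1) / s v <= rho by near: rho; apply: nbhs_pinfty_ge; exact: num_real.
  have h4 : `|q v| + 1 <= rho * (s v / 2).
    move: h3; rewrite ler_pdivrMr// => h3.
    by rewrite mulrA ler_pdivlMr// mulrC.
  have h5 := ler_wpM2l r0 (ltW h1).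
  have h6 := ler_norm (- q v); rewrite normrN in h6; lra.
move=> H; have : \forall rho \near +oo, 0 < rho /\ [set v : 'rV[R]_n | `|v| = 1] `<=`
    (fun v => 0 < q v + rho * s v).
  by apply: filterI H; exact: nbhs_pinfty_gt.
move=> /(@filter_ex _ _ _)[rho [rho0 rhoP]]; exists rho => // v v0.
have nv : 0 < `|v| by rewrite normr_gt0.
have := rhoP (`|v|^-1 *: v); rewrite /= normrZ normfV normr_id mulVf ?gt_eqF//.
move=> /(_ erefl); rewrite /q /s -scalemxAl dotZl dotZr mulrA -expr2.
have -> : \sum_(i | A i) dot (`|v|^-1 *: v) (p i) ^+ 2 =
    `|v|^-1 ^+ 2 * \sum_(i | A i) dot v (p i) ^+ 2.
  by rewrite mulr_sumr; apply: eq_bigr => i _; rewrite dotZl exprMn.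
rewrite mulrCA -mulrDr pmulr_rgt0// exprn_gt0// invr_gt0//.
Unshelve. all: by end_near. Qed.

End LinearAlgebra.

(** * Matrix-valued maps: inverses, Jacobians, slices *)

Section VectorValued.
Context (R : realType).
Implicit Types V W : normedModType R.

Lemma cvg_mxP T (F : set_system T) (FF : Filter F) p q (f : T -> 'M[R]_(p, q))
    (l : 'M[R]_(p, q)) :
  f t @[t --> F] --> l <-> forall i j, f t i j @[t --> F] --> l i j.
Proof.
split=> [fl i j|fl]; apply/cvgrPdist_le => /= e e0.
  move/cvgrPdist_le/(_ _ e0) : fl; apply: filterS => t; apply: le_trans.
  by apply: le_trans (mx_norm_ge _ i j); rewrite !mxE.
have H : \forall t \near F, forall ij : 'I_p * 'I_q,
    `|l ij.1 ij.2 - f t ij.1 ij.2| <= e.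
  apply: filter_forall => -[i j].
  by have /cvgrPdist_le/(_ _ e0) := fl i j.
apply: filterS H => t H; apply: mx_norm_le => [|i j]; first exact: ltW.
by rewrite !mxE; exact: (H (i, j)).
Qed.

Lemma cvg_mulmx T (F : set_system T) (FF : Filter F) p q s
    (f : T -> 'M[R]_(p, q)) (g : T -> 'M[R]_(q, s)) (a : 'M[R]_(p, q)) (b : 'M[R]_(q, s)) :
  f t @[t --> F] --> a -> g t @[t --> F] --> b ->
  f t *m g t @[t --> F] --> a *m b.
Proof.
move=> /cvg_mxP fa /cvg_mxP gb; apply/cvg_mxP => i j.
rewrite mxE (_ : (fun s => _) = (fun s => \sum_k f s i k * g s k j)); last first.
  by apply/funext => x; rewrite mxE.
by apply: cvg_sumr => k; apply: cvgM; [exact: fa|exact: gb].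
Qed.

(** Multiplying the difference of the inverses by [G t] turns it into [invmx G0 *m (G t - G0)]; the
    uniform bound for matrices near [G0] then undoes the multiplication, row by row. *)
Lemma cvg_invmx T (F : set_system T) (FF : Filter F) n (G : T -> 'M[R]_n) (G0 : 'M[R]_n) :
  G0 \in unitmx -> G t @[t --> F] --> G0 ->
  invmx (G t) @[t --> F] --> invmx G0.
Proof.
move=> uG cG; have [C C0 GC] := unitmx_near_bound FF uG cG.
apply/cvgrPdist_le => /= e e0.
pose e1 := e / (C * (n%:R * `|invmx G0| + 1)).
have N0 : 0 < n%:R * `|invmx G0| + 1 by rewrite ltr_wpDl// mulr_ge0.
have e10 : 0 < e1 by rewrite divr_gt0// mulr_gt0.
move/cvgrPdist_le/(_ _ e10) : cG => cG.
apply: filterS2 GC cG => t GC cG.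
have ut : G t \in unitmx.
  apply: inj_unitmx => v vG; apply/eqP; rewrite -normr_le0.
  by apply: le_trans (GC v) _; rewrite vG normr0 mulr0.
apply: mx_norm_le => [|i j]; first exact: ltW.
have -> : (invmx G0 - invmx (G t)) i j = (row i (invmx G0 - invmx (G t))) 0 j.
  by rewrite [RHS]mxE.
apply: le_trans (mx_norm_ge _ _ _) _; apply: le_trans (GC _) _.
have -> : row i (invmx G0 - invmx (G t)) *m G t =
    row i (invmx G0 *m (G t - G0)).
  by rewrite -row_mul mulmxBl mulVmx// mulmxBr mulVmx.
have -> : e = C * (e1 * (n%:R * `|invmx G0| + 1)).
  by rewrite /e1; field; rewrite !gt_eqF.
apply: ler_wpM2l; first exact: ltW.
apply: (@le_trans _ _ `|invmx G0 *m (G t - G0)|).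
  apply: mx_norm_le => // a b; rewrite mxE; exact: mx_norm_ge.
apply: le_trans (mulmx_norm_le _ _) _.
rewrite mulrDr mulr1 [e1 * _]mulrC -mulrA -[leLHS]addr0 lerD ?(ltW e10)//.
by rewrite ler_wpM2l// ler_wpM2l// distrC.
Qed.

Lemma is_derive_invmx V n (G : V -> 'M[R]_n) u v DG :
  G u \in unitmx -> is_derive u v G DG ->
  is_derive u v (fun w => invmx (G w)) (- (invmx (G u) *m DG *m invmx (G u))).
Proof.
move=> uG dG.
have dl : is_derive (0 : R) 1 (fun s : R => G (u + s *: v)) DG.
  have [d1 <-] := dG.
  by have := @is_derive_line _ _ _ G u v 0; rewrite scale0r addr0; apply.
have cl : {for 0, continuous (fun s : R => G (u + s *: v))}.
  by apply: differentiable_continuous; apply/derivable1_diffP; exact: ex_derive.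
have cG : G (u + h *: v) @[h --> 0^'] --> G u.
  have : G (u + h *: v) @[h --> 0^'] --> G (u + (0 : R) *: v).
    by apply: (cvg_trans _ cl); apply: cvg_app; exact: nbhs_dnbhs.
  by rewrite scale0r addr0.
have ciG := cvg_invmx _ uG cG.
have cD : h^-1 *: (G (h *: v + u) - G u) @[h --> 0^'] --> DG.
  by case: dG => dG <-; exact: dG.
have H : - (invmx (G (u + h *: v)) *m (h^-1 *: (G (h *: v + u) - G u)) *m invmx (G u))
   @[h --> 0^'] --> - (invmx (G u) *m DG *m invmx (G u)).
  apply: cvgN; apply: cvg_mulmx; last exact: cvg_cst.
  apply: cvg_mulmx; first exact: ciG.
  exact: cD.
have [C C0 GC] := unitmx_near_bound _ uG cG.
have {}H : h^-1 *: (((fun w => invmx (G w)) \o shift u) (h *: v) - invmx (G u)) @[h --> 0^']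
    --> - (invmx (G u) *m DG *m invmx (G u)).
  apply: cvg_trans H; apply: near_eq_cvg; apply: filterS GC => h GC /=.
  have ut : G (h *: v + u) \in unitmx.
    rewrite addrC; apply: inj_unitmx => z zG; apply/eqP; rewrite -normr_le0.
    by apply: le_trans (GC z) _; rewrite zG normr0 mulr0.
  rewrite (addrC u) -scalemxAr -scalemxAl -scalerN; congr (_ *: _).
  by rewrite mulmxBr mulVmx// mulmxBl mul1mx mulmxK// opprB.
apply: DeriveDef; first by apply/cvg_ex; exists (- (invmx (G u) *m DG *m invmx (G u))).
exact: cvg_lim.
Qed.

(** Transposed with respect to the usual Jacobian: vectors are rows, so the derivative is
    multiplication by [jac] on the right. *)
Definition jac n p (F : 'rV[R]_n -> 'rV[R]_p) u : 'M[R]_(n, p) :=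
  \matrix_i 'D_(delta_mx 0 i) F u.

Section C1.
Context (n p : nat) (U : set 'rV[R]_n) (F : 'rV[R]_n -> 'rV[R]_p).
Context (oU : open U) (CF : Ck_on 1 U F).

Lemma derive_jac u v : U u -> 'D_v F u = v *m jac F u.
Proof.
move=> Uu; apply/rowP => k; rewrite derive_mxE; last exact: (Ck_on_derivable CF).
rewrite (Ck_derive_sum v oU (Ck_on_coord 0 k oU CF) Uu) mxE.
by apply: eq_bigr => i _; rewrite mxE derive_mxE//; exact: (Ck_on_derivable CF).
Qed.

Lemma is_derive_comp_jac V (r : V -> 'rV[R]_n) v b : derivable r v b -> U (r v) ->
  is_derive v b (F \o r) ('D_b r v *m jac F (r v)).
Proof.
move=> dr Uv; rewrite -derive_jac//; apply: is_derive_mx => i j; rewrite ord1.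
have Cj := Ck_on_coord 0 j oU CF.
have := derive_comp dr (C1_differentiable oU Cj Uv).
by rewrite derive_mxE//; exact: (Ck_on_derivable CF).
Qed.

End C1.

Lemma derive2_phess n (U : set 'rV[R]_n) (F : 'rV[R]_n -> R) u a b :
  open U -> Ck_on 2 U F -> U u ->
  'D_a (fun x => 'D_b F x) u = dot (a *m phess F u) b.
Proof.
move=> oU CF Uu.
rewrite (@near_eq_derive _ _ _ _ (fun x => dot (pgrad F x) b)).
  have H := is_derive_dot (is_derive_pgrad a oU CF Uu) (is_derive_cst b u a).
  rewrite (derive_is H).
  by rewrite [X in _ + X]/dot trmx0 mulmx0 mxE addr0.
apply: filterS (open_nbhs_nbhs (conj oU Uu)) => w Uw.
by rewrite (derive_dot b oU CF Uw) dotC.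
Qed.

Lemma derive_comp_mulmx n W (F : 'rV[R]_n -> W) (A : 'M[R]_n) v b :
  'D_b (fun v => F (v *m A)) v = 'D_(b *m A) F (v *m A).
Proof.
rewrite /derive.
suff -> : (fun h : R => h^-1 *: (((fun v => F (v *m A)) \o shift v) (h *: b) - F (v *m A))) =
  (fun h => h^-1 *: ((F \o shift (v *m A)) (h *: (b *m A)) - F (v *m A))) by [].
by apply/funext => h /=; rewrite mulmxDl scalemxAl.
Qed.

Lemma Ck_on_mulmx n p k (A : 'M[R]_(n, p)) :
  Ck_on k setT (fun v : 'rV[R]_n => v *m A).
Proof.
have dA v b : is_derive v b (fun v : 'rV[R]_n => v *m A) (b *m A).
  have := is_derive_mulmx (is_derive_id v b) (is_derive_cst A v b).
  by rewrite mulmx0 addr0.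
have cA v : {for v, continuous (fun v : 'rV[R]_n => v *m A)}.
  apply: (@continuous_mulmx _ _ _ _ _ id (fun=> A) v); first exact: cvg_id.
  exact: cst_continuous.
have Ccst q W (w : W) : Ck_on q setT (fun _ : 'rV[R]_n => w).
  elim: q w => [|q IH] w; split => //; try by move=> *; exact: cst_continuous.
  move=> b; split=> [u _|]; first exact: derivable_cst.
  have -> : (fun u => 'D_b (fun _ : 'rV[R]_n => w) u) = (fun=> 0) => //.
  by apply/funext => u; rewrite derive_cst.
case: k => [|k]; split => // b; split=> [u _|]; first by have [] := dA u b.
have -> : (fun u => 'D_b (fun v : 'rV[R]_n => v *m A) u) = (fun=> b *m A) => //.
by apply/funext => u; exact: (derive_is (dA u b)).
Qed.

Lemma open_slice (V1 V2 : normedModType R) (U : set (V1 * V2)) u :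
  open U -> open [set v | U (u, v)].
Proof.
move=> oU; rewrite (_ : mkset _ = (fun v : V2 => (u, v)) @^-1` U)//.
apply: open_comp => // v _.
by apply: cvg_pair => //=; exact: cvg_cst.
Qed.

End VectorValued.

(** * Charts, metric and Riemannian Hessian *)

Section Transitions.
Context (R : realType) (n : nat) (T : topologicalType) (c c' : chart R n T).
Context (ch : is_chart c) (ch' : is_chart c').

Lemma coordK x : dom c x -> pt c (coord c x) = x.
Proof. by case: ch => _ _ H _ _; exact: H. Qed.

Lemma codom_coord x : dom c x -> codom c (coord c x).
Proof. by move=> dx; exists x. Qed.

Lemma pt_dom u : codom c u -> dom c (pt c u).
Proof. by move=> [x dx <-]; rewrite coordK. Qed.

Lemma ptK u : codom c u -> coord c (pt c u) = u.
Proof. by move=> [x dx <-]; rewrite coordK. Qed.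

Definition overlap : set 'rV[R]_n := coord c @` (dom c `&` dom c').

Lemma overlapP u : codom c u -> dom c' (pt c u) -> overlap u.
Proof. by move=> cu du; exists (pt c u); [split => //; exact: pt_dom|exact: ptK]. Qed.

Lemma overlap_codom u : overlap u -> codom c u.
Proof. by move=> [x [dx _] <-]; exists x. Qed.

Lemma overlap_dom u : overlap u -> dom c' (pt c u).
Proof. by move=> [x [dx dx'] <-]; rewrite coordK. Qed.

Lemma overlap_open : open overlap.
Proof.
rewrite openE => u ou; have cu := overlap_codom ou.
case: (ch) => _ oc _ _ /(_ _ cu) cp; case: (ch') => od' _ _ _ _.
have n1 : nbhs u (codom c) by exact: open_nbhs_nbhs.
have n2 : \forall w \near u, dom c' (pt c w).
  by apply: cp; apply: open_nbhs_nbhs; split => //; exact: overlap_dom.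
by apply: filterS2 n1 n2 => w; exact: overlapP.
Qed.

Lemma transition_codom u : overlap u -> codom c' (transition c c' u).
Proof. by move=> ou; exists (pt c u) => //; exact: overlap_dom. Qed.

End Transitions.

Section TransitionInverse.
Context (R : realType) (n : nat) (T : topologicalType).
Implicit Types c : chart R n T.

Lemma pt_transition c c' u : is_chart c -> is_chart c' -> overlap c c' u ->
  pt c' (transition c c' u) = pt c u.
Proof. by move=> ch ch' ou; rewrite /transition /= coordK//; exact: overlap_dom ou. Qed.

Lemma transition_overlap c c' u : is_chart c -> is_chart c' -> overlap c c' u ->
  overlap c' c (transition c c' u).
Proof.
move=> ch ch' ou; apply: overlapP => //; first exact: transition_codom.
by rewrite pt_transition//; apply: pt_dom => //; exact: overlap_codom ou.
Qed.

Lemma transitionK c c' u : is_chart c -> is_chart c' -> overlap c c' u ->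
  transition c' c (transition c c' u) = u.
Proof.
move=> ch ch' ou; rewrite {1}/transition /= pt_transition//.
by apply: ptK => //; exact: overlap_codom ou.
Qed.

Lemma jac_transitionK c c' u : is_chart c -> is_chart c' ->
  compatible c c' -> compatible c' c -> overlap c c' u ->
  jac (transition c c') u *m jac (transition c' c) (transition c c' u) = 1%:M.
Proof.
move=> ch ch' cc' c'c ou; apply/row_matrixP => i; rewrite rowE [RHS]rowE mulmx1.
have oo := overlap_open ch ch'; have oo' := overlap_open ch' ch.
have d1 := Ck_on_derivable (cc' 1%N) ou.
have d2 := is_derive_comp_jac oo' (c'c 1%N) (d1 (delta_mx 0 i))
  (transition_overlap ch ch' ou).
rewrite (derive_jac oo (cc' 1%N) _ ou) in d2.
have d3 := is_derive_eq_near oo ou (fun w ow => transitionK ch ch' ow) d2.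
rewrite mulmxA -(derive_is d3).
exact: (derive_is (is_derive_id u (delta_mx 0 i))).
Qed.

End TransitionInverse.

Section Tangent.
Context (R : realType) (n : nat) (M : smoothManifold R n).
Implicit Types (c : chart R n M) (x : M) (u v w : 'rV[R]_n).

(** The matrix of [from_chart c u]. It need not be continuous in [u], since [chart_at (pt c u)] may
    change abruptly. *)
Definition tanmx c u : 'M[R]_n := jac (transition c (chart_at (pt c u))) u.

Lemma chart_atP x : is_chart (chart_at x).
Proof. exact/atlas_chart/chart_at_atlas. Qed.

Lemma here_codom x : codom (chart_at x) (here x).
Proof. by exists x => //; exact: chart_at_dom. Qed.

Lemma pt_here x : pt (chart_at x) (here x) = x.
Proof. by apply: coordK; [exact: chart_atP|exact: chart_at_dom]. Qed.

Lemma codom_overlap c u : atlas c -> codom c u -> overlap c (chart_at (pt c u)) u.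
Proof.
by move=> /atlas_chart ch cu; apply: overlapP => //; exact: chart_at_dom.
Qed.

Lemma from_chartE c u v : atlas c -> codom c u -> from_chart c u v = v *m tanmx c u.
Proof.
move=> ac cu; have ch := atlas_chart ac.
apply: (derive_jac (overlap_open ch (chart_atP _))).
  exact: (atlas_compatible ac (chart_at_atlas _) 1%N).
exact: codom_overlap.
Qed.

Lemma tanmxK c u : atlas c -> codom c u ->
  tanmx c u *m jac (transition (chart_at (pt c u)) c) (here (pt c u)) = 1%:M.
Proof.
move=> ac cu; apply: jac_transitionK; [exact: atlas_chart|exact: chart_atP|..].
- exact: (atlas_compatible ac (chart_at_atlas _)).
- exact: (atlas_compatible (chart_at_atlas _) ac).
- exact: codom_overlap.
Qed.

Lemma tanmx_unit c u : atlas c -> codom c u -> tanmx c u \in unitmx.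
Proof. by move=> ac cu; have [] := mulmx1_unit (tanmxK ac cu). Qed.

(** The transition from a chart to itself is the identity on the image of its domain, so it has
    identity derivative there. *)
Lemma tanmx_here x : tanmx (chart_at x) (here x) = 1%:M.
Proof.
rewrite /tanmx pt_here; apply/row_matrixP => i; rewrite rowE [RHS]rowE mulmx1.
have ch := chart_atP x; have cc := atlas_compatible (chart_at_atlas x) (chart_at_atlas x).
have oo := overlap_open ch ch.
have ou : overlap (chart_at x) (chart_at x) (here x).
  by apply: overlapP => //; [exact: here_codom|rewrite pt_here; exact: chart_at_dom].
rewrite -(derive_jac oo (cc 1%N) _ ou).
have E w : overlap (chart_at x) (chart_at x) w -> transition (chart_at x) (chart_at x) w = w.
  by move=> /overlap_codom; exact: ptK.
have d := derivableP (Ck_on_derivable (cc 1%N) ou : derivable _ _ (delta_mx 0 i)).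
rewrite (derive_is (is_derive_eq_near oo ou (fun w ow => esym (E w ow))
  (is_derive_id (here x) (delta_mx 0 i))))//.
Qed.

Lemma from_chart_here x v : from_chart (chart_at x) (here x) v = v.
Proof.
rewrite from_chartE ?tanmx_here ?mulmx1//; first exact: chart_at_atlas.
exact: here_codom.
Qed.

Lemma from_chart0 c u : from_chart c u 0 = 0.
Proof. exact: derive0. Qed.

Lemma Ck_fun_pt k (h : M -> R) c : atlas c -> Ck_fun (W := R^o) k setT h ->
  Ck_on (W := R) k (codom c) (h \o pt c).
Proof.
move=> ac /(_ c ac); apply: Ck_on_subset => u [x dx <-].
by exists x.
Qed.

(** Chart independence of the differential: the chain rule for [h] read through the transition
    map. *)
Lemma pgrad_chart h c u v : atlas c -> codom c u -> Ck_fun (W := R^o) 1 setT h ->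
  dot (v *m tanmx c u) (pgrad (h \o pt (chart_at (pt c u))) (here (pt c u))) =
  dot v (pgrad (h \o pt c) u).
Proof.
move=> ac cu Ch; have ch := atlas_chart ac; set c' := chart_at (pt c u).
have ch' := chart_atP (pt c u); have ac' := chart_at_atlas (pt c u).
have oo := overlap_open ch ch'; have ou := codom_overlap ac cu.
have Cc := Ck_fun_pt ac Ch; have Cc' := Ck_fun_pt ac' Ch.
have oc : open (codom c) by case: ch.
have oc' : open (codom c') by case: ch'.
rewrite -(derive_dot v oc Cc cu) -(derive_jac oo (atlas_compatible ac ac' 1%N) v ou).
have H := is_derive_comp_dot oc' (transition_codom ch (c' := c')) v Cc'
  (atlas_compatible ac ac' 1%N) ou.
apply: esym; apply: (derive_is (is_derive_eq_near oo ou _ H)).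
by move=> w ow; rewrite /= pt_transition.
Qed.

End Tangent.

Section Riemann.
Context (R : realType) (n : nat) (M : riemannianManifold R n).
Implicit Types (c : chart R n M) (x : M) (u v w xi eta a : 'rV[R]_n).

Lemma metric_posdef x : posdef (metric x).
Proof. by move=> v v0; exact: (metric_pos x v0). Qed.

Lemma innerE x v w : inner x v w = dot (v *m metric x) w.
Proof. by []. Qed.

Lemma gramE c u : atlas c -> codom c u ->
  gram c u = tanmx c u *m metric (pt c u) *m (tanmx c u)^T.
Proof.
move=> ac cu; apply/matrixP => i j.
rewrite /gram /met_gram mxE !from_chartE// -!rowE /met_inner -row_mul.
rewrite [LHS]mxE [RHS]mxE; apply: eq_bigr => k _.
by rewrite !mxE.
Qed.

Lemma inner_chart c u v w : atlas c -> codom c u ->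
  inner (pt c u) (v *m tanmx c u) (w *m tanmx c u) = dot (v *m gram c u) w.
Proof.
move=> ac cu; rewrite innerE gramE// /dot trmx_mul !mulmxA.
by [].
Qed.

Lemma gram_sym c u : atlas c -> codom c u -> (gram c u)^T = gram c u.
Proof.
move=> ac cu; rewrite gramE// !trmx_mul trmxK metric_sym mulmxA//.
Qed.

Lemma gram_posdef c u : atlas c -> codom c u -> posdef (gram c u).
Proof.
move=> ac cu v v0; rewrite -inner_chart//; apply: metric_posdef.
apply: contra v0 => /eqP vA.
by rewrite -(mulmxK (tanmx_unit ac cu) v) vA mul0mx.
Qed.

Lemma gram_unit c u : atlas c -> codom c u -> gram c u \in unitmx.
Proof. by move=> ac cu; exact/posdef_unitmx/gram_posdef. Qed.

Lemma gram_here x : gram (chart_at x) (here x) = metric x.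
Proof.
rewrite gramE ?tanmx_here ?trmx1 ?mulmx1 ?mul1mx ?pt_here//.
  exact: chart_at_atlas.
exact: here_codom.
Qed.

Lemma gram_continuous c u : atlas c -> codom c u -> {for u, continuous (gram c)}.
Proof. by move=> ac; exact: (Ck_on_continuous (metric_smooth ac 0%N)). Qed.

Lemma gradE h x : grad h x =
  pgrad (h \o pt (chart_at x)) (here x) *m invmx (gram (chart_at x) (here x)).
Proof. by []. Qed.

Lemma inner_grad h x xi :
  inner x (grad h x) xi = dot xi (pgrad (h \o pt (chart_at x)) (here x)).
Proof.
rewrite innerE (gradE h x) -(gram_here x) mulmxKV; first exact: dotC.
exact: gram_unit (chart_at_atlas x) (here_codom x).
Qed.

Lemma inner_grad_chart h c u v : atlas c -> codom c u -> Ck_fun (W := R^o) 1 setT h ->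
  inner (pt c u) (grad h (pt c u)) (v *m tanmx c u) = dot v (pgrad (h \o pt c) u).
Proof. by move=> ac cu Ch; rewrite inner_grad pgrad_chart. Qed.

Definition gram_deriv c u v : 'M[R]_n :=
  \sum_i v 0 i *: \matrix_(j, l) dgram c u i j l.

Lemma is_derive_gram c u v : atlas c -> codom c u ->
  is_derive u v (gram c) (gram_deriv c u v).
Proof.
move=> ac cu; have oc : open (codom c) by case: (atlas_chart ac).
have Cg := metric_smooth ac 1%N.
apply: is_derive_mx => j l; have Cjl := Ck_on_coord j l oc Cg.
have -> : gram_deriv c u v j l = \sum_i v 0 i * dgram c u i j l.
  by rewrite /gram_deriv summxE; apply: eq_bigr => i _; rewrite !mxE.
have := derivableP (Ck_on_derivable Cjl cu : derivable _ _ v).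
rewrite (Ck_derive_sum v oc Cjl cu).
exact.
Qed.

Lemma gram_deriv_sym c u v : atlas c -> codom c u ->
  (gram_deriv c u v)^T = gram_deriv c u v.
Proof.
move=> ac cu; have oc : open (codom c) by case: (atlas_chart ac).
have d := is_derive_gram v ac cu.
have d' := is_derive_eq_near oc cu (fun w cw => gram_sym ac cw) (is_derive_trmx d).
exact: etrans (esym (derive_is d')) (derive_is d).
Qed.

(** The derivative of the metric along [xi], evaluated on [a] and [eta]; the Christoffel symbols are
    combinations of three such terms. *)
Definition tri c u xi a eta : R := dot (a *m gram_deriv c u xi) eta.

Lemma triE c u xi a eta : tri c u xi a eta =
  \sum_i \sum_j \sum_l dgram c u i j l * xi 0 i * a 0 j * eta 0 l.
Proof.
rewrite /tri /gram_deriv mulmx_sumr dot_suml; apply: eq_bigr => i _.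
rewrite -scalemxAr dotZl dotE exchange_big mulr_sumr /=; apply: eq_bigr => l _.
rewrite mxE mulr_suml mulr_sumr; apply: eq_bigr => j _; rewrite mxE; ring.
Qed.

Lemma tri_sym c u xi a eta : atlas c -> codom c u ->
  tri c u xi a eta = tri c u xi eta a.
Proof. by move=> ac cu; rewrite /tri dot_symmx// gram_deriv_sym. Qed.

(** The Koszul formula for constant coordinate fields. Lowering the index with the Gram matrix
    removes the inverse in the definition of the symbols; the remainder is reindexing. *)
Lemma christoffel_inner c u xi a eta : atlas c -> codom c u ->
  dot (christoffel_apply c u xi a *m gram c u) eta =
  2^-1 * (tri c u xi a eta + tri c u a xi eta - tri c u eta xi a).
Proof.
move=> ac cu; pose T i j l := dgram c u i j l + dgram c u j i l - dgram c u l i j.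
pose tau : 'rV[R]_n := \row_l (2^-1 * \sum_i \sum_j T i j l * xi 0 i * a 0 j).
have uG := gram_unit ac cu.
have iG : (invmx (gram c u))^T = invmx (gram c u) by rewrite trmx_inv gram_sym.
have -> : christoffel_apply c u xi a = tau *m invmx (gram c u).
  apply/rowP => k; rewrite !mxE.
  transitivity (\sum_i \sum_j \sum_l
     2^-1 * (T i j l * xi 0 i * a 0 j) * invmx (gram c u) k l).
    apply: eq_bigr => i _; apply: eq_bigr => j _; rewrite /christoffel.
    rewrite mulr_sumr !mulr_suml; apply: eq_bigr => l _; rewrite /T; ring.
  under eq_bigr do rewrite exchange_big.
  rewrite exchange_big /=; apply: eq_bigr => l _.
  rewrite [tau _ _]mxE -{1}iG mxE mulr_sumr mulr_suml; apply: eq_bigr => i _.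
  by rewrite mulr_sumr mulr_suml; apply: eq_bigr => j _.
rewrite mulmxKV// dotE.
transitivity (2^-1 * \sum_i \sum_j \sum_l T i j l * xi 0 i * a 0 j * eta 0 l).
  transitivity (\sum_l 2^-1 * \sum_i \sum_j T i j l * xi 0 i * a 0 j * eta 0 l).
    apply: eq_bigr => l _; rewrite mxE -mulrA; congr (_ * _).
    rewrite mulr_suml; apply: eq_bigr => i _; rewrite mulr_suml.
    by apply: eq_bigr => j _.
  rewrite -mulr_sumr; congr (_ * _); rewrite exchange_big; apply: eq_bigr => i _.
  by rewrite exchange_big.
congr (_ * _); rewrite !triE.
have -> : \sum_i \sum_j \sum_l dgram c u i j l * a 0 i * xi 0 j * eta 0 l =
   \sum_i \sum_j \sum_l dgram c u j i l * xi 0 i * a 0 j * eta 0 l.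
  rewrite exchange_big; apply: eq_bigr => i _; apply: eq_bigr => j _.
  by apply: eq_bigr => l _; ring.
have -> : \sum_i \sum_j \sum_l dgram c u i j l * eta 0 i * xi 0 j * a 0 l =
   \sum_i \sum_j \sum_l dgram c u l i j * xi 0 i * a 0 j * eta 0 l.
  rewrite exchange_big; apply: eq_bigr => i _; rewrite exchange_big.
  by apply: eq_bigr => j _; apply: eq_bigr => l _; ring.
rewrite -big_split -sumrB; apply: eq_bigr => i _.
rewrite -big_split -sumrB; apply: eq_bigr => j _.
rewrite -big_split -sumrB; apply: eq_bigr => l _.
by rewrite /T /=; ring.
Qed.

(** The classical expression of the covariant Hessian. Differentiating the inverse Gram matrix in
    the gradient yields a [tri] term, which combines with the Koszul formula for the gradient into
    minus the Koszul formula for [eta]. *)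
Lemma Hess_inner_here h x xi eta : Ck_fun (W := R^o) 2 setT h ->
  inner x (Hess h x xi) eta =
  dot (xi *m phess (h \o pt (chart_at x)) (here x)) eta -
  dot (christoffel_apply (chart_at x) (here x) xi eta)
      (pgrad (h \o pt (chart_at x)) (here x)).
Proof.
move=> Ch; set c := chart_at x; set u := here x; set hc := h \o pt c.
have ac : atlas c by exact: chart_at_atlas.
have cu : codom c u by exact: here_codom.
have oc : open (codom c) by case: (atlas_chart ac).
have Chc : Ck_on 2 (codom c) hc by exact: Ck_fun_pt.
have uG := gram_unit ac cu.
have sG := gram_sym ac cu.
pose X0 := pgrad hc u *m invmx (gram c u).
have dX := is_derive_mulmx (is_derive_pgrad xi oc Chc cu)
  (is_derive_invmx uG (is_derive_gram xi ac cu)).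
have EX : 'D_xi (grad_in c h) u = (xi *m phess hc u - X0 *m gram_deriv c u xi)
    *m invmx (gram c u).
  rewrite (derive_is dX) /X0 mulmxBl mulmxN !mulmxA//.
have EH : Hess h x xi = 'D_xi (grad_in c h) u + christoffel_apply c u xi (grad h x) by [].
rewrite innerE EH EX -(gram_here x) -/c -/u.
rewrite [(_ + christoffel_apply _ _ _ _) *m _]mulmxDl dotDl mulmxKV// christoffel_inner//.
have -> : pgrad hc u = X0 *m gram c u by rewrite mulmxKV.
have -> : dot (christoffel_apply c u xi eta) (X0 *m gram c u) =
    dot (christoffel_apply c u xi eta *m gram c u) X0 by rewrite dotC dot_symmx.
rewrite christoffel_inner//.
rewrite gradE -/c -/u -/hc -/X0.
rewrite dotBl -/(tri c u xi X0 eta).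
rewrite (tri_sym xi eta X0)//.
by field.
Qed.

End Riemann.

(** * Retractions *)

Section SecondDerivatives.
Context (R : realType).
Implicit Types V W : normedModType R.

Lemma derive2_coord V p q (U : set V) (F : V -> 'M[R]_(p, q)) u a b i j :
  open U -> Ck_on 2 U F -> U u ->
  ('D_a (fun x => 'D_b F x) u) i j = 'D_a (fun x => 'D_b (fun y => F y i j) x) u.
Proof.
move=> oU CF Uu; rewrite derive_mxE; last exact: (Ck_on_derivable (Ck_on_derive b CF)).
apply: near_eq_derive; apply: filterS (open_nbhs_nbhs (conj oU Uu)) => w Uw.
by rewrite derive_mxE//; exact: (Ck_on_derivable CF).
Qed.

Lemma derive2_eq_near V W (U : set V) (F G : V -> W) u a b :
  open U -> U u -> (forall w, U w -> F w = G w) ->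
  'D_a (fun x => 'D_b F x) u = 'D_a (fun x => 'D_b G x) u.
Proof.
move=> oU Uu FG; apply: near_eq_derive.
apply: filterS (open_nbhs_nbhs (conj oU Uu)) => w Uw; apply: near_eq_derive.
by apply: filterS (open_nbhs_nbhs (conj oU Uw)).
Qed.

End SecondDerivatives.

Section Christoffel.
Context (R : realType) (n : nat) (M : riemannianManifold R n) (c : chart R n M).
Context (u : 'rV[R]_n) (ac : atlas c) (cu : codom c u).
Implicit Types a b : 'rV[R]_n.

Lemma christoffel_sym k i j : christoffel c u k i j = christoffel c u k j i.
Proof.
rewrite /christoffel; congr (_ * _); apply: eq_bigr => l _; congr (_ * _).
suff -> : dgram c u l i j = dgram c u l j i by rewrite (addrC (dgram c u i j l)).
have oc : open (codom c) by case: (atlas_chart ac).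
apply: near_eq_derive; apply: filterS (open_nbhs_nbhs (conj oc cu)) => w cw.
by rewrite -{1}(gram_sym ac cw) mxE.
Qed.

Lemma christoffel_applyC a b : christoffel_apply c u a b = christoffel_apply c u b a.
Proof.
apply/rowP => k; rewrite !mxE exchange_big; apply: eq_bigr => i _.
apply: eq_bigr => j _; rewrite christoffel_sym; ring.
Qed.

Lemma christoffel_applyDl a a' b : christoffel_apply c u (a + a') b =
  christoffel_apply c u a b + christoffel_apply c u a' b.
Proof.
apply/rowP => k; rewrite !mxE -big_split; apply: eq_bigr => i _.
rewrite -big_split; apply: eq_bigr => j _; rewrite mxE /=; ring.
Qed.

Lemma christoffel_applyDr a b b' : christoffel_apply c u a (b + b') =
  christoffel_apply c u a b + christoffel_apply c u a b'.
Proof. by rewrite christoffel_applyC christoffel_applyDl !(christoffel_applyC a). Qed.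

End Christoffel.

Section Retraction.
Context (R : realType) (n : nat) (M : riemannianManifold R n).
Context (Rt : M -> 'rV[R]_n -> M) (Rr : retraction Rt).
Implicit Types (c : chart R n M) (x : M) (u v w xi eta a b : 'rV[R]_n).

(** The base point, the tangent vector and the result are all read in the single chart [c]; this is
    what makes the map jointly smooth in the base point and the vector. *)
Definition Rchart c (p : 'rV[R]_n * 'rV[R]_n) : 'rV[R]_n :=
  coord c (Rt (pt c p.1) (from_chart c p.1 p.2)).

Definition Rdom c : set ('rV[R]_n * 'rV[R]_n) :=
  [set p | codom c p.1] `&` (fun p => Rt (pt c p.1) (from_chart c p.1 p.2)) @^-1` dom c.

Lemma Rdom_open c : atlas c -> open (Rdom c).
Proof. by move=> ac; case: Rr => /(_ c 0%N ac c ac)[]. Qed.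

Lemma Rchart_smooth c k : atlas c -> Ck_on k (Rdom c) (Rchart c).
Proof. by move=> ac; case: Rr => /(_ c k ac c ac)[]. Qed.

Lemma retraction0 x : Rt x 0 = x.
Proof. by case: Rr. Qed.

Lemma Rdom0 c u : atlas c -> codom c u -> Rdom c (u, 0).
Proof.
move=> ac cu; split => //=; rewrite from_chart0 retraction0.
exact: pt_dom (atlas_chart ac) _ cu.
Qed.

Lemma pt_Rchart c p : atlas c -> Rdom c p ->
  pt c (Rchart c p) = Rt (pt c p.1) (from_chart c p.1 p.2).
Proof. by move=> ac [_ dp]; apply: coordK dp; exact: atlas_chart. Qed.

Lemma Rchart_codom c p : Rdom c p -> codom c (Rchart c p).
Proof. by move=> [_ dp]; exact: codom_coord. Qed.

Lemma Rchart0 c u : atlas c -> codom c u -> Rchart c (u, 0) = u.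
Proof.
move=> ac cu; rewrite /Rchart /= from_chart0 retraction0.
exact: ptK (atlas_chart ac) _ cu.
Qed.

Definition Rslice c u : set 'rV[R]_n := [set v | Rdom c (u, v)].

Lemma Rslice_open c u : atlas c -> open (Rslice c u).
Proof. by move=> ac; apply: open_slice; exact: Rdom_open. Qed.

Lemma Rslice_smooth c u k : atlas c -> Ck_on k (Rslice c u) (fun v => Rchart c (u, v)).
Proof. by move=> ac; apply: Ck_on_slice; exact: Rchart_smooth. Qed.

Definition Rhere x : 'rV[R]_n -> 'rV[R]_n := coord (chart_at x) \o Rt x.

Lemma RhereE x : Rhere x = (fun v => Rchart (chart_at x) (here x, v)).
Proof. by apply/funext => v; rewrite /Rchart /= pt_here from_chart_here. Qed.

Definition Rhere_dom x := Rslice (chart_at x) (here x).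

Lemma Rhere_domE x v : Rhere_dom x v = dom (chart_at x) (Rt x v).
Proof.
apply/propext; rewrite /Rhere_dom /Rslice /Rdom /= pt_here from_chart_here.
by split=> [[]//|dx]; split => //; exact: here_codom.
Qed.

Lemma Rhere_dom0 x : Rhere_dom x 0.
Proof. by rewrite Rhere_domE retraction0; exact: chart_at_dom. Qed.

Lemma Rhere_open x : open (Rhere_dom x).
Proof. by apply: Rslice_open; exact: chart_at_atlas. Qed.

Lemma Rhere_smooth x k : Ck_on k (Rhere_dom x) (Rhere x).
Proof. by rewrite RhereE; apply: Rslice_smooth; exact: chart_at_atlas. Qed.

Lemma Rhere0 x : Rhere x 0 = here x.
Proof. by rewrite /Rhere /= retraction0. Qed.

Lemma derive_Rhere x xi : 'D_xi (Rhere x) 0 = xi.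
Proof. by case: Rr => _ _; apply. Qed.

(** Zero acceleration at [t = 0] of the curve with initial velocity [xi] is exactly this equation,
    once the curve is written in the chart at its starting point. *)
Lemma second_order_Rhere x xi : second_order Rt ->
  'D_xi (fun v => 'D_xi (Rhere x) v) 0 =
  - christoffel_apply (chart_at x) (here x) xi xi.
Proof.
move=> so; have so' : cov_along (chart_at (Rt x (0 *: xi)))
   (coord (chart_at (Rt x (0 *: xi))) \o (fun t => Rt x (t *: xi)))
   (derive1 (coord (chart_at (Rt x (0 *: xi))) \o (fun t => Rt x (t *: xi)))) 0 = 0.
  exact: so x xi.
rewrite scale0r retraction0 in so'.
have E : coord (chart_at x) \o (fun t => Rt x (t *: xi)) = (fun t => Rhere x (t *: xi)).
  by [].
rewrite {}E in so'; set p := (fun t => Rhere x (t *: xi)) in so'.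
have U0 := Rhere_dom0 x; have oU := @Rhere_open x.
have dF (W : normedModType R) (F : 'rV[R]_n -> W) (t : R) : derivable F (t *: xi) xi ->
    is_derive t 1 (fun s : R => F (s *: xi)) ('D_xi F (t *: xi)).
  have := @is_derive_line _ _ _ F 0 xi t; rewrite add0r.
  by under eq_fun do rewrite add0r; apply.
have dp t : Rhere_dom x (t *: xi) -> derive1 p t = 'D_xi (Rhere x) (t *: xi).
  move=> Ut; rewrite derive1E; apply: (derive_is (dF _ _ _ _)).
  exact: (Ck_on_derivable (Rhere_smooth x 1) Ut).
have oT : open [set t : R | Rhere_dom x (t *: xi)].
  by apply: (open_comp _ oU) => t _; exact: scalel_continuous.
have T0 : Rhere_dom x ((0 : R) *: xi) by rewrite scale0r.
have ddp : derive1 (derive1 p) 0 = 'D_xi (fun v => 'D_xi (Rhere x) v) 0.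
  rewrite derive1E; have := dF _ (fun v => 'D_xi (Rhere x) v) 0.
  rewrite scale0r => /(_ (Ck_on_derivable (Ck_on_derive xi (Rhere_smooth x 2)) U0)) H.
  exact: (derive_is (is_derive_eq_near oT T0 (fun t Tt => esym (dp t Tt)) H)).
move: so'; rewrite /cov_along ddp (dp 0 T0) scale0r derive_Rhere.
by rewrite /p scale0r Rhere0 => /eqP; rewrite addr_eq0 => /eqP.
Qed.

(** Polarization of the diagonal case: both sides are symmetric bilinear, the left one by Schwarz
    and the right one by the symmetry of the Christoffel symbols. *)
Lemma second_derive_Rhere x a b : second_order Rt ->
  'D_a (fun v => 'D_b (Rhere x) v) 0 =
  - christoffel_apply (chart_at x) (here x) a b.
Proof.
move=> so; have U0 := Rhere_dom0 x; have oU := @Rhere_open x.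
have C2 := Rhere_smooth x 2.
have ac := chart_at_atlas x; have cu := here_codom x.
apply/rowP => k; pose F v := Rhere x v 0 k.
have CF : Ck_on 2 (Rhere_dom x) F by exact: Ck_on_coord.
pose S a b := dot (a *m phess F 0) b.
have SE a' b' : ('D_a' (fun v => 'D_b' (Rhere x) v) 0) 0 k = S a' b'.
  by rewrite (derive2_coord _ _ _ _ oU C2 U0) (derive2_phess _ _ oU CF U0).
have Ssym : S b a = S a b by rewrite /S dot_symmx// (phess_sym oU CF U0).
have D a' : S a' a' = - christoffel_apply (chart_at x) (here x) a' a' 0 k.
  by rewrite -SE second_order_Rhere// mxE.
have := D (a + b); have Da := D a; have Db := D b.
rewrite /S mulmxDl dotDl !dotDr -/(S a a) -/(S a b) -/(S b a) -/(S b b) Ssym Da Db.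
rewrite christoffel_applyDl !christoffel_applyDr// (christoffel_applyC ac cu b a).
have PE (A B : 'rV[R]_n) : (A + B) 0 k = A 0 k + B 0 k by rewrite mxE.
have NE (A : 'rV[R]_n) : (- A) 0 k = - A 0 k by rewrite mxE.
rewrite !PE SE NE.
move: (christoffel_apply _ _ _ _ _ _) (christoffel_apply _ _ _ _ _ _)
  (christoffel_apply _ _ _ _ _ _) (S a b) => r1 r2 r3 s; lra.
Qed.

(** In the second-order chain rule the second derivative of the retraction at 0 is minus the
    Christoffel term, which is the correction separating the covariant Hessian from the coordinate
    one. *)
Lemma Hess_pullback h x xi eta : second_order Rt -> Ck_fun (W := R^o) 2 setT h ->
  inner x (Hess h x xi) eta = 'D_xi (fun v => 'D_eta (h \o Rt x) v) 0.
Proof.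
move=> so Ch; rewrite Hess_inner_here//.
have U0 := Rhere_dom0 x; have oU := @Rhere_open x.
have ac := chart_at_atlas x; have cu := here_codom x.
have oc : open (codom (chart_at x)) by case: (atlas_chart ac).
rewrite (@derive2_eq_near _ _ _ _ _ ((h \o pt (chart_at x)) \o Rhere x) 0 xi eta oU U0).
  have RC v : Rhere_dom x v -> codom (chart_at x) (Rhere x v).
    by rewrite Rhere_domE; exact: codom_coord.
  rewrite (derive_is (is_derive2_comp oU oc RC xi eta
    (Ck_fun_pt ac Ch) (Rhere_smooth x 2) U0)).
  by rewrite !derive_Rhere Rhere0 second_derive_Rhere// dotNl.
move=> v; rewrite Rhere_domE /= => dv.
by rewrite coordK//; exact: chart_atP.
Qed.

Definition pullback c u (h : M -> R) : 'rV[R]_n -> R :=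
  (h \o pt c) \o (fun v => Rchart c (u, v)).

Lemma pullbackE c u h v : atlas c -> Rslice c u v ->
  pullback c u h v = (h \o Rt (pt c u)) (v *m tanmx c u).
Proof.
move=> ac Uv; rewrite /pullback /= pt_Rchart//= from_chartE//.
by case: Uv.
Qed.

Lemma pullback_C2 c u h : atlas c -> Ck_fun (W := R^o) 2 setT h ->
  Ck_on 2 (Rslice c u) (pullback c u h).
Proof.
move=> ac Ch; apply: (@Ck_on2_comp _ _ _ _ (codom c)).
- exact: Rslice_open.
- by case: (atlas_chart ac).
- by move=> v; exact: Rchart_codom.
- exact: Ck_fun_pt.
- exact: Rslice_smooth.
Qed.

Lemma derive2_pullback c u h v a b : atlas c -> Rslice c u v ->
  'D_a (fun w => 'D_b (pullback c u h) w) v =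
  'D_(a *m tanmx c u) (fun w => 'D_(b *m tanmx c u) (h \o Rt (pt c u)) w)
     (v *m tanmx c u).
Proof.
move=> ac Uv.
rewrite (derive2_eq_near _ _ (@Rslice_open c u ac) Uv (fun w Uw => pullbackE h ac Uw)).
rewrite -(derive_comp_mulmx (fun w => 'D_(b *m tanmx c u) (h \o Rt (pt c u)) w)).
congr ('D_a _ v); apply/funext => w.
exact: (derive_comp_mulmx (h \o Rt (pt c u))).
Qed.

Lemma Hess_inner_chart c u h a b : second_order Rt -> Ck_fun (W := R^o) 2 setT h ->
  atlas c -> codom c u ->
  inner (pt c u) (Hess h (pt c u) (a *m tanmx c u)) (b *m tanmx c u) =
  dot (a *m phess (pullback c u h) 0) b.
Proof.
move=> so Ch ac cu; have U0 : Rslice c u 0 by exact: Rdom0.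
rewrite Hess_pullback// -(derive2_phess _ _ (@Rslice_open c u ac) (pullback_C2 u ac Ch) U0).
by rewrite (derive2_pullback h a b ac U0) (mul0mx _ (tanmx c u)).
Qed.

(** The retraction axiom gives this only in the chart selected at the base point; the derivative of
    the transition back to [c] cancels the factor [tanmx c u]. *)
Lemma derive_Rchart0 c u a : atlas c -> codom c u ->
  'D_a (fun v => Rchart c (u, v)) 0 = a.
Proof.
move=> ac cu; set x := pt c u; have ac' := chart_at_atlas x.
have ch := atlas_chart ac; have ch' := chart_atP x.
have oo := overlap_open ch' ch.
have oU := @Rslice_open c u ac; have U0 : Rslice c u 0 by exact: Rdom0.
have oU' := @Rhere_open x.
pose r v := Rhere x (v *m tanmx c u).
pose O := Rslice c u `&` (fun v => v *m tanmx c u) @^-1` Rhere_dom x.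
have oO : open O.
  apply: openI => //; apply: open_comp => // v _.
  exact: (Ck_on_continuous (Ck_on_mulmx 0 (tanmx c u)) (I : setT v)).
have O0 : O 0 by split => //=; rewrite mul0mx; exact: Rhere_dom0.
have dr : is_derive 0 a r (a *m tanmx c u).
  have dl := derivableP (Ck_on_derivable (Ck_on_mulmx 1 (tanmx c u)) (I : setT 0)
     : derivable _ _ a).
  have Um : Rhere_dom x ((0 : 'rV_n) *m tanmx c u) by rewrite mul0mx; exact: Rhere_dom0.
  have := is_derive_comp_jac oU' (Rhere_smooth x 1) (derivable_is dl) Um.
  rewrite -(derive_jac oU' (Rhere_smooth x 1) _ Um) mul0mx derive_Rhere.
  suff -> : 'D_a (fun v : 'rV[R]_n => v *m tanmx c u) 0 = a *m tanmx c u by [].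
  have := is_derive_mulmx (is_derive_id 0 a) (is_derive_cst (tanmx c u) 0 a).
  by rewrite mulmx0 addr0 => H; exact: derive_is H.
have our : overlap (chart_at x) c (r 0).
  rewrite /r mul0mx Rhere0; apply: overlapP => //; first exact: here_codom.
  by rewrite pt_here; exact: pt_dom.
have H := is_derive_comp_jac oo (atlas_compatible ac' ac 1%N)
  (derivable_is dr) our.
rewrite (derive_is dr) {2}/r mul0mx Rhere0 -mulmxA tanmxK// mulmx1 in H.
apply: (derive_is (is_derive_eq_near oO O0 _ H)).
move=> v [Uv Uv']; rewrite /r /transition /= coordK//.
  by rewrite /Rchart /= from_chartE.
by move: Uv'; rewrite /= Rhere_domE.
Qed.

End Retraction.

(** * Riemannian norms against coordinate norms *)

Section Norms.
Context (R : realType) (n : nat) (M : riemannianManifold R n).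
Implicit Types (c : chart R n M) (x : M) (u v w : 'rV[R]_n).

Lemma subr1_le_sqr (t : R) : 1 <= t -> t - 1 <= t ^+ 2.
Proof. by move=> t1; nra. Qed.

Lemma norm_ge0 x v : 0 <= norm x v.
Proof. exact: sqrtr_ge0. Qed.

Lemma norm_sqr x v : norm x v ^+ 2 = inner x v v.
Proof. by rewrite /norm sqr_sqrtr// innerE; exact/posdef_ge0/metric_posdef. Qed.

Lemma inner_norm_le x v w : `|inner x v w| <= norm x v * norm x w.
Proof.
rewrite -ler_sqr ?nnegrE ?mulr_ge0 ?norm_ge0// exprMn !norm_sqr !innerE.
rewrite real_normK ?num_real//.
by apply: Cauchy_Schwarz; [exact: metric_sym | exact: metric_posdef].
Qed.

Lemma norm_eq0 x v : norm x v = 0 -> v = 0.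
Proof.
move=> v0; apply/eqP; apply: contraT => /(@metric_posdef _ _ M x); rewrite -innerE -norm_sqr v0.
by rewrite expr0n ltxx.
Qed.

Lemma normZ x k v : norm x (k *: v) = `|k| * norm x v.
Proof.
rewrite /norm !innerE -scalemxAl dotZl dotZr mulrA -expr2 sqrtrM ?sqr_ge0//.
by rewrite sqrtr_sqr.
Qed.

Lemma norm0 x : norm x 0 = 0.
Proof. by rewrite -[0 in LHS](scale0r (0 : 'rV[R]_n)) normZ normr0 mul0r. Qed.

Lemma norm_le_mx_norm (x : M) : exists2 C : R, 0 < C & forall v, norm x v <= C * `|v|.
Proof.
pose C := n%:R * (n%:R * `|metric x|) + 1.
have C0 : 0 < C by rewrite ltr_wpDl// !mulr_ge0.
exists C => // v; rewrite -ler_sqr ?nnegrE ?mulr_ge0 ?norm_ge0// ?(ltW C0)// norm_sqr innerE.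
apply: le_trans (ler_norm _) _; apply: le_trans (dot_norm_le _ _) _.
apply: (@le_trans _ _ (n%:R * (n%:R * (`|v| * `|metric x|) * `|v|))).
  by rewrite ler_wpM2l// ler_wpM2r// mulmx_norm_le.
have -> : n%:R * (n%:R * (`|v| * `|metric x|) * `|v|) = (C - 1) * `|v| ^+ 2.
  by rewrite /C; ring.
rewrite exprMn ler_wpM2r ?sqr_ge0//.
have : 1 <= C by rewrite /C lerDr !mulr_ge0.
exact: subr1_le_sqr.
Qed.

(** The operator norm is a [sup], informative only once the set of values is known to be bounded;
    coercivity of the metric on the unit ball supplies the bound. *)
Lemma opnorm_bound x (K : 'M[R]_n) v :
  norm x (v *m K) <= opnorm x (fun w => w *m K) * norm x v.
Proof.
set S := [set norm x (w *m K) | w in [set w | norm x w <= 1]].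
have hS : has_sup S.
  split; first by exists (norm x (0 *m K)), 0 => //=; rewrite norm0 ler01.
  have [C C0 CP] := norm_le_mx_norm x.
  have [c c0 cP] := posdef_coercive (metric_sym x) (@metric_posdef _ _ M x).
  exists (C * (n%:R * ((c^-1 + 1) * `|K|))) => _ [w /= w1 <-].
  apply: le_trans (CP _) _; rewrite ler_wpM2l ?(ltW C0)//.
  apply: le_trans (mulmx_norm_le _ _) _; rewrite ler_wpM2l// ler_wpM2r//.
  have := cP w; rewrite -innerE -norm_sqr => H.
  have H1 : `|w| ^+ 2 <= c^-1.
    rewrite -[leRHS]mulr1 ler_pdivlMl//; apply: le_trans H _.
    by rewrite expr_le1// norm_ge0.
  have := normr_ge0 w; have : 0 < c^-1 by rewrite invr_gt0.
  by move: (c^-1) H1 => d; nra.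
have [v0|v0] := eqVneq (norm x v) 0.
  by rewrite (norm_eq0 v0) mul0mx norm0 mulr0.
have vp : 0 < norm x v by rewrite lt0r v0 norm_ge0.
rewrite -ler_pdivrMr//; apply: (sup_upper_bound hS).
exists ((norm x v)^-1 *: v).
  by rewrite /= normZ ger0_norm ?invr_ge0 ?norm_ge0// mulVf.
by rewrite -scalemxAl normZ ger0_norm ?invr_ge0 ?norm_ge0// mulrC.
Qed.

(** The constants are uniform in [u] although [tanmx] may jump: the squared norm is the quadratic
    form of the Gram matrix, which is continuous and positive definite at [us]. *)
Lemma norm_equiv c us : atlas c -> codom c us ->
  exists k : R * R, [/\ 0 < k.1, 0 < k.2 &
   \forall u \near us, codom c u /\
     forall v, k.1 * `|v| <= norm (pt c u) (v *m tanmx c u) <= k.2 * `|v|].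
Proof.
move=> ac cs; have oc : open (codom c) by case: (atlas_chart ac).
have cg := gram_continuous ac cs.
have [l l0 lP] := posdef_near (nbhs_filter us) (gram_sym ac cs) (gram_posdef ac cs) cg.
pose C := n%:R * (n%:R * (`|gram c us| + 1)) + 1.
have C0 : 0 < C by rewrite ltr_wpDl// !mulr_ge0// addr_ge0.
exists (Num.sqrt l, C); split => //=; first by rewrite sqrtr_gt0.
move/cvgrPdist_le/(_ _ ltr01) : cg => cg.
have nc : \forall u \near us, codom c u by exact: open_nbhs_nbhs.
near=> u; have cu : codom c u by near: u.
have lu : forall v, l * `|v| ^+ 2 <= dot (v *m gram c u) v by near: u.
split => // v.
have E : norm (pt c u) (v *m tanmx c u) ^+ 2 = dot (v *m gram c u) v.
  by rewrite norm_sqr inner_chart.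
apply/andP; split.
  rewrite -ler_sqr ?nnegrE ?mulr_ge0 ?norm_ge0 ?sqrtr_ge0// E exprMn sqr_sqrtr ?(ltW l0)//.
rewrite -ler_sqr ?nnegrE ?mulr_ge0 ?norm_ge0 ?(ltW C0)// E.
have gu : `|gram c u| <= `|gram c us| + 1.
  by apply: norm_le_dist; near: u.
apply: le_trans (ler_norm _) _; apply: le_trans (dot_norm_le _ _) _.
apply: (@le_trans _ _ (n%:R * (n%:R * (`|v| * (`|gram c us| + 1)) * `|v|))).
  rewrite ler_wpM2l// ler_wpM2r//; apply: le_trans (mulmx_norm_le _ _) _.
  by rewrite ler_wpM2l// ler_wpM2l.
have -> : n%:R * (n%:R * (`|v| * (`|gram c us| + 1)) * `|v|) = (C - 1) * `|v| ^+ 2.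
  by rewrite /C; ring.
rewrite exprMn ler_wpM2r ?sqr_ge0//.
have : 1 <= C by rewrite /C lerDr !mulr_ge0// addr_ge0.
exact: subr1_le_sqr.
Unshelve. all: by end_near. Qed.

End Norms.

Section Products.
Context (R : realType).
Implicit Types V W : normedModType R.

Lemma derive_slice V W (Z : normedModType R) (F : V * W -> Z) u v b :
  'D_b (fun v => F (u, v)) v = 'D_(0, b) F (u, v).
Proof.
rewrite /derive.
suff -> : (fun h : R => h^-1 *:
    (((fun v => F (u, v)) \o shift v) (h *: b) - F (u, v))) =
    (fun h : R => h^-1 *: ((F \o shift (u, v)) (h *: ((0 : V), b)) - F (u, v))) by [].
apply/funext => h /=; congr (_ *: (F _ - _)).
by rewrite /shift /= /GRing.add /= /add_pair /= scaler0 add0r.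
Qed.

End Products.

(** * Second-order model of a function along the retraction *)

Section Expansion.
Context (R : realType) (n : nat) (M : riemannianManifold R n).
Context (Rt : M -> 'rV[R]_n -> M) (Rr : retraction Rt) (so : second_order Rt).
Context (c : chart R n M) (ac : atlas c).
Implicit Types (x : M) (u v w xi eta a b : 'rV[R]_n).

Definition retracted_dom u : set 'rV[R]_n :=
  [set xi | Rslice Rt c u (xi *m invmx (tanmx c u))].

Lemma retracted_open u : open (retracted_dom u).
Proof.
rewrite /retracted_dom (_ : mkset _ = (fun xi => xi *m invmx (tanmx c u)) @^-1`
  Rslice Rt c u)//.
apply: open_comp => [v _|]; last exact: Rslice_open.
exact: (Ck_on_continuous (Ck_on_mulmx 0 (invmx (tanmx c u))) (I : setT v)).
Qed.

Lemma retracted_domP u v : codom c u -> Rslice Rt c u v ->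
  retracted_dom u (v *m tanmx c u).
Proof. by move=> cu Uv; rewrite /retracted_dom /= mulmxK//; exact: tanmx_unit. Qed.

Lemma retracted_C2 h u : codom c u -> Ck_fun (W := R^o) 2 setT h ->
  Ck_on 2 (retracted_dom u) (h \o Rt (pt c u)).
Proof.
move=> cu Ch; set O := retracted_dom u; have oO := @retracted_open u.
pose r (xi : 'rV[R]_n) := xi *m invmx (tanmx c u).
have Cr : Ck_on 2 O r by exact: (Ck_on_subset (@subsetT _ O) (Ck_on_mulmx 2 _)).
have rO xi : O xi -> Rslice Rt c u (r xi) by [].
have Cp := Ck_on2_comp oO (@Rslice_open _ _ _ _ Rr c u ac) rO (pullback_C2 Rr u ac Ch) Cr.
have E xi : O xi -> (pullback Rt c u h \o r) xi = (h \o Rt (pt c u)) xi.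
  move=> Oxi; rewrite [LHS](pullbackE h ac Oxi).
  by rewrite mulmxKV//; exact: tanmx_unit.
exact: (Ck_on_eq oO E Cp).
Qed.

Lemma tHessE x (F : 'rV[R]_n -> R) (O : set 'rV[R]_n) xi eta :
  open O -> Ck_on 2 O F -> O xi ->
  tHess x F xi eta = eta *m phess F xi *m invmx (metric x).
Proof.
move=> oO CF Oxi; have d := is_derive_mulmx (is_derive_pgrad eta oO CF Oxi)
  (is_derive_cst (invmx (metric x)) xi eta).
rewrite mulmx0 addr0 in d; exact: derive_is d.
Qed.

Lemma phess_pullback h u v a b : codom c u -> Rslice Rt c u v ->
  Ck_fun (W := R^o) 2 setT h ->
  dot (a *m phess (pullback Rt c u h) v) b =
  dot (a *m tanmx c u *m phess (h \o Rt (pt c u)) (v *m tanmx c u)) (b *m tanmx c u).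
Proof.
move=> cu Uv Ch.
have E1 := derive2_phess a b (@Rslice_open _ _ _ _ Rr c u ac) (pullback_C2 Rr u ac Ch) Uv.
have E2 := derive2_phess (a *m tanmx c u) (b *m tanmx c u) (@retracted_open u)
  (retracted_C2 cu Ch) (retracted_domP cu Uv).
exact: etrans (esym E1) (etrans (derive2_pullback Rr h a b ac Uv) E2).
Qed.

(** Assumption (A6) restated in the fixed chart, as a bound on bilinear forms. Each factor [k2]
    converts one of [v], [a], [b] from Riemannian to coordinate norm. *)
Lemma phess_pullback_lipschitz h us : codom c us -> Ck_fun (W := R^o) 2 setT h ->
  pullback_Hess_lipschitz Rt (pt c us) h ->
  exists C r : R, [/\ 0 < C, 0 < r & forall u v, `|u - us| < r -> `|v| < r ->
    [/\ codom c u, Rdom Rt c (u, v) & forall a b,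
     `|dot (a *m (phess (pullback Rt c u h) v - phess (pullback Rt c u h) 0)) b|
       <= C * `|v| * (`|a| * `|b|)]].
Proof.
move=> cs Ch [L L0 [r r0 Lr]].
have [[k1 k2] /= [k10 k20 kP]] := norm_equiv ac cs.
have [r1 r10 r1P] := near_norm kP.
have cpt : {for us, continuous (pt c)}.
  by case: (atlas_chart ac) => _ _ _ _; apply.
have [r2 r20 r2P] : exists2 r2 : R, 0 < r2 & forall u, `|u - us| < r2 ->
    forall xi, norm (pt c u) xi < r -> opnorm (pt c u) (fun v =>
       tHess (pt c u) (h \o Rt (pt c u)) xi v - tHess (pt c u) (h \o Rt (pt c u)) 0 v)
      <= L * norm (pt c u) xi.
  by have [r2 r20 r2P] := near_norm (cpt _ Lr); exists r2.
have [r3 r30 r3P] := near_prod_norm (open_nbhs_nbhs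
  (conj (@Rdom_open _ _ _ _ Rr c ac) (Rdom0 Rr ac cs))).
pose rr := Num.min (Num.min r1 r2) (Num.min r3 (r / k2)).
exists (L * k2 * k2 * k2), rr; split; first by rewrite !mulr_gt0.
  by rewrite !lt_min r10 r20 r30 divr_gt0.
move=> u v; rewrite /rr !lt_min => /andP[/andP[u1 u2] /andP[u3 _]].
move=> /andP[/andP[_ _] /andP[v3 vr]].
have [cu nu] := r1P _ u1.
have Uv : Rdom Rt c (u, v) by apply: r3P => //; rewrite subr0.
split => // a b.
have U0 : Rslice Rt c u 0 by exact: Rdom0.
set x := pt c u; set A := tanmx c u; set F := h \o Rt x.
have nle w : norm x (w *m A) <= k2 * `|w| by have /andP[] := nu w.
have vAr : norm x (v *m A) < r.
  by apply: le_lt_trans (nle v) _; rewrite mulrC -ltr_pdivlMr.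
have := r2P _ u2 _ vAr; rewrite -/x -/F.
have C2 := retracted_C2 cu Ch.
have oO := @retracted_open u.
have Ov := retracted_domP cu Uv; have O0 := retracted_domP cu U0.
rewrite mul0mx in O0.
(* [tHess] carries the inverse metric; pairing with [inner x] cancels it and leaves the difference
   of second derivatives. *)
pose K := (phess F (v *m A) - phess F 0) *m invmx (metric x).
have -> : (fun w => tHess x F (v *m A) w - tHess x F 0 w) = (fun w => w *m K).
  apply/funext => w; rewrite (tHessE x w oO C2 Ov) (tHessE x w oO C2 O0).
  by rewrite /K mulmxA mulmxBr mulmxBl.
move=> oK.
have -> : dot (a *m (phess (pullback Rt c u h) v - phess (pullback Rt c u h) 0)) b =
    inner x (a *m A *m K) (b *m A).
  have Ev := phess_pullback a b cu Uv Ch; have E0 := phess_pullback a b cu U0 Ch.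
  rewrite (mulmxBr a) dotBl; apply: etrans (congr2 (fun p q => p - q) Ev E0) _.
  rewrite innerE /K !mulmxA mulmxKV; last exact/posdef_unitmx/metric_posdef.
  by rewrite (mul0mx _ A) (mulmxBr (a *m A)) dotBl.
apply: le_trans (inner_norm_le _ _ _) _.
have H1 : norm x (a *m A *m K) <= (L * (k2 * `|v|)) * (k2 * `|a|).
  apply: le_trans (opnorm_bound _ _ _) _.
  apply: (@le_trans _ _ (L * norm x (v *m A) * norm x (a *m A))).
    by rewrite ler_wpM2r ?norm_ge0.
  apply: ler_pM; rewrite ?mulr_ge0 ?norm_ge0 ?(ltW L0)//.
  by rewrite ler_wpM2l ?(ltW L0).
have -> : L * k2 * k2 * k2 * `|v| * (`|a| * `|b|) =
   (L * (k2 * `|v|)) * (k2 * `|a|) * (k2 * `|b|) by ring.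
by apply: ler_pM; rewrite ?norm_ge0.
Qed.

Definition Rjac (p : 'rV[R]_n * 'rV[R]_n) : 'M[R]_n :=
  \matrix_i 'D_(0, delta_mx 0 i) (Rchart Rt c) p.

Lemma derive_Rslice u v b : Rdom Rt c (u, v) ->
  'D_b (fun v => Rchart Rt c (u, v)) v = b *m Rjac (u, v).
Proof.
move=> Uv.
rewrite (derive_jac (@Rslice_open _ _ _ _ Rr c u ac) (Rslice_smooth Rr u 1 ac) b Uv).
have -> : jac (fun v => Rchart Rt c (u, v)) v = Rjac (u, v).
  apply/matrixP => i j; rewrite [LHS]mxE [RHS]mxE.
  by rewrite (derive_slice (Rchart Rt c) u v (delta_mx 0 i)).
by [].
Qed.

Lemma Rjac_continuous p : Rdom Rt c p -> {for p, continuous Rjac}.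
Proof.
move=> Up; apply/continuous_mxP => i j.
have C := Ck_on_continuous (Ck_on_derive (0, delta_mx 0 i) (Rchart_smooth Rr 1 ac)) Up.
rewrite (_ : (fun s => _) = (fun s => ('D_(0, delta_mx 0 i) (Rchart Rt c) s) 0 j)).
  by move/continuous_mxP : C; apply.
by apply/funext => w; rewrite mxE.
Qed.

Lemma Rjac0 u : codom c u -> Rjac (u, 0) = 1%:M.
Proof.
move=> cu; apply/row_matrixP => i; rewrite rowE [RHS]rowE mulmx1.
by rewrite -derive_Rslice ?derive_Rchart0//; exact: Rdom0.
Qed.

Definition Racc u (i j : 'I_n) : 'rV[R]_n :=
  'D_(0, delta_mx 0 i) (fun p => 'D_(0, delta_mx 0 j) (Rchart Rt c) p) (u, 0).

(* The second term is the Christoffel correction, read off the second-order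
   retraction. *)
Definition chess (h : M -> R) u : 'M[R]_n :=
  phess (h \o pt c) u + \matrix_(i, j) dot (Racc u i j) (pgrad (h \o pt c) u).

Lemma chessE h u i j : chess h u i j =
  phess (h \o pt c) u i j + dot (Racc u i j) (pgrad (h \o pt c) u).
Proof. by rewrite /chess [LHS]mxE [X in _ + X]mxE. Qed.

Lemma dot_mulmx_delta (A : 'M[R]_n) i j :
  dot (delta_mx 0 i *m A) (delta_mx 0 j) = A i j.
Proof. by rewrite dot_delta -rowE mxE. Qed.

(** The value of [chess] is given by derivatives of [h] and of [Rchart] in the fixed chart; this is
    what makes the Hessian visibly continuous in the base point. *)
Lemma phess_pullback0 h u : codom c u -> Ck_fun (W := R^o) 2 setT h ->
  phess (pullback Rt c u h) 0 = chess h u.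
Proof.
move=> cu Ch; apply/matrixP => i j.
have oU := @Rslice_open _ _ _ _ Rr c u ac.
have U0 : Rslice Rt c u 0 by exact: Rdom0.
have oc : open (codom c) by case: (atlas_chart ac).
have RC v : Rslice Rt c u v -> codom c (Rchart Rt c (u, v)) by exact: Rchart_codom.
have d := is_derive2_comp oU oc RC (delta_mx 0 i) (delta_mx 0 j) (Ck_fun_pt ac Ch)
  (Rslice_smooth Rr u 2 ac) U0.
rewrite -[LHS]dot_mulmx_delta.
rewrite -(derive2_phess (delta_mx 0 i) (delta_mx 0 j) oU (pullback_C2 Rr u ac Ch) U0).
rewrite (derive_is d) !(derive_Rchart0 Rr _ ac cu) (Rchart0 Rr ac cu).
have -> : 'D_(delta_mx 0 i) (fun v => 'D_(delta_mx 0 j) (fun v => Rchart Rt c (u, v)) v) 0 =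
   Racc u i j.
  have E : (fun v => 'D_(delta_mx 0 j) (fun v => Rchart Rt c (u, v)) v) =
    (fun v => 'D_(0, delta_mx 0 j) (Rchart Rt c) (u, v)).
    apply/funext => v; exact: (derive_slice (Rchart Rt c) u v (delta_mx 0 j)).
  exact: (etrans (congr1 (fun F => 'D_(delta_mx 0 i) F 0) E)
    (derive_slice (fun p => 'D_(0, delta_mx 0 j) (Rchart Rt c) p) u 0 (delta_mx 0 i))).
by rewrite dot_mulmx_delta chessE.
Qed.

Lemma Hess_chart h u a b : codom c u -> Ck_fun (W := R^o) 2 setT h ->
  inner (pt c u) (Hess h (pt c u) (a *m tanmx c u)) (b *m tanmx c u) =
  dot (a *m chess h u) b.
Proof. by move=> cu Ch; rewrite (Hess_inner_chart Rr a b so Ch ac cu) phess_pullback0. Qed.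

Lemma chess_sym h u : codom c u -> Ck_fun (W := R^o) 2 setT h ->
  (chess h u)^T = chess h u.
Proof.
move=> cu Ch; rewrite -phess_pullback0//.
apply: (phess_sym (@Rslice_open _ _ _ _ Rr c u ac) (pullback_C2 Rr u ac Ch)).
exact: Rdom0.
Qed.

Lemma chess_continuous h u : codom c u -> Ck_fun (W := R^o) 2 setT h ->
  {for u, continuous (chess h)}.
Proof.
move=> cu Ch; have Cc := Ck_fun_pt ac Ch.
have U0 : Rdom Rt c (u, 0) by exact: Rdom0.
apply: (@continuousD _ 'M[R]_n 'rV[R]_n); first exact: (phess_continuous Cc cu).
apply/continuous_mxP => i j.
rewrite (_ : (fun s => _) = (fun s => dot (Racc s i j) (pgrad (h \o pt c) s))); last first.
  by apply/funext => w; rewrite mxE.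
apply: continuous_dot; last exact: (pgrad_continuous Cc cu).
have C := Ck_on_continuous (Ck_on_derive (0, delta_mx 0 i)
  (Ck_on_derive (0, delta_mx 0 j) (Rchart_smooth Rr 2 ac))) U0.
have cp : {for u, continuous (fun u : 'rV[R]_n => (u, 0 : 'rV[R]_n))}.
  exact: (@cvg_pair _ _ _ (nbhs u) (nbhs u) (nbhs (0 : 'rV[R]_n)) _ _ _ id (fun=> 0) (@cvg_id _ _) (cvg_cst _)).
exact: (continuous_comp cp C).
Qed.

End Expansion.

Section Combination.
Context (R : realType) (m : nat) (V : normedModType R).
Implicit Types (F : V -> R) (G : 'I_m -> V -> R) (y : 'I_m -> R).

Lemma is_derive_comb F G y u v : derivable F u v -> (forall i, derivable (G i) u v) ->
  is_derive u v (fun w => F w - \sum_i y i * G i w)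
    ('D_v F u - \sum_i y i * 'D_v (G i) u).
Proof.
move=> dF dG; apply: is_deriveB; first exact: derivableP.
apply: cvg_sum_derive => i.
exact: (is_deriveZ (y i) (derivableP (dG i))).
Qed.

Lemma Ck_on_comb k (U : set V) F G y : open U -> Ck_on k U F ->
  (forall i, Ck_on k U (G i)) -> Ck_on k U (fun w => F w - \sum_i y i * G i w).
Proof.
move=> oU; have cont q F' G' u : Ck_on q U F' -> (forall i, Ck_on q U (G' i)) -> U u ->
    {for u, continuous (fun w => F' w - \sum_(i < m) y i * G' i w)}.
  move=> CF CG Uu; apply: (@continuousB _ R^o V).
    exact: (Ck_on_continuous CF Uu).
  apply: (@cvg_sumr _ _ (nbhs u) (nbhs_filter u)) => i.
  apply: (@continuousM R V (fun=> y i) (G' i)); first exact: cst_continuous.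
  exact: (Ck_on_continuous (CG i) Uu).
elim: k F G => [|k IH] F G CF CG; split => //; try by move=> u; exact: cont CF CG.
move=> v; have d u (Uu : U u) := is_derive_comb y (Ck_on_derivable CF Uu : derivable _ _ v)
  (fun i => Ck_on_derivable (CG i) Uu : derivable _ _ v).
split=> [u Uu|]; first by have [] := d u Uu.
apply: (Ck_on_eq oU _ (IH _ _ (Ck_on_derive v CF) (fun i => Ck_on_derive v (CG i)))).
by move=> u Uu; rewrite (derive_is (d u Uu)).
Qed.

End Combination.

Section PgradCombination.
Context (R : realType) (m n : nat) (U : set 'rV[R]_n) (oU : open U).
Context (F : 'rV[R]_n -> R) (G : 'I_m -> 'rV[R]_n -> R) (y : 'I_m -> R).

Lemma pgrad_comb u : Ck_on 1 U F -> (forall i, Ck_on 1 U (G i)) -> U u ->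
  pgrad (fun w => F w - \sum_i y i * G i w) u = pgrad F u - \sum_i y i *: pgrad (G i) u.
Proof.
move=> CF CG Uu; apply/rowP => j; rewrite !mxE summxE.
rewrite (derive_is (is_derive_comb y (Ck_on_derivable CF Uu)
  (fun i => Ck_on_derivable (CG i) Uu))); congr (_ - _).
by apply: eq_bigr => i _; rewrite !mxE.
Qed.

Lemma phess_comb u : Ck_on 2 U F -> (forall i, Ck_on 2 U (G i)) -> U u ->
  phess (fun w => F w - \sum_i y i * G i w) u = phess F u - \sum_i y i *: phess (G i) u.
Proof.
move=> CF CG Uu; apply/matrixP => a b; rewrite !mxE summxE.
have E w : U w -> 'D_(delta_mx 0 b) F w - \sum_i y i * 'D_(delta_mx 0 b) (G i) w =
    'D_(delta_mx 0 b) (fun w => F w - \sum_i y i * G i w) w.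
  move=> Uw; apply: esym; apply: (derive_is (is_derive_comb y
    (Ck_on_derivable CF Uw) (fun i => Ck_on_derivable (CG i) Uw))).
have d := is_derive_comb y (Ck_on_derivable (Ck_on_derive (delta_mx 0 b) CF) Uu
    : derivable _ _ (delta_mx 0 a))
  (fun i => Ck_on_derivable (Ck_on_derive (delta_mx 0 b) (CG i)) Uu
    : derivable _ _ (delta_mx 0 a)).
rewrite (derive_is (is_derive_eq_near oU Uu E d)); congr (_ - _).
by apply: eq_bigr => i _; rewrite !mxE.
Qed.

End PgradCombination.

Section LocalModel.
Context (R : realType) (n : nat) (M : riemannianManifold R n).
Context (Rt : M -> 'rV[R]_n -> M) (Rr : retraction Rt) (so : second_order Rt).
Context (c : chart R n M) (ac : atlas c) (us : 'rV[R]_n) (cs : codom c us).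
Implicit Types (x : M) (u v w xi eta a b : 'rV[R]_n).

(** The derivative of the pullback at [v] in direction [b] is the differential of [h] at the
    retracted point applied to [b *m Rjac]. Comparing pulled-back differentials rather than
    differentials at two points is what lets (A6) give a quadratic remainder. *)
Lemma grad_expansion h : Ck_fun (W := R^o) 2 setT h ->
  pullback_Hess_lipschitz Rt (pt c us) h ->
  exists C r : R, [/\ 0 < C, 0 < r & forall u v, `|u - us| < r -> `|v| < r ->
    [/\ codom c u, Rdom Rt c (u, v) & forall b,
     `|dot (b *m Rjac Rt c (u, v)) (pgrad (h \o pt c) (Rchart Rt c (u, v)))
       - dot b (pgrad (h \o pt c) u) - dot (v *m chess Rt c h u) b|
       <= C * `|v| ^+ 2 * `|b|]].
Proof.
move=> Ch A6; have [C [r [C0 r0 CP]]] := phess_pullback_lipschitz Rr ac cs Ch A6.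
exists C, r; split => // u v ur vr; have [cu Uv _] := CP u v ur vr.
split => // b; set Q := chess Rt c h u; set Phi := pullback Rt c u h.
have oU := @Rslice_open _ _ _ _ Rr c u ac.
have CPhi := pullback_C2 Rr u ac Ch.
have oc : open (codom c) by case: (atlas_chart ac).
have RC w : Rslice Rt c u w -> codom c (Rchart Rt c (u, w)) by exact: Rchart_codom.
have DPhi w : Rslice Rt c u w -> 'D_b Phi w =
    dot (b *m Rjac Rt c (u, w)) (pgrad (h \o pt c) (Rchart Rt c (u, w))).
  move=> Uw; have d := is_derive_comp_dot oc RC b (Ck_fun_pt ac Ch)
    (Rslice_smooth Rr u 1 ac) Uw.
  rewrite -(derive_Rslice Rr ac b Uw).
  exact: derive_is d.
have segU t : 0 <= t <= 1 -> Rslice Rt c u (0 + t *: v).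
  move=> tI; rewrite add0r; have [] := CP u (t *: v) ur _ => //.
  exact: le_lt_trans (normZ_le _ tI) vr.
(* The derivative of [G] along [v] is the change of the Hessian of the pullback, of size [|v|] by
   (A6); a further factor [|v|] comes from the direction. *)
pose G w := 'D_b Phi w - dot (w *m Q) b.
have dG w : Rslice Rt c u w -> is_derive w v G (dot (v *m phess Phi w) b - dot (v *m Q) b).
  move=> Uw; apply: is_deriveB.
    rewrite -(derive2_phess v b oU CPhi Uw); apply: derivableP.
    exact: (Ck_on_derivable (Ck_on_derive b CPhi) Uw).
  have := is_derive_dot (is_derive_mulmx (is_derive_id w v) (is_derive_cst Q w v))
    (is_derive_cst b w v).
  by rewrite mulmx0 addr0 [X in _ + X]/dot trmx0 mulmx0 mxE addr0.
have [t tI] := @MVT_line _ _ G 0 v (fun t tI => derivable_is (dG _ (segU t tI))).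
rewrite (derive_is (dG _ (segU t tI))) {1 2}/G.
have U0 : Rslice Rt c u 0 by exact: Rdom0.
rewrite add0r (DPhi v Uv) (DPhi 0 U0) (Rjac0 Rr ac cu) mulmx1 (Rchart0 Rr ac cu).
rewrite mul0mx [X in _ - (_ - X)]/dot mul0mx mxE subr0 => E.
have -> : dot (b *m Rjac Rt c (u, v)) (pgrad (h \o pt c) (Rchart Rt c (u, v)))
       - dot b (pgrad (h \o pt c) u) - dot (v *m Q) b =
       dot (v *m (phess Phi (0 + t *: v) - phess Phi 0)) b.
  rewrite addrAC E (phess_pullback0 Rr ac cu Ch) -/Q mulmxBr dotBl//.
rewrite add0r; have [_ _ /(_ v b) H] := CP u (t *: v) ur (le_lt_trans (normZ_le _ tI) vr).
apply: le_trans H _; rewrite expr2 !mulrA ler_wpM2r// ler_wpM2r// ler_wpM2l ?(ltW C0)//.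
exact: normZ_le.
Qed.

(** The mean value theorem reduces the remainder to the differential at an intermediate point
    [t *: v], which [grad_expansion] controls with [b = v]. The radius is at most 1 so that cubic
    terms count as quadratic ones. *)
Lemma value_expansion h : Ck_fun (W := R^o) 2 setT h ->
  pullback_Hess_lipschitz Rt (pt c us) h ->
  exists C r : R, [/\ 0 < C, 0 < r & forall u v, `|u - us| < r -> `|v| < r ->
     `|(h \o pt c) (Rchart Rt c (u, v)) - (h \o pt c) u - dot v (pgrad (h \o pt c) u)|
       <= C * `|v| ^+ 2].
Proof.
move=> Ch A6; have [C [r [C0 r0 CP]]] := grad_expansion Ch A6.
have cQ := chess_continuous Rr ac cs Ch.
have [r1 r10 r1P] := near_norm ((cvgrPdist_le _ _).1 cQ _ (@ltr01 R)).
pose K := n%:R * (n%:R * (`|chess Rt c h us| + 1)).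
have K0 : 0 <= K by rewrite !mulr_ge0// addr_ge0.
pose rr := Num.min (Num.min r r1) 1.
exists (C + K + 1), rr; split.
- by apply: ltr_wpDr => //; apply: ltr_wpDr.
- by rewrite !lt_min r0 r10 ltr01.
move=> u v; rewrite !lt_min => /andP[/andP[ur u1] _] /andP[/andP[vr _] v1].
have [cu Uv _] := CP u v ur vr.
set Phi := pullback Rt c u h; set Q := chess Rt c h u; set p := pgrad (h \o pt c) u.
have CPhi := pullback_C2 Rr u ac Ch.
have oU := @Rslice_open _ _ _ _ Rr c u ac.
have oc : open (codom c) by case: (atlas_chart ac).
have RC w : Rslice Rt c u w -> codom c (Rchart Rt c (u, w)) by exact: Rchart_codom.
have segU t : 0 <= t <= 1 -> Rslice Rt c u (0 + t *: v).
  move=> tI; rewrite add0r; have [] := CP u (t *: v) ur _ => //.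
  exact: le_lt_trans (normZ_le _ tI) vr.
pose G w := Phi w - dot w p.
have dG w : Rslice Rt c u w -> is_derive w v G
    (dot (v *m Rjac Rt c (u, w)) (pgrad (h \o pt c) (Rchart Rt c (u, w))) - dot v p).
  move=> Uw; apply: is_deriveB.
    rewrite -(derive_Rslice Rr ac v Uw).
    exact: (is_derive_comp_dot oc RC v (Ck_fun_pt ac Ch) (Rslice_smooth Rr u 1 ac) Uw).
  have := is_derive_dot (is_derive_id w v) (is_derive_cst p w v).
  by rewrite [X in _ + X]/dot trmx0 mulmx0 mxE addr0.
have [t tI] := @MVT_line _ _ G 0 v (fun t tI => derivable_is (dG _ (segU t tI))).
rewrite (derive_is (dG _ (segU t tI))) {1 2}/G.
have P0 : Phi 0 = (h \o pt c) u by rewrite /Phi /pullback /= (Rchart0 Rr ac cu).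
rewrite !add0r P0 [X in _ - (_ - X)]/dot mul0mx mxE subr0 => E.
have -> : (h \o pt c) (Rchart Rt c (u, v)) - (h \o pt c) u - dot v p =
    Phi v - dot v p - (h \o pt c) u by rewrite addrAC.
rewrite E; have [_ _ /(_ v) H] := CP u (t *: v) ur (le_lt_trans (normZ_le _ tI) vr).
have HQ : `|dot (t *: v *m Q) v| <= K * `|v| ^+ 2.
  apply: le_trans (dot_norm_le _ _) _.
  have q1 : `|Q| <= `|chess Rt c h us| + 1.
    exact: norm_le_dist (r1P _ u1).
  apply: (@le_trans _ _ (n%:R * (n%:R * (`|v| * (`|chess Rt c h us| + 1)) * `|v|))).
    rewrite ler_wpM2l// ler_wpM2r//; apply: le_trans (mulmx_norm_le _ _) _.
    rewrite ler_wpM2l//; apply: ler_pM => //; exact: normZ_le.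
  by rewrite /K le_eqVlt; apply/orP; left; apply/eqP; ring.
have H' : C * `|t *: v| ^+ 2 * `|v| <= C * `|v| ^+ 2.
  rewrite -[leRHS]mulr1; apply: ler_pM => //.
  - by rewrite mulr_ge0 ?(ltW C0)// sqr_ge0.
  - by rewrite ler_wpM2l ?(ltW C0)// ler_sqr ?nnegrE// normZ_le.
  - exact: ltW.
set X := dot (v *m _) _ in H *.
have -> : X - dot v p = (X - dot v p - dot (t *: v *m Q) v) + dot (t *: v *m Q) v.
  by rewrite subrK.
apply: le_trans (ler_normD _ _) _.
have -> : (C + K + 1) * `|v| ^+ 2 = C * `|v| ^+ 2 + (K * `|v| ^+ 2 + `|v| ^+ 2) by ring.
apply: lerD; first exact: (le_trans H H').
apply: le_trans HQ _; by rewrite lerDl sqr_ge0.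
Qed.

(** The last bound inverts the pullback: it recovers the differential at the new point from its
    pulled-back version. *)
Lemma Rjac_bounds : exists C r : R, [/\ 0 < C, 0 < r &
  forall u v, `|u - us| < r -> `|v| < r ->
   [/\ codom c u, Rdom Rt c (u, v), `|Rchart Rt c (u, v) - u| <= C * `|v| &
     forall a, `|a| <= C * `|a *m (Rjac Rt c (u, v))^T|]].
Proof.
have U0 := Rdom0 Rr ac cs; have oR := @Rdom_open _ _ _ _ Rr c ac.
have oc : open (codom c) by case: (atlas_chart ac).
have cJ := Rjac_continuous Rr ac U0.
have cJT : (Rjac Rt c p)^T @[p --> (us, 0 : 'rV[R]_n)] --> (1%:M : 'M[R]_n).
  by have := continuous_trmx cJ; rewrite /prop_for /continuous_at (Rjac0 Rr ac cs) trmx1.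
have [C1 C10 C1P] := unitmx_near_bound (nbhs_filter (us, 0 : 'rV[R]_n)) (unitmx1 _ _) cJT.
have [r1 r10 r1P] := near_prod_norm C1P.
have [r2 r20 r2P] := near_prod_norm ((cvgrPdist_le _ _).1 cJ _ (@ltr01 R)).
have [r3 r30 r3P] := near_prod_norm (open_nbhs_nbhs (conj oR U0)).
have [r4 r40 r4P] := near_norm (open_nbhs_nbhs (conj oc cs)).
pose K := n%:R * (`|Rjac Rt c (us, 0)| + 1).
have K0 : 0 <= K by rewrite !mulr_ge0// addr_ge0.
pose rr := Num.min (Num.min r1 r2) (Num.min r3 r4).
exists (C1 + K), rr; split.
- by rewrite ltr_wpDr.
- by rewrite !lt_min r10 r20 r30 r40.
move=> u v; rewrite !lt_min => /andP[/andP[u1 u2] /andP[u3 u4]].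
move=> /andP[/andP[v1 v2] /andP[v3 v4]].
have cu : codom c u by exact: r4P.
have Uv w : `|w| <= `|v| -> Rdom Rt c (u, w).
  by move=> wv; apply: r3P => //; rewrite subr0; exact: le_lt_trans wv v3.
split => //; first exact: Uv.
  apply: mx_norm_le => [|i j]; first by rewrite mulr_ge0// addr_ge0// ltW.
  rewrite ord1; pose G w := Rchart Rt c (u, w) 0 j.
  have dR t (tI : 0 <= t <= 1) : derivable (fun w => Rchart Rt c (u, w)) (0 + t *: v) v.
    apply: (Ck_on_derivable (Rslice_smooth Rr u 1 ac)).
    by rewrite add0r; apply: Uv; exact: normZ_le.
  have dG t : 0 <= t <= 1 -> derivable G (0 + t *: v) v.
    by move=> tI; have /derivable_mxP := dR t tI; apply.
  have [t tI] := MVT_line dG; rewrite add0r /G (Rchart0 Rr ac cu) !mxE => ->.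
  rewrite -(derive_mxE 0 j (dR t tI)) add0r (derive_Rslice Rr ac v (Uv _ (normZ_le _ tI))).
  apply: le_trans (mx_norm_ge _ _ _) _; apply: le_trans (mulmx_norm_le _ _) _.
  have q1 : `|Rjac Rt c (u, t *: v)| <= `|Rjac Rt c (us, 0)| + 1.
    apply: norm_le_dist; apply: r2P => //; rewrite subr0.
    exact: le_lt_trans (normZ_le _ tI) v2.
  apply: (@le_trans _ _ (K * `|v|)); last by rewrite ler_wpM2r// lerDr ltW.
  by rewrite /K mulrAC -mulrA ler_wpM2l// ler_wpM2l.
move=> a; have := r1P u v u1; rewrite subr0 => /(_ v1 a) H.
by apply: le_trans H _; rewrite ler_wpM2r// lerDl.
Qed.

(** It passes between the stopping test, stated with the Riemannian norm of the gradient, and the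
    coordinate norm of the differential. *)
Lemma grad_norm_equiv : exists C r : R, [/\ 0 < C, 0 < r &
  forall u, `|u - us| < r -> forall h, Ck_fun (W := R^o) 2 setT h ->
    norm (pt c u) (grad h (pt c u)) <= C * `|pgrad (h \o pt c) u| /\
    `|pgrad (h \o pt c) u| <= C * norm (pt c u) (grad h (pt c u))].
Proof.
have [[k1 k2] /= [k10 k20 kP]] := norm_equiv ac cs.
have [r r0 rP] := near_norm kP.
have C0 : 0 < n%:R / k1 + k2 by rewrite ltr_wpDl// divr_ge0// ltW.
exists (n%:R / k1 + k2), r; split => // u ur h Ch.
have [cu nu] := rP _ ur.
have Ch1 : Ck_fun (W := R^o) 1 setT h by move=> c' ac'; exact: Ck_on_pred (Ch c' ac').
set N := norm _ _; set p := pgrad _ _.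
have N0 : 0 <= N by exact: norm_ge0.
have uA := tanmx_unit ac cu.
pose a := grad h (pt c u) *m invmx (tanmx c u).
have aA : a *m tanmx c u = grad h (pt c u) by rewrite mulmxKV.
split.
  (* The squared norm of the gradient is the differential applied to the gradient; one factor [N]
     then cancels. *)
  have H : N * N <= n%:R * (N / k1 * `|p|).
    rewrite -expr2 /N norm_sqr -{2}aA inner_grad_chart//.
    apply: le_trans (ler_norm _) _; apply: le_trans (dot_norm_le _ _) _.
    rewrite ler_wpM2l// ler_wpM2r//.
    by have := nu a; rewrite aA => /andP[+ _]; rewrite ler_pdivlMr// mulrC.
  have [->|Nn0] := eqVneq N 0; first by rewrite mulr_ge0// ltW.
  have Np : 0 < N by rewrite lt0r Nn0.
  have : N <= n%:R / k1 * `|p|.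
    rewrite -(ler_pM2l Np); apply: le_trans H _.
    by rewrite le_eqVlt; apply/orP; left; apply/eqP; ring.
  by move=> /le_trans; apply; rewrite ler_wpM2r// lerDl ltW.
apply: mx_norm_le => [|i j]; first by rewrite mulr_ge0// ltW.
rewrite ord1 -dot_delta dotC -inner_grad_chart//.
apply: le_trans (inner_norm_le _ _ _) _; rewrite mulrC ler_wpM2r//.
have /andP[_ H] := nu (delta_mx 0 j); apply: le_trans H _.
have d1 : `|delta_mx 0 j : 'rV[R]_n| <= 1.
  by apply: mx_norm_le => // a' b'; rewrite mxE; case: (_ && _); rewrite ?normr1 ?normr0.
apply: (@le_trans _ _ (k2 * 1)); first by rewrite ler_wpM2l// ltW.
by rewrite mulr1 lerDr divr_ge0// ltW.
Qed.

End LocalModel.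

(** * The primal-dual system in a chart *)

Section RowNorms.
Context (R : realType).

Lemma norm_row_mx_l n m (a : 'rV[R]_n) (b : 'rV[R]_m) : `|a| <= `|row_mx a b|.
Proof.
apply: mx_norm_le => // i j; rewrite -(row_mxEl a b); exact: mx_norm_ge.
Qed.

Lemma norm_row_mx_r n m (a : 'rV[R]_n) (b : 'rV[R]_m) : `|b| <= `|row_mx a b|.
Proof.
apply: mx_norm_le => // i j; rewrite -(row_mxEr a b); exact: mx_norm_ge.
Qed.

Lemma norm_row_mx_le n m (a : 'rV[R]_n) (b : 'rV[R]_m) (e : R) :
  `|a| <= e -> `|b| <= e -> `|row_mx a b| <= e.
Proof.
move=> ae be; apply: mx_norm_le => [|i j]; first exact: le_trans ae.
case: (split_ordP j) => k ->; rewrite ?row_mxEl ?row_mxEr.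
  exact: le_trans (mx_norm_ge _ _ _) ae.
exact: le_trans (mx_norm_ge _ _ _) be.
Qed.

Lemma row_norm_dot_le n (q : 'rV[R]_n) (K : R) : 0 <= K ->
  (forall b, `|dot b q| <= K * `|b|) -> `|q| <= K.
Proof.
move=> K0 H; apply: mx_norm_le => // i j; rewrite ord1 -dot_delta dotC.
apply: le_trans (H _) _; rewrite ler_piMr//.
by apply: mx_norm_le => // a b; rewrite mxE; case: (_ && _); rewrite ?normr1 ?normr0.
Qed.

Lemma dot_mulmx_norm_le n (v b : 'rV[R]_n) (Q : 'M[R]_n) :
  `|dot (v *m Q) b| <= n%:R * n%:R * `|Q| * (`|v| * `|b|).
Proof.
apply: le_trans (dot_norm_le _ _) _.
apply: (@le_trans _ _ (n%:R * (n%:R * (`|v| * `|Q|) * `|b|))).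
  by rewrite ler_wpM2l// ler_wpM2r// mulmx_norm_le.
by rewrite le_eqVlt; apply/orP; left; apply/eqP; ring.
Qed.

Lemma cvg_block_mx T (F : set_system T) (FF : Filter F) p1 p2 q1 q2
    (a : T -> 'M[R]_(p1, q1)) (b : T -> 'M[R]_(p1, q2))
    (c : T -> 'M[R]_(p2, q1)) (d : T -> 'M[R]_(p2, q2))
    (a0 : 'M[R]_(p1, q1)) (b0 : 'M[R]_(p1, q2))
    (c0 : 'M[R]_(p2, q1)) (d0 : 'M[R]_(p2, q2)) :
  a t @[t --> F] --> a0 -> b t @[t --> F] --> b0 ->
  c t @[t --> F] --> c0 -> d t @[t --> F] --> d0 ->
  block_mx (a t) (b t) (c t) (d t) @[t --> F] --> block_mx a0 b0 c0 d0.
Proof.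
move=> /cvg_mxP ca /cvg_mxP cb /cvg_mxP cc /cvg_mxP cd; apply/cvg_mxP => i j.
case: (split_ordP i) => i' ->; case: (split_ordP j) => j' ->.
- by rewrite block_mxEul; under eq_fun do rewrite block_mxEul; exact: ca.
- by rewrite block_mxEur; under eq_fun do rewrite block_mxEur; exact: cb.
- by rewrite block_mxEdl; under eq_fun do rewrite block_mxEdl; exact: cc.
- by rewrite block_mxEdr; under eq_fun do rewrite block_mxEdr; exact: cd.
Qed.

End RowNorms.

Section PrimalDual.
Context (R : realType) (n m : nat).
Context (pf : 'rV[R]_n -> 'rV[R]_n) (pg : 'I_m -> 'rV[R]_n -> 'rV[R]_n).
Context (hg : 'I_m -> 'rV[R]_n -> R).
Context (Qf : 'rV[R]_n -> 'M[R]_n) (Qg : 'I_m -> 'rV[R]_n -> 'M[R]_n).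
Implicit Types (u v : 'rV[R]_n) (y s : 'rV[R]_m) (mu : R).

Definition dual_residual u y : 'rV[R]_n := pf u - \sum_i y 0 i *: pg i u.

Definition kkt_residual u y mu : 'rV[R]_(n + m) :=
  row_mx (dual_residual u y) (\row_i (hg i u * y 0 i - mu)).

Definition lagrangian_hess u y : 'M[R]_n := Qf u - \sum_i y 0 i *: Qg i u.

(** The Newton matrix, acting on row vectors from the right. Its upper left block will be the
    covariant Hessian in the chart, which is the ordinary derivative of the dual residual only where
    that residual vanishes. *)
Definition kkt_jacobian u y : 'M[R]_(n + m) :=
  block_mx (lagrangian_hess u y) (\matrix_(a, i) (y 0 i * pg i u 0 a))
           (\matrix_(i, a) - pg i u 0 a) (diag_mx (\row_i hg i u)).

(** The Schur complement left after eliminating the dual step from the Newton system; for strictly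
    feasible points it represents the operator of the trust-region model. *)
Definition barrier_hessian u y : 'M[R]_n :=
  lagrangian_hess u y + \sum_i (y 0 i / hg i u) *: ((pg i u)^T *m pg i u).

Lemma mul_kkt_jac u y v s : row_mx v s *m kkt_jacobian u y =
  row_mx (v *m lagrangian_hess u y - \sum_i s 0 i *: pg i u)
         (\row_i (y 0 i * dot v (pg i u) + s 0 i * hg i u)).
Proof.
rewrite mul_row_block; congr row_mx; apply/rowP => j; rewrite !mxE.
  congr (_ + _); rewrite summxE -sumrN; apply: eq_bigr => i _.
  by rewrite !mxE mulrN.
rewrite dotE mulr_sumr; congr (_ + _).
  by apply: eq_bigr => a _; rewrite mxE mulrCA.
by rewrite (bigD1 j)//= big1 ?addr0 ?mxE ?eqxx// => i /negbTE ij;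
  rewrite !mxE ij mulr0.
Qed.

Lemma dot_outer v w p : dot (v *m (p^T *m p)) w = dot v p * dot w p.
Proof. by rewrite (dotC w) mulmxA /dot -mulmxA mxE big_ord1. Qed.

Lemma dot_barrier_hess u y v w : dot (v *m barrier_hessian u y) w =
  dot (v *m lagrangian_hess u y) w + \sum_i y 0 i / hg i u * (dot v (pg i u) * dot w (pg i u)).
Proof.
rewrite mulmxDr dotDl; congr (_ + _); rewrite mulmx_sumr dot_suml.
by apply: eq_bigr => i _; rewrite -scalemxAr dotZl dot_outer.
Qed.

End PrimalDual.

Lemma le_half_absorb (R : realType) (a b : R) : a <= b + a / 2 -> a <= 2 * b.
Proof. by move=> h; lra. Qed.

Section LocalAnalysis.
Context (R : realType) (n m : nat).
Context (pf : 'rV[R]_n -> 'rV[R]_n) (pg : 'I_m -> 'rV[R]_n -> 'rV[R]_n).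
Context (hg : 'I_m -> 'rV[R]_n -> R).
Context (Qf : 'rV[R]_n -> 'M[R]_n) (Qg : 'I_m -> 'rV[R]_n -> 'M[R]_n).
Implicit Types (u v : 'rV[R]_n) (y s : 'rV[R]_m) (mu : R).
Context (us : 'rV[R]_n) (ys : 'rV[R]_m).

Local Notation dual_res := (dual_residual pf pg).
Local Notation kkt_res := (kkt_residual pf pg hg).
Local Notation lag_hess := (lagrangian_hess Qf Qg).
Local Notation kkt_jac := (kkt_jacobian pg hg Qf Qg).
Local Notation barrier_hess := (barrier_hessian pg hg Qf Qg).

Context (cpg : forall i, {for us, continuous (pg i)}).
Context (chg : forall i, {for us, continuous (hg i)}).
Context (cQf : {for us, continuous Qf}) (cQg : forall i, {for us, continuous (Qg i)}).
Context (sQf : (Qf us)^T = Qf us) (sQg : forall i, (Qg i us)^T = Qg i us).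
Context (hg_ge0 : forall i, 0 <= hg i us) (ys_ge0 : forall i, 0 <= ys 0 i).
Context (compl : forall i, hg i us * ys 0 i = 0).
Context (strict : forall i, (ys 0 i == 0) (+) (hg i us == 0)).
Context (licq : forall s, (forall i, hg i us != 0 -> s 0 i = 0) ->
  \sum_i s 0 i *: pg i us = 0 -> s = 0).
Context (sosc : forall v, v != 0 ->
  (forall i, hg i us == 0 -> dot v (pg i us) = 0) ->
  0 < dot (v *m lag_hess us ys) v).
Context (stat : dual_res us ys = 0).
Context (dL : forall e : R, 0 < e -> \forall u \near us,
  `|dual_res u ys - (u - us) *m lag_hess us ys| <= e * `|u - us|).
Context (dg : forall i (e : R), 0 < e -> \forall u \near us,
  `|hg i u - hg i us - dot (u - us) (pg i us)| <= e * `|u - us|).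

Lemma active_dual_gt0 i : hg i us = 0 -> 0 < ys 0 i.
Proof.
move=> gi; have := strict i; rewrite gi eqxx addbT => y0.
by rewrite lt0r y0 ys_ge0.
Qed.

Lemma inactive_dual0 i : hg i us != 0 -> ys 0 i = 0.
Proof. by move=> gi; have := strict i; rewrite (negbTE gi) addbF => /eqP. Qed.

(** A kernel vector has [v] tangent to the active constraints and [s] supported on them, by strict
    complementarity. The first block equation then makes the Hessian form vanish at [v], so SOSC
    gives [v = 0], and LICQ gives [s = 0]. *)
Lemma kkt_jac_unit : kkt_jac us ys \in unitmx.
Proof.
apply: inj_unitmx => z; rewrite -[z]hsubmxK; move: (lsubmx z) (rsubmx z) => v s {z}.
rewrite mul_kkt_jac -[X in _ = X -> _]row_mx0 => /eq_row_mx [/subr0_eq E1 /rowP E2].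
have E i : ys 0 i * dot v (pg i us) + s 0 i * hg i us = 0 by have := E2 i; rewrite !mxE.
have act i : hg i us == 0 -> dot v (pg i us) = 0.
  move=> /eqP gi; have := E i; rewrite gi mulr0 addr0 => /eqP.
  by rewrite mulf_eq0 gt_eqF ?active_dual_gt0//= => /eqP.
have inact i : hg i us != 0 -> s 0 i = 0.
  move=> gi; have := E i; rewrite (inactive_dual0 gi) mul0r add0r => /eqP.
  by rewrite mulf_eq0 (negbTE gi) orbF => /eqP.
have v0 : v = 0.
  apply/eqP; apply: contraT => vn0; have := sosc vn0 act.
  rewrite E1 dot_suml big1 ?ltxx// => i _; rewrite dotZl (dotC (pg i us)).
  have [gi|gi] := eqVneq (hg i us) 0; first by rewrite act ?gi// mulr0.
  by rewrite inact// mul0r.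
have s0 : s = 0 by apply: licq => //; rewrite -E1 v0 mul0mx.
by rewrite v0 s0 row_mx0.
Qed.

Lemma cvg_comp1 (W : topologicalType) (F : 'rV[R]_n -> W) :
  {for us, continuous F} -> F p.1 @[p --> (us, ys)] --> F us.
Proof. by move=> cF; exact: (@cvg_comp _ _ _ (fun p : 'rV[R]_n * 'rV[R]_m => p.1) F (nbhs (us, ys)) (nbhs us)
  (nbhs (F us)) (@cvg_fst _ _ (nbhs us) (nbhs ys) _) cF). Qed.

Lemma cvg_dual i : (p.2 : 'rV[R]_m) 0 i @[p --> (us, ys)] --> ys 0 i.
Proof.
exact: (@cvg_comp _ _ _ (fun p : 'rV[R]_n * 'rV[R]_m => p.2) (fun y : 'rV[R]_m => y 0 i)
  (nbhs (us, ys)) (nbhs ys) (nbhs (ys 0 i)) (@cvg_snd _ _ (nbhs us) (nbhs ys) _)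
  (@coord_continuous R 1 m 0 i ys)).
Qed.

Lemma lag_hess_cvg : lag_hess p.1 p.2 @[p --> (us, ys)] --> lag_hess us ys.
Proof.
apply: cvgB; first exact: cvg_comp1.
apply/cvg_mxP => a b; rewrite summxE.
rewrite (_ : (fun p : 'rV_n * 'rV_m => _) =
  (fun p : 'rV_n * 'rV_m => \sum_i p.2 0 i * Qg i p.1 a b)); last first.
  by apply/funext => p; rewrite summxE; apply: eq_bigr => i _; rewrite mxE.
rewrite (eq_bigr (fun i => ys 0 i * Qg i us a b)); last by move=> i _; rewrite mxE.
apply: cvg_sumr => i; apply: cvgM; first exact: cvg_dual.
by have /cvg_mxP := cvg_comp1 (@cQg i); apply.
Qed.

Lemma kkt_jac_cvg : kkt_jac p.1 p.2 @[p --> (us, ys)] --> kkt_jac us ys.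
Proof.
have cpgi i a : pg i p.1 0 a @[p --> (us, ys)] --> pg i us 0 a.
  by have /cvg_mxP := cvg_comp1 (@cpg i); apply.
apply: cvg_block_mx; first exact: lag_hess_cvg.
- apply/cvg_mxP => a i; rewrite mxE; under eq_fun do rewrite mxE.
  by apply: cvgM; [exact: cvg_dual|exact: cpgi].
- apply/cvg_mxP => i a; rewrite mxE; under eq_fun do rewrite mxE.
  by apply: cvgN; exact: cpgi.
- apply/cvg_mxP => i a; rewrite !mxE; under eq_fun do rewrite !mxE.
  case: (i == a) => /=; last by under eq_fun do rewrite mulr0n; rewrite mulr0n; exact: cvg_cst.
  under eq_fun do rewrite mulr1n; rewrite mulr1n.
  exact: (cvg_comp1 (@chg i)).
Qed.

Lemma kkt_jac_bound : exists C r : R, [/\ 0 < C, 0 < r &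
  forall u y, `|u - us| < r -> `|y - ys| < r ->
    forall z : 'rV[R]_(n + m), `|z| <= C * `|z *m kkt_jac u y|].
Proof.
have [C C0 H] := unitmx_near_bound (nbhs_filter (us, ys)) kkt_jac_unit kkt_jac_cvg.
by have [r r0 rP] := near_prod_norm H; exists C, r.
Qed.

(** Strict complementarity survives nearby in this one-sided form. Together with a positive product
    it gives positivity of both factors. *)
Lemma primal_or_dual_gt0 : exists2 r : R, 0 < r &
  forall u y, `|u - us| < r -> `|y - ys| < r -> forall i, 0 < hg i u \/ 0 < y 0 i.
Proof.
have : \forall p \near (us, ys), forall i : 'I_m, 0 < hg i p.1 \/ 0 < (p.2 : 'rV[R]_m) 0 i.
  apply: (@filter_forall _ _ (fun (i : 'I_m) (p : 'rV[R]_n * 'rV[R]_m) =>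
     0 < hg i p.1 \/ 0 < p.2 0 i) _ (nbhs_filter (us, ys))) => i.
  have [gi|gi] := eqVneq (hg i us) 0.
    have K := @cvgr_gt _ _ _ (nbhs_filter (us, ys)) _ (ys 0 i) (@cvg_dual i) _ (active_dual_gt0 gi).
    by apply: (filterS _ K) => p H; right.
  have g0 : 0 < hg i us by rewrite lt0r gi hg_ge0.
  have K := @cvgr_gt _ _ _ (nbhs_filter (us, ys)) _ (hg i us) (cvg_comp1 (@chg i)) _ g0.
  by apply: (filterS _ K) => p H; left.
by move=> /near_prod_norm[r r0 rP]; exists r.
Qed.

(** The penalized matrix [G] from Finsler's lemma is continuous and positive definite at the KKT
    pair. The barrier Hessian dominates it: active weights y_i / g_i exceed [rho] nearby and
    inactive ones are nonnegative. *)
Lemma barrier_hess_posdef : exists2 r : R, 0 < r &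
  forall u y, `|u - us| < r -> `|y - ys| < r ->
   (forall i, 0 < hg i u) -> (forall i, 0 < y 0 i) -> posdef (barrier_hess u y).
Proof.
have [rho rho0 rhoP] := Finsler (A := fun i => hg i us == 0) sosc.
pose P u := \sum_(i | hg i us == 0) (pg i u)^T *m pg i u.
pose G (p : 'rV[R]_n * 'rV[R]_m) := lag_hess p.1 p.2 + rho *: P p.1.
have dotG p v : dot (v *m G p) v = dot (v *m lag_hess p.1 p.2) v +
    rho * \sum_(i | hg i us == 0) dot v (pg i p.1) ^+ 2.
  rewrite mulmxDr dotDl -scalemxAr dotZl mulmx_sumr dot_suml; congr (_ + _ * _).
  by apply: eq_bigr => i _; rewrite dot_outer.
have sG : (G (us, ys))^T = G (us, ys).
  rewrite /G /P /lag_hess linearD linearB linearZ /= sQf; congr (_ - _ + _ *: _).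
    by rewrite linear_sum; apply: eq_bigr => i _; rewrite linearZ /= sQg.
  by rewrite linear_sum; apply: eq_bigr => i _ /=; rewrite trmx_mul trmxK.
have pG : posdef (G (us, ys)) by move=> v v0; rewrite dotG; exact: rhoP.
have cG : G p @[p --> (us, ys)] --> G (us, ys).
  apply: cvgD; first exact: lag_hess_cvg.
  apply: (@cvgZl_tmp _ _ _ _ _ rho (fun p : 'rV[R]_n * 'rV[R]_m => P p.1) (P us)).
  apply/cvg_mxP => a b; rewrite summxE.
  rewrite (_ : (fun p : 'rV_n * 'rV_m => _) =
    (fun p : 'rV_n * 'rV_m => \sum_(i | hg i us == 0) ((pg i p.1)^T *m pg i p.1) a b));
    last by apply/funext => p; rewrite summxE.
  apply: cvg_sumr => i.
  have : (pg i p.1)^T *m pg i p.1 @[p --> (us, ys)] --> (pg i us)^T *m pg i us.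
    apply: cvg_mulmx; last exact: (cvg_comp1 (@cpg i)).
    exact: (cvg_comp1 (continuous_trmx (@cpg i))).
  by move/cvg_mxP; apply.
have [c c0 cP] := posdef_near (nbhs_filter (us, ys)) sG pG cG.
(* The inequality [rho < y_i / g_i] in product form, which stays meaningful and continuous at the
   KKT pair, where g_i = 0 < y_i. *)
have act : \forall p \near (us, ys), forall i : 'I_m, hg i us == 0 ->
    rho * hg i p.1 < (p.2 : 'rV[R]_m) 0 i.
  apply: (@filter_forall _ _ (fun (i : 'I_m) (p : 'rV[R]_n * 'rV[R]_m) =>
     hg i us == 0 -> rho * hg i p.1 < p.2 0 i) _ (nbhs_filter (us, ys))) => i.
  have [gi|gi] := eqVneq (hg i us) 0; last by apply: nearW.
  have cc : (p.2 : 'rV[R]_m) 0 i - rho * hg i p.1 @[p --> (us, ys)] --> ys 0 i - rho * hg i us.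
    apply: cvgB; first exact: cvg_dual.
    apply: cvgM; first exact: cvg_cst.
    exact: (cvg_comp1 (@chg i)).
  have l0 : 0 < ys 0 i - rho * hg i us by rewrite gi mulr0 subr0 active_dual_gt0.
  have K := @cvgr_gt _ _ _ (nbhs_filter (us, ys)) _ _ cc _ l0.
  by apply: (filterS _ K) => p H _; rewrite -subr_gt0.
have [r r0 rP] := near_prod_norm (filterI cP act); exists r => //.
move=> u y ur yr gu yu v v0; have [Gv ac] := rP u y ur yr.
rewrite dot_barrier_hess.
have : 0 < dot (v *m G (u, y)) v.
  apply: lt_le_trans (Gv v); rewrite mulr_gt0// exprn_gt0// normr_gt0//.
rewrite dotG /= => /lt_le_trans; apply; rewrite lerD2l mulr_sumr big_mkcond /=.
apply: ler_sum => i _; rewrite -expr2; case: ifP => gi.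
  rewrite ler_wpM2r ?sqr_ge0// ler_pdivlMr//; exact/ltW/(ac i gi).
by rewrite mulr_ge0 ?sqr_ge0// divr_ge0// ltW.
Qed.

(** The residual at barrier parameter 0 vanishes at the KKT pair with invertible derivative there,
    so it is comparable to the distance; only a first-order expansion at that one point is used. *)
Lemma kkt_error_bound : exists C r : R, [/\ 0 < C, 0 < r &
  forall u y, `|u - us| < r -> `|y - ys| < r ->
    `|row_mx (u - us) (y - ys)| <= C * `|kkt_res u y 0| /\
    `|kkt_res u y 0| <= C * `|row_mx (u - us) (y - ys)|].
Proof.
have [C1 [r1 [C10 r10 C1P]]] := kkt_jac_bound.
have [B [B0 Bp By]] : exists B : R, [/\ 0 <= B, forall i, `|pg i us| <= B &
    forall i, `|ys 0 i| <= B].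
  have sge0 (F : 'I_m -> R) : (forall i, 0 <= F i) -> 0 <= \sum_i F i.
    by move=> F0; exact: sumr_ge0.
  exists (\sum_i `|pg i us| + \sum_i `|ys 0 i|); split=> [|i|i].
  - by rewrite addr_ge0// sge0.
  - by rewrite (bigD1 i)//= -addrA lerDl addr_ge0// ?sge0// sumr_ge0.
  - by rewrite addrC (bigD1 i)//= -addrA lerDl addr_ge0// ?sge0// sumr_ge0.
pose K := 1 + m%:R + (B + 1) + n%:R * B.
have nB : 0 <= n%:R * B by rewrite mulr_ge0.
have B10 : 0 <= B + 1 by rewrite addr_ge0.
have K0 : 0 < K by rewrite /K -!addrA ltr_pwDl// !addr_ge0.
(* [K] collects the multiples of [e] in the linearization error; this choice makes [C1] times that
   error half of [|w|], to be absorbed. *)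
pose e := (2 * C1 * K)^-1.
have e0 : 0 < e by rewrite invr_gt0 !mulr_gt0.
have [r2 r20 r2P] := near_norm (dL e0).
have [r3 r30 r3P] : exists2 r : R, 0 < r & forall u, `|u - us| < r -> forall i,
    `|hg i u - hg i us - dot (u - us) (pg i us)| <= e * `|u - us|.
  apply: (@near_norm _ _ us (fun u => forall i : 'I_m,
    `|hg i u - hg i us - dot (u - us) (pg i us)| <= e * `|u - us|)).
  apply: (@filter_forall _ _ (fun (i : 'I_m) u =>
    `|hg i u - hg i us - dot (u - us) (pg i us)| <= e * `|u - us|)
    _ (nbhs_filter us)) => i; exact: dg.
have [r4 r40 r4P] : exists2 r : R, 0 < r & forall u, `|u - us| < r -> forall i,
    `|pg i us - pg i u| <= e.
  apply: (@near_norm _ _ us (fun u => forall i : 'I_m, `|pg i us - pg i u| <= e)).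
  apply: (@filter_forall _ _ (fun (i : 'I_m) u => `|pg i us - pg i u| <= e)
    _ (nbhs_filter us)) => i.
  exact: ((cvgrPdist_le _ _).1 (@cpg i) _ e0).
pose rr := Num.min (Num.min (Num.min r1 r2) (Num.min r3 r4)) (Num.min e 1).
pose J0 := kkt_jac us ys.
pose N := (n + m)%:R * `|J0| + e * K.
have N0 : 0 <= N by rewrite addr_ge0 ?mulr_ge0 ?(ltW e0) ?(ltW K0).
exists (2 * C1 + N), rr; split.
- by rewrite ltr_wpDr// mulr_gt0.
- by rewrite !lt_min r10 r20 r30 r40 e0 ltr01.
move=> u y; rewrite !lt_min => /andP[/andP[/andP[u1 u2] /andP[u3 u4]] /andP[ue _]].
move=> /andP[/andP[/andP[y1 _] _] /andP[ye y1']].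
set w := row_mx (u - us) (y - ys).
have uw : `|u - us| <= `|w| by exact: norm_row_mx_l.
have yw : `|y - ys| <= `|w| by exact: norm_row_mx_r.
have wi i : `|(y - ys) 0 i| <= `|w| by exact: le_trans (mx_norm_ge _ _ _) yw.
have w0 : 0 <= `|w| by [].
have main : `|kkt_res u y 0 - w *m J0| <= e * K * `|w|.
  rewrite /J0 /w mul_kkt_jac /kkt_res opp_row_mx add_row_mx.
  apply: norm_row_mx_le.
    have -> : dual_res u y - ((u - us) *m lag_hess us ys - \sum_i (y - ys) 0 i *: pg i us) =
       (dual_res u ys - (u - us) *m lag_hess us ys) +
       \sum_i (y - ys) 0 i *: (pg i us - pg i u).
      have -> : \sum_i (y - ys) 0 i *: (pg i us - pg i u) =
          \sum_i (y - ys) 0 i *: pg i us -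
          (\sum_i y 0 i *: pg i u - \sum_i ys 0 i *: pg i u).
        rewrite -!sumrB; apply: eq_bigr => i _.
        by rewrite scalerBr; congr (_ - _); rewrite !mxE scalerBl.
      rewrite /dual_residual; move: (\sum_i y 0 i *: _) (\sum_i ys 0 i *: _)
        (\sum_i (y - ys) 0 i *: _) (_ *m _) (pf u) => S1 S2 X L a.
      by apply/rowP => j; rewrite !mxE; ring.
    apply: le_trans (ler_normD _ _) _.
    apply: (@le_trans _ _ (e * `|w| + m%:R * (`|w| * e))).
      apply: lerD; first by apply: le_trans (r2P _ u2) _; rewrite ler_wpM2l ?(ltW e0).
      apply: le_trans (ler_norm_sum _ _ _) _.
      have H i : true -> `|(y - ys) 0 i *: (pg i us - pg i u)| <= `|w| * e.
        by move=> _; rewrite normrZ; apply: ler_pM => //; exact: r4P.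
      by apply: le_trans (ler_sum _ H) _; rewrite sumr_const card_ord mulr_natl.
    have -> : e * `|w| + m%:R * (`|w| * e) = e * (1 + m%:R) * `|w| by ring.
    rewrite ler_wpM2r// ler_wpM2l ?(ltW e0)// /K -addrA lerDl.
    by rewrite !addr_ge0// mulr_ge0.
  apply: mx_norm_le => [|a i]; first by rewrite !mulr_ge0 ?(ltW e0) ?(ltW K0).
  rewrite ord1 !mxE subr0.
  have -> : hg i u * y 0 i - (ys 0 i * dot (u - us) (pg i us) + (y 0 i - ys 0 i) * hg i us) =
    (hg i u - hg i us - dot (u - us) (pg i us)) * y 0 i +
    (y - ys) 0 i * dot (u - us) (pg i us) + hg i us * ys 0 i.
    by rewrite !mxE; ring.
  rewrite compl addr0; apply: le_trans (ler_normD _ _) _; rewrite !normrM.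
  apply: (@le_trans _ _ (e * `|w| * (B + 1) + `|w| * (n%:R * (e * B)))).
    apply: lerD.
      apply: ler_pM => //; first by apply: le_trans (r3P _ u3 i) _; rewrite ler_wpM2l ?(ltW e0).
      have -> : y 0 i = ys 0 i + (y - ys) 0 i by rewrite !mxE; ring.
      apply: le_trans (ler_normD _ _) (lerD (By i) _).
      by apply: le_trans (mx_norm_ge _ _ _) _; exact: ltW.
    apply: ler_pM => //; apply: le_trans (dot_norm_le _ _) _.
    rewrite ler_wpM2l//; apply: ler_pM => //; exact: ltW.
  have -> : e * `|w| * (B + 1) + `|w| * (n%:R * (e * B)) = e * ((B + 1) + n%:R * B) * `|w| by ring.
  rewrite ler_wpM2r// ler_wpM2l ?(ltW e0)//.
  have -> : K = 1 + m%:R + (B + 1 + n%:R * B) by rewrite /K !addrA.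
  by rewrite lerDr addr_ge0.
have rs : 0 <= `|kkt_res u y 0| by [].
split.
  have H1 : `|w| <= C1 * `|w *m J0|.
    by apply: C1P; rewrite subrr normr0.
  have H2 : `|w *m J0| <= `|kkt_res u y 0| + e * K * `|w|.
    have -> : w *m J0 = kkt_res u y 0 - (kkt_res u y 0 - w *m J0) by rewrite subKr.
    by apply: le_trans (ler_normB _ _) _; rewrite lerD2l.
  have H3 : C1 * (e * K * `|w|) = `|w| / 2.
    by rewrite /e; field; rewrite !gt_eqF.
  have := ler_wpM2l (ltW C10) H2; rewrite mulrDr H3 => H4.
  have H5 : `|w| <= 2 * C1 * `|kkt_res u y 0|.
    by rewrite -mulrA; apply: le_half_absorb; exact: le_trans H1 H4.
  by apply: le_trans H5 _; rewrite ler_wpM2r// lerDl.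
have -> : kkt_res u y 0 = (kkt_res u y 0 - w *m J0) + w *m J0 by rewrite subrK.
apply: le_trans (ler_normD _ _) _.
have H := mulmx_norm_le w J0.
apply: (@le_trans _ _ (N * `|w|)).
  rewrite /N mulrDl addrC; apply: lerD => //.
  by apply: le_trans H _; rewrite [X in _ * X]mulrC mulrA.
by rewrite ler_wpM2r// lerDr mulr_ge0 ?(ltW C10).
Qed.

End LocalAnalysis.

(** * The Newton step and the trust-region subproblem *)

Section NewtonStep.
Context (R : realType) (n m : nat).
Context (pf : 'rV[R]_n -> 'rV[R]_n) (pg : 'I_m -> 'rV[R]_n -> 'rV[R]_n).
Context (hg : 'I_m -> 'rV[R]_n -> R).
Context (Qf : 'rV[R]_n -> 'M[R]_n) (Qg : 'I_m -> 'rV[R]_n -> 'M[R]_n).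
Context (Rc : 'rV[R]_n -> 'rV[R]_n -> 'rV[R]_n) (DR : 'rV[R]_n -> 'rV[R]_n -> 'M[R]_n).
Implicit Types (u v b : 'rV[R]_n) (y s : 'rV[R]_m) (mu : R).

Local Notation dual_res := (dual_residual pf pg).
Local Notation kkt_res := (kkt_residual pf pg hg).
Local Notation lag_hess := (lagrangian_hess Qf Qg).
Local Notation kkt_jac := (kkt_jacobian pg hg Qf Qg).

Definition newton_const (K Y : R) : R :=
  K * (m%:R * (n%:R * n%:R * K) + K + m%:R * (Y * K)) + (n%:R * K + K * Y).

(** The Newton equation cancels the zeroth- and first-order terms of the new residual. What survives
    is quadratic: Taylor remainders weighted by the new multipliers, and the cross terms between [s]
    and [v]. *)
Lemma newton_residual (K Y zeta : R) u y v s mu :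
  0 < K -> 0 <= Y -> 0 <= zeta -> `|v| <= zeta -> `|s| <= zeta -> `|y + s| <= Y ->
  (forall b, `|dot (b *m DR u v) (pf (Rc u v)) - dot b (pf u) - dot (v *m Qf u) b|
     <= K * `|v| ^+ 2 * `|b|) ->
  (forall i b, `|dot (b *m DR u v) (pg i (Rc u v)) - dot b (pg i u) - dot (v *m Qg i u) b|
     <= K * `|v| ^+ 2 * `|b|) ->
  (forall i, `|hg i (Rc u v) - hg i u - dot v (pg i u)| <= K * `|v| ^+ 2) ->
  (forall a : 'rV[R]_n, `|a| <= K * `|a *m (DR u v)^T|) ->
  (forall i, `|Qg i u| <= K) -> (forall i, `|pg i u| <= K) ->
  row_mx v s *m kkt_jac u y = - kkt_res u y mu ->
  `|kkt_res (Rc u v) (y + s) mu| <= newton_const K Y * zeta ^+ 2.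
Proof.
move=> K0 Y0 z0 vz sz yY Ef Eg V DRb Qb pb.
rewrite mul_kkt_jac /kkt_res opp_row_mx => /eq_row_mx[N1 /rowP N2].
have siz i : `|s 0 i| <= zeta by exact: le_trans (mx_norm_ge _ _ _) sz.
have yiY i : `|(y + s) 0 i| <= Y by exact: le_trans (mx_norm_ge _ _ _) yY.
have v2 : `|v| ^+ 2 <= zeta ^+ 2 by rewrite ler_sqr ?nnegrE.
have z20 : 0 <= zeta ^+ 2 by exact: sqr_ge0.
have nn0 : (0 : R) <= n%:R by [].
have mm0 : (0 : R) <= m%:R by [].
have Kge := ltW K0.
have Kv : K * `|v| ^+ 2 <= K * zeta ^+ 2 by rewrite ler_wpM2l.
have c1 : 0 <= m%:R * (n%:R * n%:R * K) + K + m%:R * (Y * K).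
  by rewrite !addr_ge0// !mulr_ge0.
have c2 : 0 <= n%:R * K + K * Y by rewrite !addr_ge0// mulr_ge0.
apply: norm_row_mx_le.
  (* The new dual residual is pulled back to the old tangent space, where it can be compared with
     the Newton equation; the bound on [DR] removes the pullback at the end. *)
  pose q := dual_res (Rc u v) (y + s) *m (DR u v)^T.
  have qE b : dot b q = dot (b *m DR u v) (pf (Rc u v)) -
      \sum_i (y + s) 0 i * dot (b *m DR u v) (pg i (Rc u v)).
    rewrite dotC /q dot_mulmxl trmxK dotC /dual_residual dotBr; congr (_ - _).
    by rewrite dotC dot_suml; apply: eq_bigr => i _; rewrite dotZl dotC.
  have qD b : dot b q =
      (dot (b *m DR u v) (pf (Rc u v)) - dot b (pf u) - dot (v *m Qf u) b)
      - \sum_i s 0 i * dot (v *m Qg i u) b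
      - \sum_i (y + s) 0 i *
         (dot (b *m DR u v) (pg i (Rc u v)) - dot b (pg i u) - dot (v *m Qg i u) b).
    have N1b : dot (v *m Qf u) b - \sum_i y 0 i * dot (v *m Qg i u) b
         - \sum_i s 0 i * dot b (pg i u) + dot b (pf u) - \sum_i y 0 i * dot b (pg i u) = 0.
      have := congr1 (fun w => dot w b) N1.
      rewrite dotNl dotBl /lagrangian_hess mulmxBr dotBl mulmx_sumr !dot_suml.
      rewrite /dual_residual dotBl !dot_suml.
      under eq_bigr do rewrite -scalemxAr dotZl.
      under [X in _ - X = _]eq_bigr do rewrite dotZl dotC.
      under [X in _ = - (_ - X)]eq_bigr do rewrite dotZl dotC.
      rewrite (dotC (pf u)) => ->; ring.
    have E : \sum_i (y + s) 0 i *
         (dot (b *m DR u v) (pg i (Rc u v)) - dot b (pg i u) - dot (v *m Qg i u) b) =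
      \sum_i (y + s) 0 i * dot (b *m DR u v) (pg i (Rc u v)) -
      (\sum_i y 0 i * dot b (pg i u) + \sum_i s 0 i * dot b (pg i u)) -
      (\sum_i y 0 i * dot (v *m Qg i u) b + \sum_i s 0 i * dot (v *m Qg i u) b).
      rewrite -!big_split -!sumrB; apply: eq_bigr => i _ /=; rewrite !mxE; ring.
    rewrite qE E -[RHS]addr0 -[X in _ = _ + X]N1b; ring.
  have qn : `|q| <= (m%:R * (n%:R * n%:R * K) + K + m%:R * (Y * K)) * zeta ^+ 2.
    apply: row_norm_dot_le => [|b]; first exact: mulr_ge0.
    rewrite qD; apply: le_trans (ler_normB _ _) _.
    have -> : (m%:R * (n%:R * n%:R * K) + K + m%:R * (Y * K)) * zeta ^+ 2 * `|b| =
      (K * zeta ^+ 2 * `|b| + m%:R * (zeta * (n%:R * n%:R * K * (zeta * `|b|)))) +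
      m%:R * (Y * (K * zeta ^+ 2 * `|b|)) by ring.
    have sums (F : 'I_m -> R) e : (forall i, `|F i| <= e) -> `|\sum_i F i| <= m%:R * e.
      move=> Fe; apply: le_trans (ler_norm_sum _ _ _) _.
      by apply: le_trans (ler_sum _ (fun i _ => Fe i)) _; rewrite sumr_const card_ord mulr_natl.
    apply: lerD.
      apply: le_trans (ler_normB _ _) _; apply: lerD.
        by apply: le_trans (Ef b) _; rewrite ler_wpM2r.
      apply: sums => i; rewrite normrM; apply: ler_pM => //.
      apply: le_trans (dot_mulmx_norm_le _ _ _) _.
      apply: ler_pM; rewrite ?mulr_ge0//.
        by apply: ler_wpM2l; rewrite ?mulr_ge0.
      by apply: ler_wpM2r.
    apply: sums => i; rewrite normrM; apply: ler_pM => //.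
    by apply: le_trans (Eg i b) _; rewrite ler_wpM2r.
  apply: le_trans (DRb _) _; rewrite -/q /newton_const.
  apply: le_trans (ler_wpM2l Kge qn) _.
  rewrite (mulrA K); apply: ler_wpM2r => //.
  by rewrite lerDl.
apply: mx_norm_le => [|a i].
  by rewrite mulr_ge0// addr_ge0// mulr_ge0.
rewrite ord1 mxE.
have -> : hg i (Rc u v) * (y + s) 0 i - mu =
   s 0 i * dot v (pg i u) + (hg i (Rc u v) - hg i u - dot v (pg i u)) * (y + s) 0 i.
  have := N2 i; rewrite !mxE => E.
  have -> : hg i (Rc u v) * (y 0 i + s 0 i) - mu =
    (hg i u * y 0 i - mu) + (y 0 i * dot v (pg i u) + s 0 i * hg i u) +
    s 0 i * dot v (pg i u) +
    (hg i (Rc u v) - hg i u - dot v (pg i u)) * (y 0 i + s 0 i) by ring.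
  by rewrite E subrr add0r.
apply: le_trans (ler_normD _ _) _; rewrite !normrM.
apply: (@le_trans _ _ (zeta * (n%:R * (zeta * K)) + K * zeta ^+ 2 * Y)).
  apply: lerD.
    apply: ler_pM => //; apply: le_trans (dot_norm_le _ _) _.
    by rewrite ler_wpM2l//; apply: ler_pM.
  by apply: ler_pM => //; exact: le_trans (V i) Kv.
have -> : zeta * (n%:R * (zeta * K)) + K * zeta ^+ 2 * Y = (n%:R * K + K * Y) * zeta ^+ 2.
  by ring.
by rewrite /newton_const ler_wpM2r// lerDr mulr_ge0.
Qed.

End NewtonStep.

Lemma le_half_cancel (R : realType) (a b q : R) : a + 2^-1 * q <= a -> q <= 0.
Proof. by move=> h; lra. Qed.

Section Model.
Context (R : realType) (n m : nat) (M : riemannianManifold R n).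
Context (f : M -> R) (g : 'I_m -> M -> R).
Context (f_C2 : Ck_fun (W := R^o) 2 setT f) (g_C2 : forall i, Ck_fun (W := R^o) 2 setT (g i)).
Context (Rt : M -> 'rV[R]_n -> M) (Rr : retraction Rt) (so : second_order Rt).
Context (c : chart R n M) (ac : atlas c).
Implicit Types (u v a b : 'rV[R]_n) (y s : 'rV[R]_m) (mu Delta : R).

Definition cost_diff u := pgrad (f \o pt c) u.
Definition cstr_diff i u := pgrad (g i \o pt c) u.
Definition cstr_val i u := g i (pt c u).
Definition cost_hess u := chess Rt c f u.
Definition cstr_hess i u := chess Rt c (g i) u.

Local Notation dual_res := (dual_residual cost_diff cstr_diff).
Local Notation kkt_res := (kkt_residual cost_diff cstr_diff cstr_val).
Local Notation lag_hess := (lagrangian_hess cost_hess cstr_hess).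
Local Notation kkt_jac := (kkt_jacobian cstr_diff cstr_val cost_hess cstr_hess).
Local Notation barrier_hess := (barrier_hessian cstr_diff cstr_val cost_hess cstr_hess).

Lemma Ck_fun_pred k (h : M -> R) : Ck_fun (W := R^o) k.+1 setT h ->
  Ck_fun (W := R^o) k setT h.
Proof. by move=> Ch c' ac'; exact: Ck_on_pred (Ch c' ac'). Qed.

Lemma innerDl (x : M) a a' b : inner x (a + a') b = inner x a b + inner x a' b.
Proof. by rewrite !innerE mulmxDl dotDl. Qed.

Lemma innerZl (x : M) k a b : inner x (k *: a) b = k * inner x a b.
Proof. by rewrite !innerE -scalemxAl dotZl. Qed.

Lemma inner_suml (x : M) (F : 'I_m -> 'rV[R]_n) b :
  inner x (\sum_i F i) b = \sum_i inner x (F i) b.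
Proof. by rewrite innerE mulmx_suml dot_suml. Qed.

Lemma innerBl (x : M) a a' b : inner x (a - a') b = inner x a b - inner x a' b.
Proof. by rewrite !innerE mulmxBl dotBl. Qed.

Lemma calG_adj_chart u a i : codom c u ->
  calG_adj g (pt c u) (a *m tanmx c u) 0 i = dot a (cstr_diff i u).
Proof.
by move=> cu; rewrite mxE inner_grad_chart//; exact/Ck_fun_pred/g_C2.
Qed.

Lemma opH_chart u y a b : codom c u ->
  inner (pt c u) (opH f g (pt c u) y (a *m tanmx c u)) (b *m tanmx c u) =
  dot (a *m barrier_hess u y) b.
Proof.
move=> cu; rewrite dot_barrier_hess /opH innerDl innerBl inner_suml.
rewrite (Hess_chart Rr so ac a b cu f_C2); congr (_ + _).
  rewrite /lagrangian_hess mulmxBr dotBl; congr (_ - _).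
  rewrite mulmx_sumr dot_suml; apply: eq_bigr => i _.
  by rewrite innerZl (Hess_chart Rr so ac a b cu (g_C2 i)) -scalemxAr dotZl.
rewrite /calG inner_suml; apply: eq_bigr => i _.
rewrite innerZl mxE (calG_adj_chart a i cu) inner_grad_chart//.
  by rewrite /cstr_val mulrA.
exact/Ck_fun_pred/g_C2.
Qed.

Definition barrier_cov mu u := cost_diff u - mu *: \sum_i (cstr_val i u)^-1 *: cstr_diff i u.

Lemma TRS_obj_chart u y mu a : codom c u ->
  TRS_obj f g (pt c u) y mu (a *m tanmx c u) =
  2^-1 * dot (a *m barrier_hess u y) a + dot a (barrier_cov mu u).
Proof.
move=> cu; rewrite /TRS_obj (opH_chart y a a cu); congr (_ + _).
rewrite /barrier_grad innerBl innerZl /calG inner_suml inner_grad_chart//; last first.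
  exact/Ck_fun_pred/f_C2.
rewrite /barrier_cov dotBr dotZr [X in _ = _ - _ * X]dotC dot_suml; congr (_ - _ * _).
apply: eq_bigr => i _; rewrite innerZl mxE inner_grad_chart//.
  by rewrite dotZl [in RHS]dotC.
exact/Ck_fun_pred/g_C2.
Qed.

Lemma barrier_hess_sym u y : codom c u -> (barrier_hess u y)^T = barrier_hess u y.
Proof.
move=> cu; rewrite /barrier_hessian /lagrangian_hess linearD linearB /=.
rewrite (chess_sym Rr ac cu f_C2); congr (_ - _ + _); rewrite linear_sum.
  by apply: eq_bigr => i _; rewrite linearZ /= (chess_sym Rr ac cu (g_C2 i)).
by apply: eq_bigr => i _; rewrite linearZ /= trmx_mul trmxK.
Qed.

(** Eliminating [s] makes [v] a stationary point of the model. At any other [a] the model is larger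
    by half the positive definite form at [a - v], so a feasible [v] is the only minimizer;
    [dual_step] is the eliminated equation solved for [s]. *)
Lemma TRS_newton u y v s mu Delta d : codom c u ->
  (forall i, 0 < cstr_val i u) -> posdef (barrier_hess u y) ->
  row_mx v s *m kkt_jac u y = - kkt_res u y mu ->
  norm (pt c u) (v *m tanmx c u) <= Delta ->
  TRS_sol f g (pt c u) y mu Delta d ->
  d = v *m tanmx c u /\ dual_step g (pt c u) y mu d = s.
Proof.
move=> cu gu pH; rewrite mul_kkt_jac /kkt_residual opp_row_mx => /eq_row_mx[N1 /rowP N2].
move=> vD [dD dmin].
have N2i i : y 0 i / cstr_val i u * dot v (cstr_diff i u) = - y 0 i + mu / cstr_val i u - s 0 i.
  have := N2 i; rewrite !mxE => E; have g0 := gu i.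
  have -> : y 0 i / cstr_val i u * dot v (cstr_diff i u) = (y 0 i * dot v (cstr_diff i u) + s 0 i * cstr_val i u) / cstr_val i u
    - s 0 i by field; rewrite gt_eqF.
  by rewrite E; field; rewrite gt_eqF.
have NH b : dot (v *m barrier_hess u y) b = - dot b (barrier_cov mu u).
  have := congr1 (fun w => dot w b) N1; rewrite dotNl dotBl /dual_residual dotBl !dot_suml.
  rewrite dot_barrier_hess => E.
  have -> : \sum_i y 0 i / cstr_val i u * (dot v (cstr_diff i u) * dot b (cstr_diff i u)) =
     - \sum_i dot (y 0 i *: cstr_diff i u) b - \sum_i dot (s 0 i *: cstr_diff i u) b
     + mu * \sum_i (cstr_val i u)^-1 * dot b (cstr_diff i u).
    rewrite mulr_sumr -sumrN -sumrB -big_split; apply: eq_bigr => i _ /=.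
    by rewrite !dotZl mulrA N2i (dotC (cstr_diff i u)); ring.
  rewrite /barrier_cov dotBr dotZr (dotC b (\sum_i _)) dot_suml.
  have -> : \sum_i dot ((cstr_val i u)^-1 *: cstr_diff i u) b = \sum_i (cstr_val i u)^-1 * dot b (cstr_diff i u).
    by apply: eq_bigr => i _; rewrite dotZl dotC.
  rewrite (dotC b); move: E; move: (dot (v *m _) b) (dot (cost_diff u) b).
  move: (\sum_i dot (s 0 i *: _) b) (\sum_i dot (y 0 i *: _) b).
  by move=> S1 S2 A B E; rewrite -(subrK S1 A) E; ring.
have uA := tanmx_unit ac cu.
pose a := d *m invmx (tanmx c u).
have dE : d = a *m tanmx c u by rewrite mulmxKV.
have av : a = v.
  apply/eqP; rewrite -subr_eq0; apply: contraT => /pH q0.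
  have := dmin _ vD; rewrite dE !(TRS_obj_chart _ _ _ cu).
  have sH := barrier_hess_sym y cu.
  have -> : 2^-1 * dot (a *m barrier_hess u y) a + dot a (barrier_cov mu u) =
     2^-1 * dot (v *m barrier_hess u y) v + dot v (barrier_cov mu u) +
     2^-1 * dot ((a - v) *m barrier_hess u y) (a - v).
    rewrite mulmxBl dotBl !(dotBr _ a v) (dot_symmx a v sH) (NH a) (NH v).
    by move: (dot (a *m _) a) (dot a _) (dot v _) => p1 p2 p3; field.
  move=> /(@le_half_cancel _ _ 0); rewrite leNgt q0//.
split; first by rewrite dE av.
apply/rowP => i; rewrite mxE dE av (calG_adj_chart v i cu).
by rewrite -/(cstr_val i u) N2i; ring.
Qed.

End Model.

(** * Local analysis near the KKT pair *)

(** The common constant is a sum and the common radius the inverse of a sum of inverses; both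
    dominate every index, and the added 1 also handles [m = 0]. *)
Lemma fin_uniform (R : realType) m (P : 'I_m -> R -> R -> Prop) :
  (forall i C r C' r', C <= C' -> r' <= r -> P i C r -> P i C' r') ->
  (forall i, exists C r, [/\ 0 < C, 0 < r & P i C r]) ->
  exists C r, [/\ 0 < C, 0 < r & forall i, P i C r].
Proof.
move=> mono H.
have {}H i : exists p : R * R, [/\ 0 < p.1, 0 < p.2 & P i p.1 p.2].
  by have [C [r H']] := H i; exists (C, r).
have [F FP] := choice H.
have s1 : 0 <= \sum_i (F i).1 by apply: sumr_ge0 => i _; have [/ltW] := FP i.
have s2 : 0 <= \sum_i (F i).2^-1.
  by apply: sumr_ge0 => i _; rewrite invr_ge0; have [_ /ltW] := FP i.
exists (\sum_i (F i).1 + 1), (\sum_i (F i).2^-1 + 1)^-1; split.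
- by rewrite ltr_wpDl.
- by rewrite invr_gt0 ltr_wpDl.
move=> i; have [C0 r0 Pi] := FP i; apply: mono Pi.
  rewrite (bigD1 i)//= -addrA lerDl addr_ge0// sumr_ge0// => j _.
  by have [/ltW] := FP j.
rewrite -[leRHS]invrK lef_pV2 ?posrE ?invr_gt0// ?ltr_wpDl//.
rewrite (bigD1 i)//= -addrA lerDl addr_ge0// sumr_ge0// => j _.
by rewrite invr_ge0; have [_ /ltW] := FP j.
Qed.

(** [free] indexes coefficients by position in the filtered list; this translates to coefficients
    indexed by the constraints. *)
Lemma free_coef0 (R : realType) n m (A : pred 'I_m) (F : 'I_m -> 'rV[R]_n)
    (s : 'rV[R]_m) :
  free [seq F i | i <- enum 'I_m & A i] -> (forall i, ~~ A i -> s 0 i = 0) ->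
  \sum_i s 0 i *: F i = 0 -> s = 0.
Proof.
move=> fr sA sum0; apply/rowP => i; rewrite [RHS]mxE.
have [Ai|/sA//] := boolP (A i).
pose S := [seq i <- enum 'I_m | A i].
have /freeP fr' : free (in_tuple [seq F i | i <- S]) by [].
have H := fr' (fun k => s 0 (nth i S k)).
have sz : size [seq F i | i <- S] = size S by rewrite size_map.
have sumS : \sum_(k < size [seq F i | i <- S]) s 0 (nth i S k) *:
    (in_tuple [seq F i | i <- S])`_k = 0.
  rewrite (eq_bigr (fun k : 'I_(size [seq F i | i <- S]) =>
     s 0 (nth i S k) *: F (nth i S k))); last first.
    by move=> k _; rewrite (nth_map i)// -sz.
  rewrite -(big_mkord xpredT (fun k => s 0 (nth i S k) *: F (nth i S k))) sz.
  rewrite -(big_nth i xpredT (fun i => s 0 i *: F i)) /S big_filter big_enum_cond /=.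
  rewrite -[RHS]sum0 [RHS](bigID A) /= [X in _ = _ + X]big1 ?addr0//.
  by move=> j /sA ->; rewrite scale0r.
have iS : i \in S by rewrite mem_filter Ai mem_enum.
have lt : (index i S < size [seq F i | i <- S])%N by rewrite sz index_mem.
by have := H sumS (Ordinal lt); rewrite /= nth_index.
Qed.

Lemma le_sum6 (R : realType) (a1 a2 a3 a4 a5 a6 : R) :
  0 <= a1 -> 0 <= a2 -> 0 <= a3 -> 0 <= a4 -> 0 <= a5 -> 0 <= a6 ->
  let s := a1 + a2 + a3 + a4 + a5 + a6 in
  [/\ a1 <= s, a2 <= s & a3 <= s] /\ [/\ a4 <= s, a5 <= s & a6 <= s].
Proof. by move=> h1 h2 h3 h4 h5 h6 s; split; split; rewrite /s; lra. Qed.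

Lemma newton_const_ge0 (R : realType) n m (K Y : R) :
  0 <= K -> 0 <= Y -> 0 <= newton_const n m K Y.
Proof.
move=> K0 Y0; rewrite /newton_const; apply: addr_ge0.
  by rewrite mulr_ge0// !addr_ge0// !mulr_ge0.
by rewrite addr_ge0// mulr_ge0.
Qed.

Section LocalStep.
Context (R : realType) (n m : nat) (M : riemannianManifold R n).
Context (f : M -> R) (g : 'I_m -> M -> R).
Context (f_C2 : Ck_fun (W := R^o) 2 setT f) (g_C2 : forall i, Ck_fun (W := R^o) 2 setT (g i)).
Context (Rt : M -> 'rV[R]_n -> M) (Rr : retraction Rt) (so : second_order Rt).
Context (xs : M) (ys : 'rV[R]_m) (kkt : KKT f g xs ys).
Context (sc : strict_complementarity g xs ys) (licq : LICQ g xs) (sosc : SOSC f g xs ys).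
Context (A6f : pullback_Hess_lipschitz Rt xs f).
Context (A6g : forall i, pullback_Hess_lipschitz Rt xs (g i)).
Implicit Types (u v a b : 'rV[R]_n) (y s : 'rV[R]_m) (mu Delta : R).

Let c := chart_at xs.
Let us := here xs.
Local Notation pf := (cost_diff f c).
Local Notation pg := (cstr_diff g c).
Local Notation hg := (cstr_val g c).
Local Notation Qf := (cost_hess f Rt c).
Local Notation Qg := (cstr_hess g Rt c).
Local Notation dual_res := (dual_residual pf pg).
Local Notation kkt_res := (kkt_residual pf pg hg).
Local Notation lag_hess := (lagrangian_hess Qf Qg).
Local Notation kkt_jac := (kkt_jacobian pg hg Qf Qg).
Local Notation barrier_hess := (barrier_hessian pg hg Qf Qg).

Let ac : atlas c. Proof. exact: chart_at_atlas. Qed.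
Let cs : codom c us. Proof. exact: here_codom. Qed.
Let oc : open (codom c). Proof. by case: (atlas_chart ac). Qed.
Let pts : pt c us = xs. Proof. exact: pt_here. Qed.

Let Cf : Ck_on 2 (codom c) (f \o pt c). Proof. exact: Ck_fun_pt. Qed.
Let Cg i : Ck_on 2 (codom c) (g i \o pt c). Proof. exact: (Ck_fun_pt ac (g_C2 i)). Qed.

Lemma lagrangian_C2 y : Ck_fun (W := R^o) 2 setT (lagrangian f g y).
Proof.
move=> c' ac'.
have oc' : open (coord c' @` (dom c' `&` setT)).
  by rewrite setIT; case: (atlas_chart ac').
exact: (Ck_on_comb (fun i => y 0 i) oc' (f_C2 ac') (fun i => g_C2 i ac')).
Qed.

Lemma pgrad_lagrangian y u : codom c u ->
  pgrad (lagrangian f g y \o pt c) u = dual_res u y.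
Proof.
move=> cu; exact: (pgrad_comb (fun i => y 0 i) (Ck_on_pred Cf)
  (fun i => Ck_on_pred (Cg i)) cu).
Qed.

Lemma phess_lagrangian y u : codom c u ->
  phess (lagrangian f g y \o pt c) u =
  phess (f \o pt c) u - \sum_i y 0 i *: phess (g i \o pt c) u.
Proof.
move=> cu; have -> : lagrangian f g y \o pt c =
  (fun w => (f \o pt c) w - \sum_i y 0 i * (g i \o pt c) w) by [].
exact: (phess_comb (U := codom c) oc (fun i => y 0 i) Cf Cg cu).
Qed.

(** The correction term of [chess] is linear in the differential, so the covariant Hessian in the
    chart commutes with forming the Lagrangian. *)
Lemma chess_lagrangian y u : codom c u ->
  chess Rt c (lagrangian f g y) u = lag_hess u y.
Proof.
move=> cu; apply/matrixP => i j; rewrite chessE phess_lagrangian// pgrad_lagrangian//.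
rewrite /lagrangian_hess [RHS]mxE [X in _ = _ + X]mxE summxE [X in X + _]mxE.
rewrite [X in _ + X + _]mxE summxE /cost_hess chessE /dual_residual dotBr [dot _ (\sum_i _)]dotC dot_suml.
rewrite (eq_bigr (fun k => y 0 k * phess (g k \o pt c) u i j)); last first.
  by move=> k _; rewrite mxE.
rewrite [X in _ = _ - X](eq_bigr (fun k => y 0 k * phess (g k \o pt c) u i j +
   dot (y 0 k *: pg k u) (Racc Rt c u i j))); last first.
  by move=> k _; rewrite mxE /cstr_hess chessE mulrDr dotZl (dotC _ (Racc _ _ _ _ _)).
rewrite big_split /=; ring.
Qed.

Lemma dual_res_stationary : dual_res us ys = 0.
Proof.
rewrite -pgrad_lagrangian//; apply: rV_dot_eq => b.
have H := inner_grad_chart b ac cs (Ck_fun_pred (lagrangian_C2 ys)).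
rewrite dotC -H pts; case: kkt => + _ _ _; rewrite innerE => ->.
by rewrite /dot !mul0mx.
Qed.

(** At the KKT pair the differential of the Lagrangian vanishes, and with it the correction in
    [chess]; there [lag_hess] is the matrix of ordinary second derivatives, hence the true
    derivative of the dual residual. *)
Lemma dual_res_expansion (e : R) : 0 < e -> \forall u \near us,
  `|dual_res u ys - (u - us) *m lag_hess us ys| <= e * `|u - us|.
Proof.
move=> e0; pose h := lagrangian f g ys \o pt c.
have Ch : Ck_on 2 (codom c) h by exact: Ck_fun_pt (lagrangian_C2 ys).
have E0 : pgrad h us = 0 by rewrite pgrad_lagrangian// dual_res_stationary.
have EQ : lag_hess us ys = phess h us.
  rewrite -chess_lagrangian//; apply/matrixP => i j.
  by rewrite chessE -/h E0 /dot trmx0 mulmx0 [X in _ + X]mxE addr0.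
have H j := C1_expansion oc (Ck_on_derive (delta_mx 0 j) Ch) cs e0.
pose P (j : 'I_n) (v : 'rV[R]_n) : Prop :=
    `|'D_(delta_mx 0 j) h (us + v) - 'D_(delta_mx 0 j) h us -
      \sum_i v 0 i * 'D_(delta_mx 0 i) (fun w => 'D_(delta_mx 0 j) h w) us| <= e * `|v|.
have {}H : \forall v \near (0 : 'rV[R]_n), forall j, P j v.
  by apply: (@filter_forall _ _ P _ (nbhs_filter (0 : 'rV[R]_n))) => j; exact: H.
have [r1 r10 r1P] := near_norm H.
have [r2 r20 r2P] := near_norm (open_nbhs_nbhs (conj oc cs)).
apply: (@norm_near _ _ _ _ (Num.min r1 r2)); first by rewrite lt_min r10.
move=> u; rewrite lt_min => /andP[u1 u2]; have cu := r2P _ u2.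
rewrite -pgrad_lagrangian// -/h EQ.
apply: mx_norm_le => [|i j]; first by rewrite mulr_ge0// ltW.
rewrite ord1; have := r1P (u - us); rewrite subr0 => /(_ u1 j).
rewrite /P (addrC us) subrK.
have -> : 'D_(delta_mx 0 j) h us = 0 by have /rowP/(_ j) := E0; rewrite !mxE.
rewrite subr0 !mxE.
by under [X in _ - X]eq_bigr do rewrite -[X in _ * X](mxE matrix_key (fun i j => 'D_(delta_mx 0 i)
   (fun w => 'D_(delta_mx 0 j) h w) us)).
Qed.

Lemma constraint_expansion i (e : R) : 0 < e -> \forall u \near us,
  `|hg i u - hg i us - dot (u - us) (pg i us)| <= e * `|u - us|.
Proof.
move=> e0; have [r r0 rP] := near_norm (C1_expansion oc (Ck_on_pred (Cg i)) cs e0).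
apply: (@norm_near _ _ _ _ r) => // u ur.
have := rP (u - us); rewrite subr0 => /(_ ur); rewrite (addrC us) subrK.
have -> // : dot (u - us) (pg i us) =
  \sum_j (u - us) 0 j * 'D_(delta_mx 0 j) (g i \o pt c) us.
by rewrite dotE; apply: eq_bigr => j _; congr (_ * _); rewrite mxE.
Qed.

Let hgs i : hg i us = g i xs. Proof. by rewrite /cstr_val pts. Qed.

Let cpg i : {for us, continuous (pg i)}.
Proof. exact: (pgrad_continuous (Cg i) cs). Qed.

Let chg i : {for us, continuous (hg i)}.
Proof. exact: (Ck_on_continuous (Cg i) cs). Qed.

Let cQf : {for us, continuous Qf}.
Proof. exact: (chess_continuous Rr ac cs f_C2). Qed.

Let cQg i : {for us, continuous (Qg i)}.
Proof. exact: (chess_continuous Rr ac cs (g_C2 i)). Qed.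

Let ys_ge0 i : 0 <= ys 0 i. Proof. by case: kkt => _ _ _; apply. Qed.

Let hg_ge0 i : 0 <= hg i us. Proof. by rewrite hgs; case: kkt => _ _ + _; apply. Qed.

Let compl i : hg i us * ys 0 i = 0.
Proof. by rewrite hgs; case: kkt => _ + _ _; apply. Qed.

Let strict i : (ys 0 i == 0) (+) (hg i us == 0).
Proof. by rewrite hgs; exact: sc. Qed.

Let licq_chart s : (forall i, hg i us != 0 -> s 0 i = 0) ->
  \sum_i s 0 i *: pg i us = 0 -> s = 0.
Proof.
move=> sA sum0; apply: (free_coef0 licq) => [i gi|]; first by apply: sA; rewrite hgs.
rewrite (eq_bigr (fun i => s 0 i *: pg i us *m invmx (gram c us))); last first.
  by move=> i _; rewrite -scalemxAl gradE.
by rewrite -mulmx_suml sum0 mul0mx.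
Qed.

(** The inequality clause of SOSC concerns active constraints with zero multiplier; strict
    complementarity leaves none, so equality on the active set suffices. *)
Let sosc_chart v : v != 0 -> (forall i, hg i us == 0 -> dot v (pg i us) = 0) ->
  0 < dot (v *m lag_hess us ys) v.
Proof.
move=> v0 act; rewrite -chess_lagrangian//.
have := Hess_chart Rr so ac v v cs (lagrangian_C2 ys).
rewrite (tanmx_here xs) !mulmx1 pts => <-; apply: sosc => // i gi.
  move=> _; have := inner_grad_chart v ac cs (Ck_fun_pred (g_C2 i)).
  rewrite (tanmx_here xs) mulmx1 pts => ->; apply: act.
  by rewrite hgs gi.
by move=> y0; have := strict i; rewrite y0 hgs gi eqxx.
Qed.

Lemma local_regularity : exists C r : R, [/\ 0 < C, 0 < r &
  forall u y, `|u - us| < r -> `|y - ys| < r ->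
  [/\ codom c u,
     `|row_mx (u - us) (y - ys)| <= C * `|kkt_res u y 0| /\
     `|kkt_res u y 0| <= C * `|row_mx (u - us) (y - ys)|,
     forall i, 0 < hg i u \/ 0 < y 0 i,
     (forall i, 0 < hg i u) -> (forall i, 0 < y 0 i) -> posdef (barrier_hess u y) &
     forall z : 'rV[R]_(n + m), `|z| <= C * `|z *m kkt_jac u y|]].
Proof.
have sQf : (Qf us)^T = Qf us := chess_sym Rr ac cs f_C2.
have sQg i : (Qg i us)^T = Qg i us := chess_sym Rr ac cs (g_C2 i).
have [C1 [r1 [C10 r10 H1]]] := kkt_error_bound cpg chg cQf cQg ys_ge0 compl strict
  licq_chart sosc_chart dual_res_expansion constraint_expansion.
have [C2 [r2 [C20 r20 H2]]] := kkt_jac_bound cpg chg cQf cQg ys_ge0 strict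
  licq_chart sosc_chart.
have [r3 r30 H3] := primal_or_dual_gt0 chg hg_ge0 ys_ge0 strict.
have [r4 r40 H4] := barrier_hess_posdef cpg chg cQf cQg sQf sQg ys_ge0 strict sosc_chart.
have [r5 r50 H5] := near_norm (open_nbhs_nbhs (conj oc cs)).
exists (C1 + C2), (Num.min (Num.min r1 r2) (Num.min (Num.min r3 r4) r5)); split.
- by rewrite addr_gt0.
- by rewrite !lt_min r10 r20 r30 r40 r50.
move=> u y; rewrite !lt_min => /andP[/andP[u1 u2] /andP[/andP[u3 u4] u5]].
move=> /andP[/andP[y1 y2] /andP[/andP[y3 y4] y5]].
have [E1 E2] := H1 u y u1 y1.
split; [exact: H5| |exact: H3|exact: H4|].
  split.
    by apply: le_trans E1 _; rewrite ler_wpM2r// lerDl ltW.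
  by apply: le_trans E2 _; rewrite ler_wpM2r// lerDl ltW.
by move=> z; apply: le_trans (H2 u y u2 y2 z) _; rewrite ler_wpM2r// lerDr ltW.
Qed.

Lemma continuous_bounded_near p q (F : 'rV[R]_n -> 'M[R]_(p, q)) :
  {for us, continuous F} ->
  exists K r : R, [/\ 0 < K, 0 < r & forall u, `|u - us| < r -> `|F u| <= K].
Proof.
move=> cF; have [r r0 rP] := near_norm ((cvgrPdist_le _ _).1 cF _ (@ltr01 R)).
exists (`|F us| + 1), r; split => //.
by move=> u /rP /norm_le_dist.
Qed.

Lemma local_newton : exists C r : R, [/\ 0 < C, 0 < r &
  forall u y v s mu (zeta : R), `|u - us| < r -> `|y - ys| < r -> `|v| < r -> `|s| < r ->
    row_mx v s *m kkt_jac u y = - kkt_res u y mu ->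
    0 <= zeta -> `|v| <= zeta -> `|s| <= zeta ->
    [/\ Rdom Rt c (u, v), `|Rchart Rt c (u, v) - u| <= C * zeta &
      `|kkt_res (Rchart Rt c (u, v)) (y + s) mu| <= C * zeta ^+ 2]].
Proof.
have A6f' : pullback_Hess_lipschitz Rt (pt c us) f by rewrite pts.
have A6g' i : pullback_Hess_lipschitz Rt (pt c us) (g i) by rewrite pts; exact: A6g.
have [K1 [r1 [K10 r10 H1]]] := grad_expansion Rr ac cs f_C2 A6f'.
have [K2 [r2 [K20 r20 H2]]] := fin_uniform (P := fun i C r => forall u v,
    `|u - us| < r -> `|v| < r -> forall b,
     `|dot (b *m Rjac Rt c (u, v)) (pg i (Rchart Rt c (u, v)))
       - dot b (pg i u) - dot (v *m Qg i u) b| <= C * `|v| ^+ 2 * `|b|)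
   (fun i C r C' r' CC rr H u v ur vr b => le_trans
      (H u v (lt_le_trans ur rr) (lt_le_trans vr rr) b)
      (ler_wpM2r (normr_ge0 b) (ler_wpM2r (sqr_ge0 `|v|) CC)))
   (fun i => let: ex_intro C (ex_intro r (And3 C0 r0 H)) :=
       grad_expansion Rr ac cs (g_C2 i) (A6g' i) in
     ex_intro _ C (ex_intro _ r (And3 C0 r0 (fun u v ur vr =>
       let: And3 _ _ h := H u v ur vr in h)))).
have [K3 [r3 [K30 r30 H3]]] := fin_uniform (P := fun i C r => forall u v,
    `|u - us| < r -> `|v| < r ->
     `|hg i (Rchart Rt c (u, v)) - hg i u - dot v (pg i u)| <= C * `|v| ^+ 2)
   (fun i C r C' r' CC rr H u v ur vr => le_trans
      (H u v (lt_le_trans ur rr) (lt_le_trans vr rr))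
      (ler_wpM2r (sqr_ge0 `|v|) CC))
   (fun i => value_expansion Rr ac cs (g_C2 i) (A6g' i)).
have [K4 [r4 [K40 r40 H4]]] := Rjac_bounds Rr ac cs.
have [K5 [r5 [K50 r50 H5]]] := fin_uniform (P := fun i C r => forall u,
    `|u - us| < r -> `|Qg i u| <= C)
   (fun i C r C' r' CC rr H u ur => le_trans (H u (lt_le_trans ur rr)) CC)
   (fun i => continuous_bounded_near (@cQg i)).
have [K6 [r6 [K60 r60 H6]]] := fin_uniform (P := fun i C r => forall u,
    `|u - us| < r -> `|pg i u| <= C)
   (fun i C r C' r' CC rr H u ur => le_trans (H u (lt_le_trans ur rr)) CC)
   (fun i => continuous_bounded_near (@cpg i)).
pose K := K1 + K2 + K3 + K4 + K5 + K6.
(* A bound on the new multipliers: both [y - ys] and [s] have norm below 1. *)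
pose Y := `|ys| + 2.
have Y0 : 0 <= Y by rewrite addr_ge0.
have K0 : 0 < K by rewrite !addr_gt0.
have [[L1 L2 L3] [L4 L5 L6]] := le_sum6 (ltW K10) (ltW K20) (ltW K30) (ltW K40)
  (ltW K50) (ltW K60); rewrite -/K in L1 L2 L3 L4 L5 L6.
have N0 : 0 <= newton_const n m K Y by exact: newton_const_ge0 (ltW K0) Y0.
pose rr := Num.min (Num.min (Num.min r1 r2) (Num.min r3 r4)) (Num.min (Num.min r5 r6) 1).
exists (K + newton_const n m K Y), rr; split.
- by rewrite ltr_wpDr.
- by rewrite !lt_min r10 r20 r30 r40 r50 r60 ltr01.
move=> u y v s mu zeta; rewrite !lt_min.
move=> /andP[/andP[/andP[u1 u2] /andP[u3 u4]] /andP[/andP[u5 u6] _]].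
move=> /andP[_ /andP[_ y1]].
move=> /andP[/andP[/andP[v1 v2] /andP[v3 v4]] _] /andP[_ /andP[_ s1]].
move=> N z0 vz sz.
have [_ Ud Rl Rj] := H4 u v u4 v4.
split => //.
  apply: le_trans Rl _; apply: ler_pM => //; first exact: ltW.
  by apply: le_trans L4 _; rewrite lerDl.
apply: (@le_trans _ _ (newton_const n m K Y * zeta ^+ 2)); last first.
  by rewrite ler_wpM2r ?sqr_ge0// lerDr ltW.
apply: (@newton_residual _ _ _ pf pg hg Qf Qg (fun u v => Rchart Rt c (u, v))
  (fun u v => Rjac Rt c (u, v)) K Y zeta u y v s mu) => //.
- apply: le_trans (ler_normD _ _) _; rewrite /Y.
  have -> : y = ys + (y - ys) by rewrite addrC subrK.
  have H : `|ys + (y - ys)| <= `|ys| + 1.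
    by apply: le_trans (ler_normD _ _) _; rewrite lerD2l ltW.
  have -> : `|ys| + 2 = `|ys| + 1 + 1 :> R by rewrite -addrA.
  by apply: lerD => //; exact: ltW.
- move=> b; have [_ _ H] := H1 u v u1 v1; apply: le_trans (H b) _.
  by rewrite ler_wpM2r// ler_wpM2r ?sqr_ge0.
- move=> i b; apply: le_trans (H2 i u v u2 v2 b) _.
  by rewrite ler_wpM2r// ler_wpM2r ?sqr_ge0.
- move=> i; apply: le_trans (H3 i u v u3 v3) _.
  by rewrite ler_wpM2r ?sqr_ge0.
- by move=> a; apply: le_trans (Rj a) _; rewrite ler_wpM2r.
- by move=> i; apply: le_trans (H5 i u u5) _.
- by move=> i; apply: le_trans (H6 i u u6) _.
Qed.

End LocalStep.

Section EuclideanNorm.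
Context (R : realType) (p : nat).
Implicit Types v : 'rV[R]_p.

Lemma enorm_ge v : `|v| <= enorm v.
Proof.
apply: mx_norm_le => [|i j]; first exact: sqrtr_ge0.
rewrite ord1 -sqrtr_sqr ler_sqrt; last by apply: sumr_ge0 => k _; exact: sqr_ge0.
by rewrite (bigD1 j)//= lerDl sumr_ge0// => k _; exact: sqr_ge0.
Qed.

Lemma enorm_le v : enorm v <= p%:R * `|v|.
Proof.
rewrite -[leRHS]ger0_norm ?mulr_ge0// -sqrtr_sqr ler_sqrt ?sqr_ge0// exprMn.
have H i : true -> v 0 i ^+ 2 <= `|v| ^+ 2.
  move=> _; rewrite -[v 0 i ^+ 2]real_normK ?num_real// ler_sqr ?nnegrE//.
  exact: mx_norm_ge.
apply: le_trans (ler_sum _ H) _; rewrite sumr_const card_ord -[leLHS]mulr_natl.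
rewrite ler_wpM2r ?sqr_ge0// -natrX ler_nat; case: (p) => // q.
by rewrite expnS expn1 leq_pmulr.
Qed.

End EuclideanNorm.

(** Only the first trial step is inspected. In the rejecting case it is recorded that a subproblem
    solution failed the stopping test, which near the KKT pair will be contradictory. *)
Lemma inner_iter_first (R : realType) (n m : nat) (M : riemannianManifold R n)
    (f : M -> R) (g : 'I_m -> M -> R) Rt phiL phic phis mu x y Delta x' y' Delta' :
  inner_iter f g Rt phiL phic phis mu x y Delta x' y' Delta' ->
  (exists d, [/\ TRS_sol f g x y mu Delta d, x' = Rt x d & y' = y + dual_step g x y mu d]) \/
  (exists2 d, TRS_sol f g x y mu Delta d &
     ~ stopping f g phiL phic phis mu (Rt x d) (y + dual_step g x y mu d)).
Proof.
case=> [x0 y0 D d ds _|x0 y0 D d x1 y1 D1 x2 y2 D2 ds nst _ _ _].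
  by left; exists d.
by right; exists d.
Qed.

(** * One outer iteration near the KKT pair *)

Section Step.
Context (R : realType) (n m : nat) (M : riemannianManifold R n).
Context (f : M -> R) (g : 'I_m -> M -> R).
Context (f_C2 : Ck_fun (W := R^o) 2 setT f) (g_C2 : forall i, Ck_fun (W := R^o) 2 setT (g i)).
Context (Rt : M -> 'rV[R]_n -> M) (Rr : retraction Rt) (so : second_order Rt).
Implicit Types (u v a b : 'rV[R]_n) (y s : 'rV[R]_m) (mu Delta : R).

Lemma eigenvalue_min_ge0 (c : chart R n M) u y : atlas c -> codom c u ->
  posdef (barrier_hessian (cstr_diff g c) (cstr_val g c) (cost_hess f Rt c) (cstr_hess g Rt c) u y) ->
  0 <= eigenvalue_min (opH f g (pt c u) y).
Proof.
move=> ac cu pH; rewrite /eigenvalue_min; set A := mkset _.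
(* Without eigenvectors the infimum takes its default value 0, which satisfies the claim. *)
have [->|A0] := eqVneq A set0; first by rewrite inf0.
apply: lb_le_inf; first exact/set0P.
move=> t [v v0 Av]; have uA := tanmx_unit ac cu.
pose a := v *m invmx (tanmx c u).
have vE : v = a *m tanmx c u by rewrite mulmxKV.
have a0 : a != 0 by apply: contra v0 => /eqP a0; rewrite vE a0 mul0mx.
have := pH _ a0; rewrite -(opH_chart f_C2 g_C2 Rr so ac y a a cu) -vE Av innerZl.
have iv : 0 < inner (pt c u) v v by exact: metric_posdef.
by rewrite pmulr_lgt0// => /ltW.
Qed.

Context (xs : M) (ys : 'rV[R]_m) (kkt : KKT f g xs ys).
Context (sc : strict_complementarity g xs ys) (licq : LICQ g xs) (sosc : SOSC f g xs ys).
Context (A6f : pullback_Hess_lipschitz Rt xs f).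
Context (A6g : forall i, pullback_Hess_lipschitz Rt xs (g i)).
Context (phiL phic phis : R -> R).
Context (phis_ge0 : forall t, 0 <= t -> 0 <= phis t).

Let c := chart_at xs.
Let us := here xs.
Local Notation kkt_res := (kkt_residual (cost_diff f c) (cstr_diff g c) (cstr_val g c)).
Local Notation dual_res := (dual_residual (cost_diff f c) (cstr_diff g c)).
Local Notation kkt_jac := (kkt_jacobian (cstr_diff g c) (cstr_val g c) (cost_hess f Rt c) (cstr_hess g Rt c)).

Let ac : atlas c. Proof. exact: chart_at_atlas. Qed.
Let cs : codom c us. Proof. exact: here_codom. Qed.

Lemma approx_stationary_equiv : exists C r : R, [/\ 0 < C, 0 < r &
  forall u y, `|u - us| < r ->
   [/\ codom c u, norm (pt c u) (grad (lagrangian f g y) (pt c u)) <= C * `|dual_res u y| &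
       `|dual_res u y| <= C * norm (pt c u) (grad (lagrangian f g y) (pt c u))]].
Proof.
have oc : open (codom c) by case: (atlas_chart ac).
have [C [r [C0 r0 H]]] := grad_norm_equiv ac cs.
have [r1 r10 r1P] := near_norm (open_nbhs_nbhs (conj oc cs)).
exists C, (Num.min r r1); split => //; first by rewrite lt_min r0.
move=> u y; rewrite lt_min => /andP[ur u1]; have cu := r1P _ u1.
have [] := H u ur _ (lagrangian_C2 f_C2 g_C2 y).
rewrite (pgrad_lagrangian f_C2 g_C2 y cu) => H1 H2; split => //.
Qed.

(** The three numerical conditions on the residual ensure, in order, that the trial point stays in
    the good neighbourhood, that the Newton step fits in the trust region, and that the new residual
    passes the stopping test. They are kept as hypotheses so that the induction along a run can
    verify them. *)
Lemma one_step : exists C r : R, [/\ 0 < C, 0 < r &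
  forall u y mu Delta x' y' Delta' kap, `|u - us| < r -> `|y - ys| < r ->
  strictly_feasible g (pt c u) y -> 0 < mu -> 0 < kap <= 1 ->
  kap * mu <= phiL mu -> kap * mu <= phic mu ->
  C * `|kkt_res u y mu| < r -> C * `|kkt_res u y mu| <= Delta ->
  C * `|kkt_res u y mu| ^+ 2 <= kap * mu / 2 ->
  inner_iter f g Rt phiL phic phis mu (pt c u) y Delta x' y' Delta' ->
  exists2 u', x' = pt c u' &
    [/\ codom c u', `|u' - u| <= C * `|kkt_res u y mu|,
       `|y' - y| <= C * `|kkt_res u y mu|,
       `|kkt_res u' y' mu| <= C * `|kkt_res u y mu| ^+ 2 &
       strictly_feasible g x' y']].
Proof.
have [C1 [r1 [C10 r10 H1]]] := local_regularity f_C2 g_C2 Rr so kkt sc licq sosc.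
have [C2 [r2 [C20 r20 H2]]] := local_newton f_C2 g_C2 Rr ys A6f A6g.
have [C3 [r3 [C30 r30 H3]]] := approx_stationary_equiv.
have [[k1 k2] /= [k10 k20 kP]] := norm_equiv ac cs.
have [r4 r40 r4P] := near_norm kP.
(* Half the radius is left for the step, since the estimates are applied at the new point too. *)
pose rr := Num.min (Num.min r1 r2) (Num.min r3 r4) / 2.
have rr0 : 0 < rr by rewrite divr_gt0// !lt_min r10 r20 r30 r40.
have [q1 q2 q3 q4] : [/\ 2 * rr <= r1, 2 * rr <= r2, 2 * rr <= r3 & 2 * rr <= r4].
  have -> : 2 * rr = Num.min (Num.min r1 r2) (Num.min r3 r4) by rewrite /rr mulrC divfK.
  by split; rewrite !ge_min lexx ?orbT.
pose D := C2 * C1 ^+ 2.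
have D0 : 0 < D by rewrite mulr_gt0// exprn_gt0.
(* The summands bound the Newton step, the motion in the chart, the Riemannian length of the step,
   and then the Riemannian gradient, the Euclidean complementarity residual and the full residual at
   the new point. *)
pose C := C1 + C2 * C1 + k2 * C1 + (C3 + m%:R + 1) * D.
have [e1 e2 e3 [e4 e5 e6]] : [/\ C1 <= C, C2 * C1 <= C, k2 * C1 <= C &
   [/\ C3 * D <= C, m%:R * D <= C & D <= C]].
  have a1 := ltW C10; have a2 : 0 <= C2 * C1 by rewrite mulr_ge0// ltW.
  have a3 : 0 <= k2 * C1 by rewrite mulr_ge0// ltW.
  have a4 : 0 <= C3 * D by rewrite mulr_ge0// ltW.
  have a5 : 0 <= m%:R * D by rewrite mulr_ge0// ltW.
  have -> : C = C1 + C2 * C1 + k2 * C1 + C3 * D + m%:R * D + D by rewrite /C; ring.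
  by have [[? ? ?] [? ? ?]] := le_sum6 a1 a2 a3 a4 a5 (ltW D0).
have C0 : 0 < C by exact: lt_le_trans C10 e1.
exists C, rr; split => // u y mu Delta x' y' Delta' kap ur yr fe mu0 /andP[kap0 kap1] kL kc.
set rho := `|kkt_res u y mu| => Cr CD Ck it.
have rho0 : 0 <= rho by exact: normr_ge0.
have rr2 : rr <= 2 * rr by rewrite ler_peMl ?ler1n// ltW.
have lt2 t t' : t < rr -> 2 * rr <= t' -> t < t'.
  by move=> h1 h2; apply: lt_le_trans h1 (le_trans rr2 h2).
have [cu _ _ pH Jb] := H1 u y (lt2 _ _ ur q1) (lt2 _ _ yr q1).
have [gu yu] := fe.
have uJ : kkt_jac u y \in unitmx.
  apply: inj_unitmx => z zJ; apply/eqP; rewrite -normr_le0.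
  by apply: le_trans (Jb z) _; rewrite zJ normr0 mulr0.
pose z := - kkt_res u y mu *m invmx (kkt_jac u y).
have zJ : z *m kkt_jac u y = - kkt_res u y mu by rewrite /z mulmxKV.
have zn : `|z| <= C1 * rho by apply: le_trans (Jb z) _; rewrite zJ normrN.
pose v := lsubmx z; pose s := rsubmx z.
have zE : z = row_mx v s by rewrite hsubmxK.
rewrite zE in zJ zn.
have vn : `|v| <= C1 * rho by apply: le_trans (norm_row_mx_l _ _) zn.
have sn : `|s| <= C1 * rho by apply: le_trans (norm_row_mx_r _ _) zn.
have vC : `|v| <= C * rho by apply: le_trans vn _; rewrite ler_wpM2r.
have sC : `|s| <= C * rho by apply: le_trans sn _; rewrite ler_wpM2r.
have vr2 : `|v| < r2 by apply: lt2 q2; exact: le_lt_trans Cr.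
have sr2 : `|s| < r2 by apply: lt2 q2; exact: le_lt_trans Cr.
have [Ud Rl Rq] := H2 u y v s mu (C1 * rho) (lt2 _ _ ur q2) (lt2 _ _ yr q2) vr2 sr2 zJ
  (mulr_ge0 (ltW C10) rho0) vn sn.
set u' := Rchart Rt c (u, v) in Rl Rq.
have Rq' : `|kkt_res u' (y + s) mu| <= D * rho ^+ 2.
  by apply: le_trans Rq _; rewrite exprMn mulrA.
have u'u : `|u' - u| <= C * rho by apply: le_trans Rl _; rewrite mulrA ler_wpM2r.
have u'r : `|u' - us| < 2 * rr.
  rewrite mulr_natl mulr2n -(subrKA u); apply: le_lt_trans (ler_normD _ _) _.
  by apply: ltrD => //; exact: le_lt_trans Cr.
have y'r : `|y + s - ys| < 2 * rr.
  rewrite mulr_natl mulr2n addrAC; apply: le_lt_trans (ler_normD _ _) _.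
  by apply: ltrD => //; exact: le_lt_trans Cr.
have [cu' _ pd pH' _] := H1 u' (y + s) (lt_le_trans u'r q1) (lt_le_trans y'r q1).
have rho2 : 0 <= rho ^+ 2 by exact: sqr_ge0.
have kmu : kap * mu / 2 <= kap * mu.
  by rewrite ler_pdivrMr// ler_peMr ?ler1n// mulr_ge0// ltW.
(* The strict bound by [mu] makes every product positive; the factor 1/2 in the hypothesis is what
   makes it strict when [kap = 1]. *)
have comp_i i : `|cstr_val g c i u' * (y + s) 0 i - mu| < mu.
  have -> : cstr_val g c i u' * (y + s) 0 i - mu =
      (\row_j (cstr_val g c j u' * (y + s) 0 j - mu)) 0 i by rewrite !mxE.
  apply: le_lt_trans (mx_norm_ge _ _ _) _.
  apply: le_lt_trans (norm_row_mx_r (dual_res u' (y + s)) _) _.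
  apply: le_lt_trans Rq' _; apply: (@le_lt_trans _ _ (kap * mu / 2)).
    by apply: le_trans Ck; rewrite ler_wpM2r.
  rewrite ltr_pdivrMr//; apply: (@le_lt_trans _ _ mu).
    by rewrite ler_piMl// ltW.
  by rewrite ltr_pMr// ltr1n.
have fe' : strictly_feasible g (pt c u') (y + s).
  have pos i : 0 < cstr_val g c i u' * (y + s) 0 i.
    have := comp_i i; rewrite ltr_distl => /andP[+ _]; by rewrite subrr.
  split=> i; have := pos i; case: (pd i) => h.
  - by move=> _; exact: h.
  - by rewrite pmulr_lgt0.
  - by rewrite pmulr_rgt0.
  - by move=> _; exact: h.
have st : stopping f g phiL phic phis mu (pt c u') (y + s).
  have [_ N1 _] := H3 u' (y + s) (lt_le_trans u'r q3).
  split; last first.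
    have [gu' yu'] := fe'.
    apply: (@le_trans _ _ 0); first by rewrite oppr_le0 phis_ge0// ltW.
    by apply: (eigenvalue_min_ge0 ac cu'); exact: pH'.
  split=> //.
    apply: le_trans N1 _; apply: le_trans kL; apply: le_trans kmu; apply: le_trans Ck.
    apply: (@le_trans _ _ (C3 * (D * rho ^+ 2))).
      by rewrite ler_wpM2l ?(ltW C30)//; apply: le_trans (norm_row_mx_l _ _) Rq'.
    by rewrite mulrA ler_wpM2r.
  apply: le_trans kc; apply: le_trans kmu; apply: le_trans Ck.
  apply: le_trans (enorm_le _) _.
  apply: (@le_trans _ _ (m%:R * (D * rho ^+ 2))).
    rewrite ler_wpM2l//; apply: le_trans _ Rq'.
    exact: (norm_row_mx_r (dual_res u' (y + s)) (compl_res g (pt c u') (y + s) mu)).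
  by rewrite mulrA ler_wpM2r.
have vA : norm (pt c u) (v *m tanmx c u) <= Delta.
  have [_ /(_ v)/andP[_ h]] := r4P _ (lt2 _ _ ur q4).
  apply: le_trans h _; apply: le_trans CD.
  apply: (@le_trans _ _ (k2 * (C1 * rho))); first by rewrite ler_wpM2l// ltW.
  by rewrite mulrA ler_wpM2r.
have newton d : TRS_sol f g (pt c u) y mu Delta d ->
    Rt (pt c u) d = pt c u' /\ y + dual_step g (pt c u) y mu d = y + s.
  move=> ds; have [-> ->] := TRS_newton f_C2 g_C2 Rr so ac cu gu (pH gu yu) zJ vA ds.
  by split=> //; rewrite /u' (pt_Rchart ac Ud) /= from_chartE.
(* In either case the first subproblem solution is the Newton step; a rejection contradicts [st]. *)
have [[d [ds -> ->]]|[d ds nst]] := inner_iter_first it; have [E1 E2] := newton d ds.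
  exists u'; first exact: E1.
  rewrite E1 E2; split => //; first by rewrite addrC addKr.
  by apply: le_trans Rq' _; rewrite ler_wpM2r.
by exfalso; apply: nst; rewrite E1 E2.
Qed.

End Step.

(** * Convergence rates *)

Lemma C1_lipschitz_near (R : realType) n p (U : set 'rV[R]_n) (F : 'rV[R]_n -> 'rV[R]_p) u0 :
  open U -> Ck_on 1 U F -> U u0 ->
  exists B r : R, [/\ 0 < B, 0 < r & forall u, `|u - u0| < r ->
    `|F u - F u0| <= B * `|u - u0|].
Proof.
move=> oU CF Uu0; pose P (j : 'I_p) (B r : R) := forall u, `|u - u0| < r ->
    `|F u 0 j - F u0 0 j| <= B * `|u - u0|.
have [||B [r [B0 r0 H]]] := @fin_uniform _ _ P.
- move=> j C r C' r' CC rr H u ur; apply: le_trans (H u (lt_le_trans ur rr)) _.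
  exact: ler_wpM2r.
- move=> j; have CFj := Ck_on_coord 0 j oU CF.
  have [r r0 rP] := near_norm (C1_expansion oU CFj Uu0 (@ltr01 R)).
  pose B := \sum_i `|'D_(delta_mx 0 i) (fun u => F u 0 j) u0|.
  have B0 : 0 <= B by apply: sumr_ge0.
  exists (1 + B), r; split => //; first by rewrite ltr_pwDl.
  move=> u ur; have := rP (u - u0); rewrite subr0 => /(_ ur).
  rewrite (addrC u0) subrK mul1r; set S := \sum_j0 _ => H.
  have HS : `|S| <= B * `|u - u0|.
    rewrite /B mulr_suml; apply: le_trans (ler_norm_sum _ _ _) _; apply: ler_sum => i _.
    by rewrite normrM mulrC ler_wpM2l// mx_norm_ge.
  rewrite -(subrK S (_ - _)); apply: le_trans (ler_normD _ _) _.
  by rewrite mulrDl mul1r; apply: lerD.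
exists B, r; split => // u ur; apply: mx_norm_le => [|i j].
  by rewrite mulr_ge0// ltW.
by rewrite ord1 !mxE; exact: H.
Qed.

Section ChartError.
Context (R : realType) (n m : nat) (M : smoothManifold R n).
Context (psi c : chart R n M) (sp : smooth_chart psi) (ac : atlas c).
Context (us : 'rV[R]_n) (cs : codom c us) (ds : dom psi (pt c us)) (ys : 'rV[R]_m).

(** Changing the chart alters the error only by constant factors: the transition map and its inverse
    are Lipschitz at the limit point. The rates can thus be proved in one chart. *)
Lemma chart_err_equiv : exists a b r : R, [/\ 0 < a, 0 < b, 0 < r &
  forall u y, `|u - us| < r ->
   a * `|row_mx (u - us) (y - ys)| <=
     enorm (row_mx (coord psi (pt c u)) y - row_mx (coord psi (pt c us)) ys) <=
   b * `|row_mx (u - us) (y - ys)|].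
Proof.
case: sp => chp cp; have [pc cpc] := cp c ac; have ch := atlas_chart ac.
have oo := overlap_open ch chp; have oo' := overlap_open chp ch.
have ou : overlap c psi us by exact: overlapP.
have ou' := transition_overlap ch chp ou.
have [B [r [B0 r0 H]]] := C1_lipschitz_near oo (cpc 1%N) ou.
have [B' [r' [B'0 r'0 H']]] := C1_lipschitz_near oo' (pc 1%N) ou'.
have [r1 r10 r1P] := near_norm (open_nbhs_nbhs (conj oo ou)).
exists (B' + 1)^-1, ((n + m)%:R * (B + 1) + 1), (Num.min (Num.min r r1) (r' / B)).
have B1 : 0 < B + 1 by rewrite addr_gt0.
have B'1 : 0 < B' + 1 by rewrite addr_gt0.
split.
- by rewrite invr_gt0.
- by rewrite ltr_wpDl// mulr_ge0// ltW.
- by rewrite !lt_min r0 r10 divr_gt0.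
move=> u y; rewrite !lt_min => /andP[/andP[ur u1] u2].
rewrite opp_row_mx add_row_mx; set w := row_mx (u - us) _; set E := row_mx (coord psi _ - _) _.
have ouu := r1P _ u1.
have Eu : `|coord psi (pt c u) - coord psi (pt c us)| <= B * `|u - us| := H u ur.
have uE : `|u - us| <= B' * `|coord psi (pt c u) - coord psi (pt c us)|.
  have := H' (transition c psi u); rewrite !transitionK//; apply.
  by apply: le_lt_trans Eu _; rewrite mulrC -ltr_pdivlMr.
apply/andP; split.
  rewrite ler_pdivrMl//; apply: (@le_trans _ _ ((B' + 1) * `|E|)).
    apply: norm_row_mx_le.
      apply: le_trans uE _; apply: ler_pM => //; first exact: ltW.
        by rewrite lerDl.
      exact: norm_row_mx_l.
    rewrite -[leLHS]mul1r; apply: ler_pM => //; first by rewrite lerDr ltW.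
    exact: norm_row_mx_r.
  by rewrite ler_wpM2l ?(ltW B'1)// enorm_ge.
apply: le_trans (enorm_le _) _.
apply: (@le_trans _ _ ((n + m)%:R * ((B + 1) * `|w|))).
  rewrite ler_wpM2l//; apply: norm_row_mx_le.
    apply: le_trans Eu _; apply: ler_pM => //; first exact: ltW.
      by rewrite lerDl.
    exact: norm_row_mx_l.
  rewrite -[leLHS]mul1r; apply: ler_pM => //; first by rewrite lerDr ltW.
  exact: norm_row_mx_r.
by rewrite mulrA ler_wpM2r// lerDl.
Qed.

End ChartError.

(** * Invariants along a whole run *)

Section Run.
Context (R : realType) (n m : nat) (M : riemannianManifold R n).
Context (f : M -> R) (g : 'I_m -> M -> R).
Context (f_C2 : Ck_fun (W := R^o) 2 setT f) (g_C2 : forall i, Ck_fun (W := R^o) 2 setT (g i)).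
Context (Rt : M -> 'rV[R]_n -> M) (Rr : retraction Rt) (so : second_order Rt).
Context (xs : M) (ys : 'rV[R]_m) (kkt : KKT f g xs ys).
Context (sc : strict_complementarity g xs ys) (licq : LICQ g xs) (sosc : SOSC f g xs ys).
Context (A6f : pullback_Hess_lipschitz Rt xs f).
Context (A6g : forall i, pullback_Hess_lipschitz Rt xs (g i)).
Context (phiL phic phis : R -> R) (phis_ge0 : forall t, 0 <= t -> 0 <= phis t).
Context (Delta0 Delta_min : R) (Delta0_gt0 : 0 < Delta0) (Delta_min_gt0 : 0 < Delta_min).
Context (mu : nat -> R) (mu_gt0 : forall k, 0 < mu k).
Context (A2L : exists kl ku : R, [/\ 0 < kl, kl < 1, 1 < ku &
     forall k, kl * mu k.+1 <= phiL (mu k.+1) <= ku * mu k.+1]).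
Context (A2c : exists kl ku : R, [/\ 0 < kl, kl < 1, 1 < ku &
     forall k, kl * mu k.+1 <= phic (mu k.+1) <= ku * mu k.+1]).
Context (A3 : mu k ^+ 2 / mu k.+1 @[k --> \oo] --> (0 : R)).
Context (A4 : \forall k \near \oo, mu k.+1 <= mu k).

Let c := chart_at xs.
Let us := here xs.
Local Notation kkt_res := (kkt_residual (cost_diff f c) (cstr_diff g c) (cstr_val g c)).
Local Notation dual_res := (dual_residual (cost_diff f c) (cstr_diff g c)).

Let ac : atlas c. Proof. exact: chart_at_atlas. Qed.

Definition local_err (x : nat -> M) (y : nat -> 'rV[R]_m) k : R :=
  `|row_mx (coord c (x k) - us) (y k - ys)|.

Lemma kkt_res_shift u y t t' : `|kkt_res u y t| <= `|kkt_res u y t'| + `|t' - t|.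
Proof.
have -> : kkt_res u y t = kkt_res u y t' + row_mx 0 (\row_i (t' - t)).
  rewrite /kkt_residual add_row_mx addr0; congr row_mx; apply/rowP => i; rewrite !mxE; ring.
apply: le_trans (ler_normD _ _) _; rewrite lerD2l.
apply: norm_row_mx_le; first by rewrite normr0.
by apply: mx_norm_le => // i j; rewrite mxE.
Qed.

Lemma kkt_res_unconstrained u y t t' : m = 0%N -> kkt_res u y t = kkt_res u y t'.
Proof.
move=> m0; rewrite /kkt_residual; congr row_mx; apply/rowP => i.
by exfalso; move: i; rewrite m0 => -[].
Qed.

Lemma schedule_tail (eps : R) : 0 < eps -> exists2 K0, (0 < K0)%N &
  forall k, (K0 <= k)%N -> mu k.+1 <= mu k /\ mu k ^+ 2 <= eps * mu k.+1.
Proof.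
move=> eps0; move/cvgrPdist_le/(_ _ eps0) : A3 => A3'.
have [K0 _ H] := filterI A4 A3'.
(* The threshold is made positive because (A2) and the update rule speak of mu from index 1 on. *)
exists K0.+1 => // k Kk; have [h1 h2] := H k (ltnW Kk); split => //.
move: h2; rewrite sub0r normrN => /(le_trans (ler_norm _)).
by rewrite ler_pdivrMr.
Qed.

(** The error bounds begin at index 1: only computed iterates have a residual at most half the
    barrier parameter, which the comparison from below needs. The disjunction is the unconstrained
    case against the case with a constraint. *)
Lemma run_bounds : exists C ra delta : R, [/\ 0 < C, 0 < ra, 0 < delta &
  forall K (x : nat -> M) (y : nat -> 'rV[R]_m),
  let nu := fun k => mu (K + k)%N in
  dom c (x 0%N) -> `|coord c (x 0%N) - us| < ra -> `|y 0%N - ys| < ra ->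
  nu 0%N < delta ->
  approx_stationary f g phiL phic (nu 0%N) (x 0%N) (y 0%N) ->
  outer_run f g Rt phiL phic phis Delta0 Delta_min nu x y ->
  (0 < K)%N /\ forall k, [/\ dom c (x k), local_err x y k.+1 <= C * nu k.+1 &
     local_err x y k.+2 <= C * local_err x y k.+1 ^+ 2 \/
     (local_err x y k.+2 <= C * nu k.+2 /\ nu k.+1 <= C * local_err x y k.+1)]].
Proof.
have [C0 [r0 [C00 r00 H0]]] := one_step f_C2 g_C2 Rr so kkt sc licq sosc A6f A6g phiL phic phis_ge0.
have [C1 [r1 [C10 r10 H1]]] := local_regularity f_C2 g_C2 Rr so kkt sc licq sosc.
have [C3 [r3 [C30 r30 H3]]] := approx_stationary_equiv f_C2 g_C2 xs.
have [kl1 [ku1 [kl10 kl11 ku11 phiLP]]] := A2L.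
have [kl2 [ku2 [kl20 kl21 ku21 phicP]]] := A2c.
pose kap := Num.min kl1 kl2.
have kap0 : 0 < kap by rewrite lt_min kl10.
have kap1 : kap <= 1 by rewrite ge_min (ltW kl11).
(* [C5] is the residual bound, relative to mu, granted by the stopping test; [C6] adds the change
   from one barrier parameter to the next. *)
pose C5 := C3 * ku1 + ku2 + 1.
have ku10 : 0 < ku1 by exact: lt_trans ku11.
have ku20 : 0 < ku2 by exact: lt_trans ku21.
have C31 : 0 < C3 * ku1 by rewrite mulr_gt0.
have C5_1 : 1 <= C5 by rewrite /C5 lerDr addr_ge0// ltW.
have C50 : 0 < C5 by exact: lt_le_trans C5_1.
pose C6 := C5 + 1.
have C60 : 0 < C6 by rewrite addr_gt0.
pose ra := Num.min (Num.min r0 r1) r3 / 2.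
have ra0 : 0 < ra by rewrite divr_gt0// !lt_min r00 r10 r30.
have [q0 q1 q3] : [/\ 2 * ra <= r0, 2 * ra <= r1 & 2 * ra <= r3].
  have -> : 2 * ra = Num.min (Num.min r0 r1) r3 by rewrite /ra mulrC divfK.
  by split; rewrite !ge_min lexx ?orbT.
have ra2 : ra <= 2 * ra by rewrite ler_peMl ?ler1n// ltW.
(* The tolerance in (A3) for which [C0] times the squared residual bound [C6 * nu k] is at most
   [kap * nu k.+1 / 2], as [one_step] demands. *)
pose eps := kap / 2 / (C0 * C6 ^+ 2).
have eps0 : 0 < eps by rewrite !divr_gt0// mulr_gt0// exprn_gt0.
have [K0 K00 tail] := schedule_tail eps0.
(* The finitely many earlier barrier parameters are positive, so a small initial one can only occur
   in the tail where the asymptotic conditions hold. *)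
have [d0 d00 d0P] : exists2 d : R, 0 < d & forall k, mu k < d -> (K0 <= k)%N.
  elim: (K0) => [|q [d dp IH]]; first by exists 1.
  exists (Num.min d (mu q)); first by rewrite lt_min dp mu_gt0.
  move=> k; rewrite lt_min => /andP[/IH]; rewrite leq_eqVlt => /orP[/eqP ->|//].
  by rewrite ltxx.
pose Dlo := Num.min Delta0 Delta_min.
have Dlo0 : 0 < Dlo by rewrite lt_min Delta0_gt0.
(* In order: the run starts in the tail, a step is shorter than [ra], it fits in every initial trust
   region, and the new error is again below [ra]. *)
pose delta := Num.min d0 (Num.min (ra / (C0 * C6)) (Num.min (Dlo / (C0 * C6)) (ra / (2 * C1)))).
have C06 : 0 < C0 * C6 by rewrite mulr_gt0.
pose C := 2 * C1 + C1 ^+ 3 * C0.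
have C130 : 0 < C1 ^+ 3 * C0 by rewrite mulr_gt0// exprn_gt0.
have C120 : 0 < 2 * C1 by rewrite mulr_gt0.
exists C, ra, delta; split => //.
- by rewrite addr_gt0.
- by rewrite !lt_min d00 (divr_gt0 ra0 C06) (divr_gt0 Dlo0 C06) (divr_gt0 ra0 C120).
move=> K x y nu dx0 u0r y0r nu0; rewrite /approx_stationary => -[S1 S2 S3] [_ [Di [Df [D0 DS Df0 it]]]].
have KK : (K0 <= K)%N.
  by move: nu0; rewrite lt_min => /andP[/d0P + _]; rewrite addn0.
have nup k : 0 < nu k by exact: mu_gt0.
have nuS k : nu k.+1 <= nu k /\ nu k ^+ 2 <= eps * nu k.+1.
  by rewrite /nu addnS; apply: tail; exact: leq_trans (leq_addr _ _).
have nud k : nu k < delta.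
  by elim: k => // k IH; apply: le_lt_trans IH; have [] := nuS k.
have Klt : (0 < K)%N by exact: leq_trans KK.
have phiLk k : kap * nu k <= phiL (nu k) <= ku1 * nu k.
  rewrite /nu -(prednK (leq_trans Klt (leq_addr k K))).
  have /andP[h1 h2] := phiLP (K + k).-1; rewrite h2 andbT; apply: le_trans h1.
  by rewrite ler_wpM2r ?(ltW (mu_gt0 _))// ge_min lexx.
have phick k : kap * nu k <= phic (nu k) <= ku2 * nu k.
  rewrite /nu -(prednK (leq_trans Klt (leq_addr k K))).
  have /andP[h1 h2] := phicP (K + k).-1; rewrite h2 andbT; apply: le_trans h1.
  by rewrite ler_wpM2r ?(ltW (mu_gt0 _))// ge_min lexx orbT.
pose u k := coord c (x k).
have ch := atlas_chart ac.
(* The distances do not accumulate: each new error is bounded afresh through its residual, not by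
   adding step lengths. *)
pose Inv k := [/\ dom c (x k), `|u k - us| < ra, `|y k - ys| < ra,
   strictly_feasible g (x k) (y k) & `|kkt_res (u k) (y k) (nu k)| <= C5 * nu k].
have DiP k : Dlo <= Di k.
  case: k => [|k]; first by rewrite D0 ge_min lexx.
  by rewrite DS ge_min !le_max lexx !orbT.
have rhoP k : Inv k -> `|kkt_res (u k) (y k) (nu k.+1)| <= C6 * nu k.
  move=> [_ _ _ _ h]; apply: le_trans (kkt_res_shift _ _ _ (nu k)) _.
  rewrite /C6 mulrDl mul1r; apply: lerD => //.
  have [h1 _] := nuS k; rewrite ger0_norm ?subr_ge0// gerBl ltW//.
have stepk k : Inv k -> [/\ Inv k.+1,
    `|kkt_res (u k.+1) (y k.+1) (nu k.+1)| <= nu k.+1 / 2,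
    `|kkt_res (u k.+1) (y k.+1) (nu k.+1)| <=
      C0 * `|kkt_res (u k) (y k) (nu k.+1)| ^+ 2 &
    local_err x y k.+1 <= 2 * C1 * nu k.+1].
  move=> Ik; have rk := rhoP k Ik; have [dk uk yk fk _] := Ik.
  have := nud k; rewrite !lt_min => /andP[_ /andP[n1 /andP[n2 n3]]].
  set rho := `|kkt_res (u k) (y k) (nu k.+1)| in rk *.
  have rho0 : 0 <= rho by exact: normr_ge0.
  have Cr : C0 * rho < ra.
    apply: (@le_lt_trans _ _ (C0 * C6 * nu k)); first by rewrite -mulrA ler_wpM2l// ltW.
    by rewrite mulrC -ltr_pdivlMr.
  have CD : C0 * rho <= Di k.
    apply: le_trans (DiP k); apply: (@le_trans _ _ (C0 * C6 * nu k)).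
      by rewrite -mulrA ler_wpM2l// ltW.
    by rewrite mulrC -ler_pdivlMr// ltW.
  have Ck : C0 * rho ^+ 2 <= kap * nu k.+1 / 2.
    apply: (@le_trans _ _ (C0 * (C6 * nu k) ^+ 2)).
      rewrite ler_wpM2l ?(ltW C00)// ler_sqr ?nnegrE//.
      by rewrite mulr_ge0// ltW.
    have [_ h2] := nuS k; rewrite exprMn mulrA.
    apply: le_trans (ler_wpM2l _ h2) _; first by rewrite mulr_ge0 ?sqr_ge0// ltW.
    rewrite le_eqVlt; apply/orP; left; apply/eqP; rewrite /eps; field.
    by rewrite !gt_eqF.
  have xE : x k = pt c (u k) by rewrite (coordK ch dk).
  have /andP[pL _] := phiLk k.+1; have /andP[pc _] := phick k.+1.
  have itk := it k; rewrite xE in itk fk.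
  have [u' xu' [cu' u'u y'y res' fe']] := H0 (u k) (y k) (nu k.+1) (Di k) (x k.+1) (y k.+1)
    (Df k) kap (lt_le_trans (lt_le_trans uk ra2) q0) (lt_le_trans (lt_le_trans yk ra2) q0)
    fk (nup k.+1) (introT andP (conj kap0 kap1)) pL pc
    (lt_le_trans (lt_le_trans Cr ra2) q0) CD Ck itk.
  have uE : u k.+1 = u' by rewrite /u xu' (ptK ch cu').
  rewrite -uE in u'u res'.
  have half : `|kkt_res (u k.+1) (y k.+1) (nu k.+1)| <= nu k.+1 / 2.
    apply: le_trans res' _; apply: le_trans Ck _; rewrite ler_wpM2r//.
    by rewrite ler_piMl// ltW.
  have u'r : `|u k.+1 - us| < 2 * ra.
    rewrite mulr_natl mulr2n -(subrKA (u k)); apply: le_lt_trans (ler_normD _ _) _.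
    by apply: ltrD => //; exact: le_lt_trans Cr.
  have y'r : `|y k.+1 - ys| < 2 * ra.
    rewrite mulr_natl mulr2n -(subrKA (y k)); apply: le_lt_trans (ler_normD _ _) _.
    by apply: ltrD => //; exact: le_lt_trans Cr.
  have [_ [eb _] _ _ _] := H1 (u k.+1) (y k.+1) (lt_le_trans u'r q1) (lt_le_trans y'r q1).
  have err : local_err x y k.+1 <= 2 * C1 * nu k.+1.
    apply: le_trans eb _; rewrite [2 * C1]mulrC -mulrA ler_wpM2l ?(ltW C10)//.
    apply: le_trans (kkt_res_shift _ _ _ (nu k.+1)) _.
    rewrite subr0 (gtr0_norm (nup _)) [2 * _]mulr_natl mulr2n lerD2r.
    apply: le_trans half _; rewrite ler_pdivrMr// ler_peMr ?ler1n// ltW//.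
  have errs : local_err x y k.+1 < ra.
    apply: le_lt_trans err _; have := nud k.+1.
    rewrite !lt_min => /andP[_ /andP[_ /andP[_ h]]].
    by rewrite mulrC -ltr_pdivlMr.
  split => //; split => //.
  - by rewrite xu'; exact: pt_dom.
  - by apply: le_lt_trans errs; exact: norm_row_mx_l.
  - by apply: le_lt_trans errs; exact: norm_row_mx_r.
  - apply: le_trans half _; apply: (@le_trans _ _ (nu k.+1)).
      by rewrite ler_pdivrMr// ler_peMr ?ler1n// ltW.
    by rewrite ler_peMl// ltW.
have Inv0 : Inv 0%N.
  split => //.
  have [_ _ h] := H3 (u 0%N) (y 0%N) (lt_le_trans (lt_le_trans u0r ra2) q3).
  rewrite (coordK ch dx0) in h.
  have /andP[_ pL] := phiLk 0%N; have /andP[_ pc] := phick 0%N.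
  have nu00 := nup 0%N.
  apply: norm_row_mx_le.
    apply: (@le_trans _ _ (C3 * ku1 * nu 0%N)).
      apply: le_trans h _; rewrite -mulrA ler_wpM2l ?(ltW C30)//.
      exact: le_trans S1 pL.
    by rewrite ler_wpM2r ?(ltW nu00)// /C5 -addrA lerDl addr_ge0// ltW.
  apply: (@le_trans _ _ (ku2 * nu 0%N)).
    have -> : \row_i (cstr_val g c i (u 0%N) * y 0%N 0 i - nu 0%N) =
        compl_res g (x 0%N) (y 0%N) (nu 0%N).
      by apply/rowP => i; rewrite !mxE /cstr_val (coordK ch dx0).
    by apply: le_trans (enorm_ge _) _; exact: le_trans S2 pc.
  rewrite ler_wpM2r ?(ltW nu00)// /C5 addrAC lerDr addr_ge0// ltW//.
have InvP k : Inv k by elim: k => // k /stepk[].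
split => // k; have [I1 hf1 _ er1] := stepk k (InvP k).
have [I2 hf2 qd2 er2] := stepk k.+1 I1.
have [dk _ _ _ _] := InvP k.
split => //.
  by apply: le_trans er1 _; rewrite ler_wpM2r ?(ltW (nup _))// lerDl ltW.
have [d1 u1 y1 [g1 _] _] := I1; have [_ u2 y2 _ _] := I2.
have lt2 t t' : t < ra -> 2 * ra <= t' -> t < t'.
  by move=> h1 h2; apply: lt_le_trans h1 (le_trans ra2 h2).
have [_ [eb1 eb1'] _ _ _] := H1 (u k.+1) (y k.+1) (lt2 _ _ u1 q1) (lt2 _ _ y1 q1).
have [_ [eb2 eb2'] _ _ _] := H1 (u k.+2) (y k.+2) (lt2 _ _ u2 q1) (lt2 _ _ y2 q1).
have e0 : 0 <= local_err x y k.+1 by exact: normr_ge0.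
(* Without constraints the residual ignores mu, so the quadratic residual estimate becomes a
   quadratic error estimate. *)
have [m0|m0] := posnP m.
  left; apply: (@le_trans _ _ (C1 ^+ 3 * C0 * local_err x y k.+1 ^+ 2)); last first.
    by rewrite ler_wpM2r ?sqr_ge0// lerDr ltW.
  apply: le_trans eb2 _; rewrite (kkt_res_unconstrained _ _ 0 (nu k.+2) m0).
  apply: le_trans (ler_wpM2l (ltW C10) qd2) _.
  rewrite (kkt_res_unconstrained _ _ (nu k.+2) 0 m0).
  have -> : C1 ^+ 3 * C0 * local_err x y k.+1 ^+ 2 =
     C1 * (C0 * (C1 * local_err x y k.+1) ^+ 2) by ring.
  rewrite ler_wpM2l ?(ltW C10)// ler_wpM2l ?(ltW C00)//.
  by rewrite ler_sqr ?nnegrE// mulr_ge0// ltW.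
right; split.
  by apply: le_trans er2 _; rewrite ler_wpM2r ?(ltW (nup _))// lerDl ltW.
pose i := Ordinal m0.
have gy : `|cstr_val g c i (u k.+1) * y k.+1 0 i - nu k.+1| <= nu k.+1 / 2.
  have -> : cstr_val g c i (u k.+1) * y k.+1 0 i - nu k.+1 =
    (\row_j (cstr_val g c j (u k.+1) * y k.+1 0 j - nu k.+1)) 0 i by rewrite !mxE.
  apply: le_trans (mx_norm_ge _ _ _) _.
  by apply: le_trans (norm_row_mx_r (dual_res (u k.+1) (y k.+1)) _) hf1.
(* A single complementarity product stays at least half the barrier parameter; as it is an entry of
   the residual at 0, the error cannot be much smaller than mu. *)
have gy' : nu k.+1 / 2 <= cstr_val g c i (u k.+1) * y k.+1 0 i.
  move: gy; rewrite ler_distl => /andP[+ _]; apply: le_trans.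
  by rewrite -[X in X - _](mulfVK (_ : 2 != 0 :> R))// mulr_natr mulr2n addrK.
have res0 : cstr_val g c i (u k.+1) * y k.+1 0 i <= `|kkt_res (u k.+1) (y k.+1) 0|.
  apply: le_trans (ler_norm _) _.
  have -> : cstr_val g c i (u k.+1) * y k.+1 0 i =
    (\row_j (cstr_val g c j (u k.+1) * y k.+1 0 j - 0)) 0 i by rewrite !mxE subr0.
  apply: le_trans (mx_norm_ge _ _ _) _.
  exact: (norm_row_mx_r (dual_res (u k.+1) (y k.+1)) _).
have := le_trans gy' (le_trans res0 eb1'); rewrite ler_pdivrMr// mulrC mulrA => h.
by apply: le_trans h _; rewrite ler_wpM2r// lerDl ltW.
Qed.

End Run.

Lemma ratio_cvg0_le (R : realType) (a b : nat -> R) (eps : R) :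
  (forall k, 0 < b k) -> a k / b k @[k --> \oo] --> (0 : R) -> 0 < eps ->
  exists N, forall k, (N <= k)%N -> a k <= eps * b k.
Proof.
move=> b0 /cvgrPdist_le ab e0; have [N _ H] := ab _ e0; exists N => k Nk.
have := H k Nk; rewrite /= sub0r normrN => /(le_trans (ler_norm _)).
by rewrite ler_pdivrMr.
Qed.

(** * Rates of scalar error sequences *)

Section Rates.
Context (R : realType) (e nu : nat -> R) (C : R) (C0 : 0 < C).
Context (e0 : forall k, 0 <= e k) (nu0 : forall k, 0 < nu k).
Context (e_le : forall k, e k.+1 <= C * nu k.+1).
Context (e_step : forall k, e k.+2 <= C * e k.+1 ^+ 2 \/
  (e k.+2 <= C * nu k.+2 /\ nu k.+1 <= C * e k.+1)).
Context (nu_cvg : nu k @[k --> \oo] --> (0 : R)).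

Lemma rates_cvg (eps : R) : 0 < eps -> exists N, forall k, (N <= k)%N -> e k <= eps.
Proof.
move=> eps0; have ec0 : 0 < eps / C by rewrite divr_gt0.
move/cvgrPdist_le/(_ _ ec0) : nu_cvg => [N _ H]; exists N.+1 => -[//|k] Nk.
apply: le_trans (e_le k) _; rewrite mulrC -ler_pdivlMr//.
have := H k.+1 (ltnW Nk); rewrite /= sub0r normrN; exact/le_trans/ler_norm.
Qed.

(** In the quadratic case the small error is itself the contraction factor; otherwise the two-sided
    comparison of error and mu transfers the ratio of mu at the price of [C ^+ 2]. *)
Lemma rates_superlinear (eps : R) : nu k.+1 / nu k @[k --> \oo] --> (0 : R) ->
  0 < eps -> exists N, forall k, (N <= k)%N -> e k.+1 <= eps * e k.
Proof.
move=> A8 eps0; have ec0 : 0 < eps / C by rewrite divr_gt0.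
have ecc0 : 0 < eps / C ^+ 2 by rewrite divr_gt0// exprn_gt0.
have [N1 H1] := rates_cvg ec0; have [N2 H2] := ratio_cvg0_le nu0 A8 ecc0.
exists (maxn N1 N2).+1 => -[//|k]; rewrite ltnS geq_max => /andP[k1 k2].
case: (e_step k) => [h|[h1 h2]].
  apply: le_trans h _; rewrite expr2 mulrA ler_wpM2r//.
  by rewrite mulrC -ler_pdivlMr//; exact/H1/leqW.
apply: le_trans h1 _; apply: (@le_trans _ _ (C * (eps / C ^+ 2 * (C * e k.+1)))).
  rewrite ler_wpM2l ?(ltW C0)//; apply: le_trans (H2 _ (leqW k2)) _.
  by rewrite ler_wpM2l// ltW.
by rewrite le_eqVlt; apply/orP; left; apply/eqP; field; rewrite gt_eqF.
Qed.

(** A quadratic step has order [1 + r] once errors are at most 1, because [r < 1]; otherwise the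
    recursion for mu is inserted between the two comparisons, which produces the power of [C]. *)
Lemma rates_order (d r : R) : 0 < d -> 0 < r < 1 ->
  (forall k, nu k.+1 = d * nu k `^ (1 + r)) ->
  exists2 D, 0 < D & exists N, forall k, (N <= k)%N -> e k.+1 <= D * e k `^ (1 + r).
Proof.
move=> d0 /andP[r0 r1] nuS; have [N H] := rates_cvg ltr01.
have Cr0 : 0 < C `^ (1 + r) by exact: powR_gt0.
exists (C + C * d * C `^ (1 + r)); first by rewrite addr_gt0// !mulr_gt0.
exists N.+1 => -[//|k]; rewrite ltnS => Nk.
have ep := powR_ge0 (e k.+1) (1 + r).
case: (e_step k) => [h|[h1 h2]].
  apply: (@le_trans _ _ (C * e k.+1 `^ (1 + r))); last first.
    by rewrite ler_wpM2r// lerDl !mulr_ge0 ?(ltW C0) ?(ltW d0) ?(ltW Cr0).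
  apply: le_trans h _; rewrite ler_wpM2l ?(ltW C0)//.
  (* Monotonicity of real powers in the exponent is applied for a base in (0, 1], so zero error is
     treated apart. *)
  have [z|z] := eqVneq (e k.+1) 0; first by rewrite z expr0n powR_ge0.
  rewrite -powR_mulrn//; apply: ger_powR.
    by rewrite lt0r z e0 H// leqW.
  by rewrite -[2%:R]/(1 + 1) lerD2l ltW.
apply: (@le_trans _ _ (C * d * C `^ (1 + r) * e k.+1 `^ (1 + r))); last first.
  by rewrite ler_wpM2r// lerDr ltW.
apply: le_trans h1 _; rewrite nuS -!mulrA ler_wpM2l ?(ltW C0)// ler_wpM2l ?(ltW d0)//.
rewrite -powRM ?(ltW C0)//; apply: ge0_ler_powR; rewrite ?nnegrE//.
- by rewrite addr_ge0// ltW.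
- exact: ltW.
- by rewrite mulr_ge0// ltW.
Qed.

End Rates.
Theorem corollary5p2 (R : realType) (n m : nat) (M : riemannianManifold R n)
  (f : M -> R) (g : 'I_m -> M -> R) (Rt : M -> 'rV[R]_n -> M)
  (phiL phic phis : R -> R) (Delta_max Delta0 Delta_min : R)
  (xs : M) (ys : 'rV[R]_m) (mu : nat -> R)
  (M_connected : connected [set: M]) (M_complete : complete_manifold M)
  (f_C2 : Ck_fun (W := R^o) 2 [set: M] f)
  (g_C2 : forall i, Ck_fun (W := R^o) 2 [set: M] (g i))
  (Rt_retraction : retraction Rt)
  (phiL_forcing : forcing phiL) (phic_forcing : forcing phic)
  (phis_forcing : forcing phis)
  (Delta_max_gt0 : 0 < Delta_max)
  (Delta0_bnd : 0 < Delta0 <= Delta_max)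
  (Delta_min_bnd : 0 < Delta_min <= Delta_max)
  (mu_gt0 : forall k, 0 < mu k) (mu_cvg0 : mu k @[k --> \oo] --> (0 : R))
  (kkt : KKT f g xs ys)
  (A1 : [/\ strict_complementarity g xs ys, LICQ g xs & SOSC f g xs ys])
  (A2L : exists kl ku : R, [/\ 0 < kl, kl < 1, 1 < ku &
     forall k, kl * mu k.+1 <= phiL (mu k.+1) <= ku * mu k.+1])
  (A2c : exists kl ku : R, [/\ 0 < kl, kl < 1, 1 < ku &
     forall k, kl * mu k.+1 <= phic (mu k.+1) <= ku * mu k.+1])
  (A3 : mu k ^+ 2 / mu k.+1 @[k --> \oo] --> (0 : R))
  (A4 : \forall k \near \oo, mu k.+1 <= mu k)
  (A5 : second_order Rt)
  (A6f : pullback_Hess_lipschitz Rt xs f)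
  (A6g : forall i, pullback_Hess_lipschitz Rt xs (g i))
  (A8 : mu k.+1 / mu k @[k --> \oo] --> (0 : R))
  (A9f : Hess_lipschitz xs f)
  (A9g : forall i, Hess_lipschitz xs (g i)) :
  exists2 U : set (M * 'rV[R]_m), nbhs (xs, ys) U &
  exists2 delta : R, 0 < delta &
  forall (K : nat) (x : nat -> M) (y : nat -> 'rV[R]_m),
    let nu := fun k => mu (K + k)%N in
    U (x 0%N, y 0%N) -> nu 0%N < delta ->
    approx_stationary f g phiL phic (nu 0%N) (x 0%N) (y 0%N) ->
    outer_run f g Rt phiL phic phis Delta0 Delta_min nu x y ->
    [/\ x k @[k --> \oo] --> xs,
        y k @[k --> \oo] --> ys,
        forall psi, smooth_chart psi -> dom psi xs ->
          superlinear psi xs ys x y &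
        forall c r : R, 0 < c < 1 -> 0 < r < 1 -> 0 < mu 1%N <= 1 ->
          (forall k, mu k.+2 = c * mu k.+1 `^ (1 + r)) ->
          forall psi, smooth_chart psi -> dom psi xs ->
            order_at_least psi xs ys x y (1 + r)].
Proof.
have [sc licq sosc] := A1.
have phis_ge0 t : 0 <= t -> 0 <= phis t by case: phis_forcing => _ + _; apply.
have D0 : 0 < Delta0 by case/andP: Delta0_bnd.
have Dm : 0 < Delta_min by case/andP: Delta_min_bnd.
have [C [ra [delta [C0 ra0 d0 run]]]] := run_bounds f_C2 g_C2 Rt_retraction A5 kkt sc licq
  sosc A6f A6g phis_ge0 D0 Dm mu_gt0 A2L A2c A3 A4.
set c := chart_at xs in run; set us := here xs in run.
have ac : atlas c by exact: chart_at_atlas.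
have [odc oc _ ccoord cpt] := atlas_chart ac.
have cs : codom c us by exact: here_codom.
have pts : pt c us = xs by exact: pt_here.
exists [set p : M * 'rV[R]_m |
  [/\ dom c p.1, `|coord c p.1 - us| < ra & `|p.2 - ys| < ra]].
  (* A product neighbourhood; its first factor is the preimage of a ball under the chart, which is
     continuous at [xs]. *)
  exists ([set x | dom c x /\ `|coord c x - us| < ra], [set y | `|y - ys| < ra]).
    split=> /=.
      apply: filterI; first by apply: open_nbhs_nbhs; split => //; exact: chart_at_dom.
      have H : \forall u \near us, `|u - us| < ra by apply: (@norm_near _ _ us _ ra ra0).
      exact: (ccoord xs (chart_at_dom xs) _ H).
    by apply: (@norm_near _ _ ys _ ra ra0).
  by move=> [x y] /= [[dx ux] yy].
exists delta => // K x y nu [/= dx0 ux0 yy0] nu0 st out.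
have [K0 facts] := run K x y dx0 ux0 yy0 nu0 st out.
pose e k := local_err xs ys x y k.
have e0 k : 0 <= e k by exact: normr_ge0.
have nup k : 0 < nu k by exact: mu_gt0.
have e_le k : e k.+1 <= C * nu k.+1 by have [] := facts k.
have dx k : dom c (x k) by have [] := facts k.
have e_step k := let: And3 _ _ h := facts k in h.
have nu_cvg : nu k @[k --> \oo] --> (0 : R).
  have -> : nu = [sequence mu (k + K)%N]_k by apply/funext => k; rewrite /nu addnC.
  by have H := mu_cvg0; rewrite -(cvg_shiftn K) in H.
have nu_ratio : nu k.+1 / nu k @[k --> \oo] --> (0 : R).
  have -> : (fun k => nu k.+1 / nu k) = [sequence (mu (k + K).+1 / mu (k + K)%N)]_k.
    by apply/funext => k; rewrite /nu addnS addnC.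
  by have H := A8; rewrite -(cvg_shiftn K) in H.
have xE k : x k = pt c (coord c (x k)) by rewrite (coordK (atlas_chart ac)).
have ue k : `|coord c (x k) - us| <= e k by exact: norm_row_mx_l.
have ye k : `|y k - ys| <= e k by exact: norm_row_mx_r.
have ecvg := rates_cvg C0 e_le nu_cvg.
(* Convergence brings the iterates into the region where the two charts have comparable errors;
   hence the bound holds only from some index on. *)
have transfer psi : smooth_chart psi -> dom psi xs -> exists a b : R,
    [/\ 0 < a, 0 < b & exists N, forall k, (N <= k)%N ->
      a * e k <= chart_err psi xs ys x y k <= b * e k].
  move=> sp dp; have [|a [b [r [a0 b0 r0 H]]]] := @chart_err_equiv _ _ m _ psi c sp ac us cs _ ys.
    by rewrite pts.
  exists a, b; split => //; have r20 : 0 < r / 2 by rewrite divr_gt0.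
  have [N HN] := ecvg _ r20; exists N => k Nk.
  have := H (coord c (x k)) (y k); rewrite -xE pts; apply.
  apply: le_lt_trans (ue k) _; apply: le_lt_trans (HN k Nk) _.
  by rewrite ltr_pdivrMr// ltr_pMr// ltr1n.
split.
- move=> A nA; have nA' : nbhs us (pt c @^-1` A) by apply: (cpt us cs); rewrite pts.
  have [r r0 rP] := near_norm nA'; have r20 : 0 < r / 2 by rewrite divr_gt0.
  have [N HN] := ecvg _ r20; exists N => // k Nk /=.
  rewrite xE; apply: rP; apply: le_lt_trans (ue k) _; apply: le_lt_trans (HN k Nk) _.
  by rewrite ltr_pdivrMr// ltr_pMr// ltr1n.
- apply/cvgrPdist_le => t t0; have [N HN] := ecvg _ t0; exists N => // k Nk /=.
  by rewrite distrC; exact: le_trans (ye k) (HN k Nk).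
- move=> psi sp dp t t0; have [a [b [a0 b0 [N1 H1]]]] := transfer psi sp dp.
  (* The contraction factor in the chart [c] is shrunk by [a / b] to compensate for passing to [psi]
     and back. *)
  have tab0 : 0 < t * a / b by rewrite divr_gt0// mulr_gt0.
  have [N2 H2] := rates_superlinear C0 e0 nup e_le e_step nu_cvg nu_ratio tab0.
  exists (maxn N1 N2) => // k /=; rewrite geq_max => /andP[k1 k2].
  have /andP[_ h1] := H1 k.+1 (leqW k1); have /andP[h2 _] := H1 k k1.
  apply: le_trans h1 _; apply: (@le_trans _ _ (b * (t * a / b * e k))).
    by rewrite ler_wpM2l ?(ltW b0)//; exact: H2.
  have -> : b * (t * a / b * e k) = t * (a * e k) by field; rewrite gt_eqF.
  by rewrite ler_wpM2l// ltW.
move=> d r /andP[d00 d1] r01 _ sched psi sp dp.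
have [a [b [a0 b0 [N1 H1]]]] := transfer psi sp dp.
(* The update rule is given from [mu 1] on; it covers every step of the run because [K] is
   positive. *)
have nuS k : nu k.+1 = d * nu k `^ (1 + r).
  by rewrite /nu addnS -(prednK K0) addSn sched.
have [D D0' [N2 H2]] := rates_order C0 e0 nup e_le e_step nu_cvg d00 r01 nuS.
have r10 : 0 <= 1 + r by case/andP: r01 => r0 _; rewrite addr_ge0// ltW.
exists (b * D * (a^-1) `^ (1 + r)).
  by rewrite !mulr_ge0 ?(ltW b0) ?(ltW D0')// powR_ge0.
exists (maxn N1 N2) => // k /=; rewrite geq_max => /andP[k1 k2].
have /andP[_ h1] := H1 k.+1 (leqW k1); have /andP[h2 _] := H1 k k1.
apply: le_trans h1 _; rewrite -!mulrA ler_wpM2l ?(ltW b0)//.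
apply: le_trans (H2 k k2) _; rewrite ler_wpM2l ?(ltW D0')//.
have c0 : 0 <= chart_err psi xs ys x y k by exact: sqrtr_ge0.
rewrite -powRM ?invr_ge0 ?(ltW a0)//; apply: ge0_ler_powR; rewrite ?nnegrE//.
  by rewrite mulr_ge0// invr_ge0 ltW.
by rewrite ler_pdivlMl.
Qed.
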